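(* Let $(X,\mathscr F,\mu,T)$ be an ergodic system, $\mathcal C$ a space of measurable cocycles, $\Xi$ a set of observables, $\mathscr P$ a set of LDT parameters with corresponding spaces of deviation functions $\mathscr E$ and $\mathscr I$ (all in the sense defined in the context), and let $1<p\le\infty$. Assume: (1) $\Xi$ is compatible with every cocycle $A\in\mathcal C$; (2) every observable $\xi\in\Xi$ satisfies a base-LDT; (3) every $A\in\mathcal C$ with $L_1(A)>-\infty$ is uniformly $L^p$-bounded; (4) every cocycle $A\in\mathcal C$ for which $L_1(A)>L_2(A)$ satisfies a uniform fiber-LDT. Then for all $m\ge 1$ and all $1\le k\le m$ the Lyapunov exponent $L_k:\mathcal C_m\to[-\infty,\infty)$ is a continuous function of the cocycle. Moreover, given $A\in\mathcal C_m$ and $1\le k<m$ with $L_k(A)>L_{k+1}(A)$, the map $\Lambda_k:=L_1+L_2+\dots+L_k$ has, locally near $A$, the modulus of continuity $\omega(h):=\big[\iota\big(c\log\tfrac1h\big)\big]^{1-1/p}$ for some $\iota=\iota(A)\in\mathscr I$ and some $c=c(A)>0$; that is, there are $\delta>0$, $\iota\in\mathscr I$ and $c>0$, depending on $A$, such that $|\Lambda_k(B_1)-\Lambda_k(B_2)|\le\omega(\mathrm{dist}(B_1,B_2))$ for all $B_1,B_2\in\mathcal C_m$ with $\mathrm{dist}(B_i,A)<\delta$, $i=1,2$ (with $\omega(0)=0$; for $p=\infty$ the exponent $1-1/p$ is $1$).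
   Context: Ergodic system: a probability space $(X,\mathscr F,\mu)$ with an ergodic measure preserving map $T:X\to X$. $\mathrm{Mat}_m(\mathbb R)$ denotes the $m\times m$ real matrices, $\|\cdot\|$ the operator norm, $s_1(g)\ge\dots\ge s_m(g)\ge0$ the singular values of $g$ (so $s_1(g)=\|g\|$), and $\wedge_k g$ the $k$-th exterior power. Space of measurable cocycles: a class $\mathcal C$ of functions $A:X\to\mathrm{Mat}_m(\mathbb R)$ ($m\in\mathbb N$ not fixed) such that each $A\in\mathcal C$ is $\mathscr F$-measurable, $\|A\|\in L^\infty(\mu)$, and $\wedge_kA:X\to\mathrm{Mat}_{\binom mk}(\mathbb R)$ is in $\mathcal C$ for all $k\le m$. Each $\mathcal C_m:=\{A\in\mathcal C: A:X\to\mathrm{Mat}_m(\mathbb R)\}$ is endowed with a distance $\mathrm{dist}$ such that $\mathrm{dist}(B,A)\ge\|B-A\|_{L^\infty}$, and the maps $\mathcal C_m\ni A\mapsto\wedge_kA\in\mathcal C_{\binom mk}$ are locally Lipschitz. Iterates: $A^{(n)}(x)=A(T^{n-1}x)\cdots A(Tx)A(x)$, $A^{(0)}=I$. Lyapunov exponents: $L_k(A)=\lim_{n\to\infty}\int_X\frac1n\log s_k[A^{(n)}(x)]\,\mu(dx)\in[-\infty,\infty)$, $1\le k\le m$, so $L_1(A)\ge\dots\ge L_m(A)$. Finite scale exponent: $L_1^{(n)}(A)=\int_X\frac1n\log\|A^{(n)}(x)\|\,\mu(dx)$. Uniform $L^p$-boundedness: $A\in\mathcal C_m$ is uniformly $L^p$-bounded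 if there are $\delta>0$ and $C<\infty$ such that $\big\|\frac1n\log\|B^{(n)}(\cdot)\|\big\|_{L^p}<C$ for all $B\in\mathcal C_m$ with $\mathrm{dist}(B,A)<\delta$ and all $n\ge1$. Observables and compatibility: $\Xi$ is a set of measurable functions $\xi:X\to\mathbb R$. For $A\in\mathcal C$ and $N\in\mathbb N$, $\mathscr F_N(A)$ is the algebra of sets generated by the sets $\{x:\|A^{(n)}(x)\|\le c\}$ and $\{x:\|A^{(n)}(x)\|\ge c\}$, $c\ge0$, $0\le n\le N$. $\Xi$ and $A$ are compatible if for every $N\in\mathbb N$, $F\in\mathscr F_N(A)$ and $\epsilon>0$ there is $\xi\in\Xi$ with $\mathbf 1_F\le\xi$ and $\int_X\xi\,d\mu\le\mu(F)+\epsilon$. Deviation functions and LDT parameters: $\mathscr E$ is a set of non-increasing functions $e:(0,\infty)\to(0,\infty)$ (deviation sizes). $\mathscr I$ is a set of functions $\iota:(0,\infty)\to(0,\infty)$ (deviation set measures), each continuous and strictly decreasing to $0$ as $t\to\infty$, with $\log t\lesssim\log\frac1{\iota(t)}\lesssim t$ as $t\to\infty$ ($\lesssim$ means $\le$ up to a positive multiplicative constant), and such that the inverse $\phi_\iota$ of $\psi_\iota(t):=t\,[\iota(t)]^{-1/2}$ satisfies $\limsup_{t\to\infty}\phi_\iota(2t)/\phi_\iota(t)<2$. $\mathscr I$ is a convex cone: $a\iota\in\mathscr I$ and $\iota_1+\iota_2\in\mathscr I$ for $a>0$, $\iota,\iota_1,\iota_2\in\mathscr I$. $\mathscr P$ is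 a set of triplets $(\underline{n_0},e,\iota)$ with $\underline{n_0}\in\mathbb N$, $e\in\mathscr E$, $\iota\in\mathscr I$, such that for all $\epsilon>0$ there is $(\underline{n_0},e,\iota)\in\mathscr P$ with $e(\underline{n_0})\le\epsilon$. Write $e_n:=e(n)$, $\iota_n:=\iota(n)$. Base-LDT: $\xi$ (with $\int_X\xi\,d\mu$ finite) satisfies a base-LDT if for every $\epsilon>0$ there is $(\underline{n_0},e,\iota)\in\mathscr P$ such that for all $n\ge\underline{n_0}$: $e_n\le\epsilon$ and $\mu\{x:|\frac1n\sum_{j=0}^{n-1}\xi(T^jx)-\int_X\xi\,d\mu|>e_n\}<\iota_n$. Uniform fiber-LDT: $A\in\mathcal C_m$ satisfies a uniform fiber-LDT if for every $\epsilon>0$ there are $\delta>0$ and $(\underline{n_0},e,\iota)\in\mathscr P$ (depending on $A,\epsilon$) such that for all $B\in\mathcal C_m$ with $\mathrm{dist}(B,A)<\delta$ and all $n\ge\underline{n_0}$: $e_n\le\epsilon$ and $\mu\{x:|\frac1n\log\|B^{(n)}(x)\|-L_1^{(n)}(B)|>e_n\}<\iota_n$. *)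

(* Defs.v *)
From HB Require Import structures.
From mathcomp Require Import all_boot all_order all_algebra.
From mathcomp Require Import all_classical all_reals all_analysis.
From mathcomp Require Import complex.

Set Implicit Arguments.
Unset Strict Implicit.
Unset Printing Implicit Defensive.
Import Order.TTheory GRing.Theory Num.Theory.
Import numFieldNormedType.Exports.
Local Open Scope classical_set_scope.
Local Open Scope ring_scope.

Section MatrixNorm.
Context {R : realType}.

Definition enorm (n : nat) (v : 'cV[R]_n) : R :=
  Num.sqrt (\sum_(i < n) v i ord0 ^+ 2).

Definition opnorm (m : nat) (g : 'M[R]_m) : R :=
  sup [set enorm (g *m v) | v in [set v : 'cV[R]_m | enorm v <= 1]].

(* The multiplicities are those of the roots of the characteristic polynomial
   of g^T g; comparing degrees gives [size s = m]. *)
Definition is_singular_values (m : nat) (g : 'M[R]_m) (s : seq R) : Prop :=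
  [/\ sorted >=%R s, all (fun t => 0 <= t) s
    & char_poly (g^T *m g) = \prod_(t <- s) ('X - (t ^+ 2)%:P)].

Definition singular_values (m : nat) (g : 'M[R]_m) : seq R :=
  xget [::] (is_singular_values g).

(* The s_k of the literature: k is counted from 1. *)
Definition singval (m : nat) (k : nat) (g : 'M[R]_m) : R :=
  (singular_values g)`_k.-1.

End MatrixNorm.

Section SingularValuesExist.
Context {R : realType}.
Local Open Scope complex_scope.
Local Notation toC := (@real_complex R).

Let gram_eigenvalue (m : nat) (g : 'M[R]_m) (z : R[i]) :
  root (char_poly (map_mx toC (g^T *m g))) z -> 0 <= z.
Proof.
rewrite -eigenvalue_root_char => /eigenvalueP[v vE v0].
set G := map_mx toC g.
have normE n (w : 'rV[R[i]]_n) :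
    (w *m (map_mx conjc w)^T) 0 0 = \sum_i `|w 0 i| ^+ 2.
  by rewrite mxE; apply: eq_bigr => i _; rewrite !mxE normCK.
have Gconj : map_mx conjc G = G.
  by apply/matrixP => i j; rewrite !mxE conjc_real.
have e1 : v *m map_mx toC (g^T *m g) *m (map_mx conjc v)^T =
    (v *m G^T) *m (map_mx conjc (v *m G^T))^T.
  have -> : map_mx conjc (v *m G^T) = map_mx conjc v *m G^T.
    by rewrite map_mxM -[in RHS]Gconj map_trmx.
  by rewrite map_mxM map_trmx -/G trmx_mul trmxK !mulmxA -!map_trmx.
have := normE _ (v *m G^T); rewrite -e1 vE -scalemxAl mxE normE => e2.
have vpos : 0 < \sum_i `|v 0 i| ^+ 2.
  rewrite lt_neqAle sumr_ge0 ?andbT; last by move=> i _; rewrite exprn_ge0.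
  rewrite eq_sym psumr_eq0; last by move=> i _; rewrite exprn_ge0.
  apply: contraNN v0 => /allP h; apply/eqP/rowP => i; rewrite mxE.
  by apply/eqP; rewrite -normr_eq0 -sqrf_eq0; apply: h; rewrite mem_index_enum.
have : 0 <= z * \sum_i `|v 0 i| ^+ 2.
  by rewrite e2 sumr_ge0 // => i _; rewrite exprn_ge0.
by rewrite pmulr_lge0.
Qed.

Lemma singular_valuesP (m : nat) (g : 'M[R]_m) :
  is_singular_values g (singular_values g).
Proof.
apply: xgetPex.
have [r rE] := closed_field_poly_normal (char_poly (map_mx toC (g^T *m g))).
have mon := char_poly_monic (map_mx toC (g^T *m g)).
rewrite (monicP mon) scale1r in rE.
have rge0 z : z \in r -> 0 <= z.
  by move=> zr; apply: (@gram_eigenvalue _ g); rewrite rE root_prod_XsubC.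
pose s := sort >=%R [seq Num.sqrt (complex.Re z) | z <- r].
exists s; split.
- by apply: sort_sorted => x y; exact: (le_total y x).
- by rewrite all_sort; apply/allP => _ /mapP[z _ ->]; rewrite sqrtr_ge0.
apply: (@map_poly_inj _ _ toC).
rewrite map_char_poly rE rmorph_prod /=.
have sr : perm_eq s [seq Num.sqrt (complex.Re z) | z <- r] by rewrite perm_sort.
rewrite (perm_big _ sr) /=.
rewrite big_map; apply: eq_big_seq => z /rge0 z0.
rewrite rmorphB /= map_polyX map_polyC /=; congr (_ - _%:P).
move: z0; case: z => a b; rewrite lecE /= => /andP[/eqP -> a0].
by rewrite sqr_sqrtr.
Qed.

End SingularValuesExist.

Section ExteriorPower.
Variables m k : nat.

Definition ktuples : {set k.-tuple 'I_m} :=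
  [set t : k.-tuple 'I_m | sorted ltn [seq val i | i <- t]].

Lemma card_ktuples : #|ktuples| = 'C(m, k).
Proof. exact: card_ltn_sorted_tuples. Qed.

Definition ktuple (i : 'I_('C(m, k))) : k.-tuple 'I_m :=
  @Order.enum_val _ (k.-tuplelexi 'I_m) (mem ktuples)
    (cast_ord (esym card_ktuples) i).

(* The matrix of the k-th exterior power in the basis
   e_{i_1} /\ ... /\ e_{i_k}, i_1 < ... < i_k, ordered lexicographically, i.e.
   the k-th compound matrix. *)
Definition extmx {R : realType} (g : 'M[R]_m) : 'M[R]_('C(m, k)) :=
  \matrix_(i, j) \det (mxsub (tnth (ktuple i)) (tnth (ktuple j)) g).

End ExteriorPower.

Section Cocycles.
Context {d : measure_display} {X : measurableType d} {R : realType}.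
Variables (mu : probability X R) (T : X -> X).

Definition measure_preserving : Prop :=
  measurable_fun [set: X] T /\
  forall F : set X, measurable F -> mu (T @^-1` F) = mu F.

Definition ergodic : Prop :=
  measure_preserving /\
  forall F : set X, measurable F -> T @^-1` F = F -> mu F = 0%E \/ mu F = 1%E.

Definition Linfty_norm (m : nat) (A : X -> 'M[R]_m) : \bar R :=
  ('N[mu]_(+oo)[(fun x => (opnorm (A x))%:E)])%E.

Definition ext_cocycle (m k : nat) (A : X -> 'M[R]_m) : X -> 'M[R]_('C(m, k)) :=
  fun x => extmx k (A x).

(* [dist] is a distance up to equality almost everywhere, so both readings of
   the elements of C (functions, or functions modulo null sets) are covered.
   [C 0] is unconstrained: dimensions are positive. *)
Record cocycle_space (C : forall m : nat, set (X -> 'M[R]_m))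
    (dist : forall m : nat, (X -> 'M[R]_m) -> (X -> 'M[R]_m) -> R) : Prop := {
  cocycle_measurable : forall (m : nat) (A : X -> 'M[R]_m), (0 < m)%N ->
    C m A -> forall i j : 'I_m, measurable_fun [set: X] (fun x => A x i j) ;
  cocycle_bounded : forall (m : nat) (A : X -> 'M[R]_m), (0 < m)%N ->
    C m A -> (Linfty_norm A < +oo)%E ;
  cocycle_ext : forall (m k : nat) (A : X -> 'M[R]_m), (0 < k <= m)%N ->
    C m A -> C 'C(m, k) (ext_cocycle k A) ;
  cocycle_dist_ge0 : forall (m : nat) (A B : X -> 'M[R]_m), (0 < m)%N ->
    C m A -> C m B -> 0 <= dist m A B ;
  cocycle_dist_refl : forall (m : nat) (A : X -> 'M[R]_m), (0 < m)%N ->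
    C m A -> dist m A A = 0 ;
  cocycle_dist_sep : forall (m : nat) (A B : X -> 'M[R]_m), (0 < m)%N ->
    C m A -> C m B -> dist m A B = 0 -> {ae mu, forall x, A x = B x} ;
  cocycle_dist_sym : forall (m : nat) (A B : X -> 'M[R]_m), (0 < m)%N ->
    C m A -> C m B -> dist m A B = dist m B A ;
  cocycle_dist_triangle : forall (m : nat) (A B D : X -> 'M[R]_m), (0 < m)%N ->
    C m A -> C m B -> C m D -> dist m A D <= dist m A B + dist m B D ;
  cocycle_dist_Linfty : forall (m : nat) (A B : X -> 'M[R]_m), (0 < m)%N ->
    C m A -> C m B ->
    (Linfty_norm (fun x => (B x - A x)%R) <= (dist m B A)%:E)%E ;
  cocycle_ext_lipschitz : forall (m k : nat) (A : X -> 'M[R]_m),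
    (0 < k <= m)%N -> C m A ->
    exists delta K : R, 0 < delta /\
      forall B1 B2 : X -> 'M[R]_m, C m B1 -> C m B2 ->
      dist m B1 A < delta -> dist m B2 A < delta ->
      dist 'C(m, k) (ext_cocycle k B1) (ext_cocycle k B2) <= K * dist m B1 B2
}.

Fixpoint iterate (m : nat) (A : X -> 'M[R]_m) (n : nat) (x : X) : 'M[R]_m :=
  if n is n'.+1 then A (iter n' T x) *m iterate A n' x else 1%:M.

(* [lne] is the logarithm on \bar R, with [lne 0 = -oo]. *)
Definition log_growth (m : nat) (A : X -> 'M[R]_m) (n : nat) (x : X) : \bar R :=
  ((n%:R^-1)%:E * lne (opnorm (iterate A n x))%:E)%E.

Definition lyap1_fin (m : nat) (n : nat) (A : X -> 'M[R]_m) : \bar R :=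
  (\int[mu]_x log_growth A n x)%E.

Definition lyap (m : nat) (k : nat) (A : X -> 'M[R]_m) : \bar R :=
  limn (fun n : nat =>
    (\int[mu]_x ((n%:R^-1)%:E * lne (singval k (iterate A n x))%:E))%E).

Definition lyap_sum (m : nat) (k : nat) (A : X -> 'M[R]_m) : \bar R :=
  (\sum_(1 <= j < k.+1) lyap j A)%E.

Definition unif_Lp_bounded (C : forall m : nat, set (X -> 'M[R]_m))
    (dist : forall m : nat, (X -> 'M[R]_m) -> (X -> 'M[R]_m) -> R)
    (p : \bar R) (m : nat) (A : X -> 'M[R]_m) : Prop :=
  exists delta K : R, 0 < delta /\
    forall B : X -> 'M[R]_m, C m B -> dist m B A < delta ->
    forall n : nat, (0 < n)%N -> ('N[mu]_p[log_growth B n] < K%:E)%E.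

Definition set_algebra (G : set (set X)) : Prop :=
  [/\ G [set: X], setC_closed G & setU_closed G].

Definition norm_algebra (m : nat) (A : X -> 'M[R]_m) (N : nat) : set (set X) :=
  smallest set_algebra
    [set F | exists n (c : R), [/\ (n <= N)%N, 0 <= c &
       F = [set x | opnorm (iterate A n x) <= c] \/
       F = [set x | opnorm (iterate A n x) >= c]]].

Definition compatible (Xi : set (X -> R)) (m : nat) (A : X -> 'M[R]_m) : Prop :=
  forall (N : nat) (F : set X) (eps : R), norm_algebra A N F -> 0 < eps ->
  exists xi : X -> R, [/\ Xi xi, forall x, \1_F x <= xi x &
    (\int[mu]_x (xi x)%:E <= mu F + eps%:E)%E].

End Cocycles.

(* Functions on (0, +oo) are represented by functions on R; their values
   outside (0, +oo) are never constrained. *)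
Section DeviationFunctions.
Context {R : realType}.

Definition deviation_size (e : R -> R) : Prop :=
  (forall t : R, 0 < t -> 0 < e t) /\
  (forall s t : R, 0 < s -> s <= t -> e t <= e s).

Definition psi (iota : R -> R) (t : R) : R := t * (iota t) `^ (- 2^-1).

(* psi is a bijection of (0, +oo) when iota is a positive, continuous and
   decreasing function. *)
Definition phi (iota : R -> R) : R -> R :=
  'pinv_(fun=> 0) [set t : R | 0 < t] (psi iota).

Record deviation_measure (iota : R -> R) : Prop := {
  devm_gt0 : forall t : R, 0 < t -> 0 < iota t ;
  devm_cont : forall t : R, 0 < t -> {for t, continuous iota} ;
  devm_decr : forall s t : R, 0 < s -> s < t -> iota t < iota s ;
  devm_cvg0 : iota t @[t --> +oo] --> 0 ;
  devm_log : exists2 K : R, 0 < K &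
    \forall t \near +oo, ln t <= K * ln (1 / iota t) ;
  devm_lin : exists2 K : R, 0 < K &
    \forall t \near +oo, ln (1 / iota t) <= K * t ;
  devm_phi : (limf_esup (fun t : R => (phi iota (2 * t) / phi iota t)%:E)
                (pinfty_nbhs R) < 2%:E)%E
}.

Record LDT_parameters (E I : set (R -> R))
    (P : set (nat * (R -> R) * (R -> R))) : Prop := {
  ldt_size : forall e, E e -> deviation_size e ;
  ldt_measure : forall iota, I iota -> deviation_measure iota ;
  ldt_scale : forall (a : R) iota, 0 < a -> I iota -> I (fun t => a * iota t) ;
  ldt_add : forall iota1 iota2, I iota1 -> I iota2 ->
    I (fun t => iota1 t + iota2 t) ;
  ldt_triplet : forall n0 e iota, P (n0, e, iota) ->
    [/\ (0 < n0)%N, E e & I iota] ;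
  ldt_small : forall eps : R, 0 < eps ->
    exists n0 e iota, P (n0, e, iota) /\ e n0%:R <= eps
}.

(* The exponent 1 - 1/p is computed in \bar R, where (+oo)^-1 = 0. *)
Definition modulus (p : \bar R) (iota : R -> R) (c h : R) : R :=
  if h == 0 then 0 else iota (c * ln (1 / h)) `^ fine (1 - p^-1)%E.

End DeviationFunctions.

Section LargeDeviations.
Context {d : measure_display} {X : measurableType d} {R : realType}.
Variables (mu : probability X R) (T : X -> X).
Variable P : set (nat * (R -> R) * (R -> R)).

Definition base_LDT (xi : X -> R) : Prop :=
  mu.-integrable [set: X] (EFin \o xi) /\
  forall eps : R, 0 < eps ->
  exists n0 e iota, P (n0, e, iota) /\
    forall n : nat, (n0 <= n)%N -> e n%:R <= eps /\
      (mu [set x | (`|n%:R^-1 * \sum_(0 <= j < n) xi (iter j T x)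
                     - \int[mu]_y xi y| > e n%:R)%R] < (iota n%:R)%:E)%E.

Definition unif_fiber_LDT (C : forall m : nat, set (X -> 'M[R]_m))
    (dist : forall m : nat, (X -> 'M[R]_m) -> (X -> 'M[R]_m) -> R)
    (m : nat) (A : X -> 'M[R]_m) : Prop :=
  forall eps : R, 0 < eps ->
  exists delta n0 e iota, [/\ (0 : R) < delta, P (n0, e, iota) &
    forall B : X -> 'M[R]_m, C m B -> dist m B A < delta ->
    forall n : nat, (n0 <= n)%N -> e n%:R <= eps /\
      (mu [set x | `|log_growth T B n x - lyap1_fin mu T n B| > (e n%:R)%:E]
         < (iota n%:R)%:E)%E].

End LargeDeviations.

(* Main.v *)
(* For a cocycle A with L_1(A) > L_2(A) put l_n(B) := L_1^(n)(B) for B near A.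
   Off a set of measure of order iota(n), the norm of B^(n) is close to
   exp(n l_n(B)) by the fiber-LDT, and the second exterior power of B^(n) is
   exponentially smaller than its square: this last fact comes from the base-LDT
   applied to observables dominating the level sets of the norm of an iterate of
   the exterior square of A. Four consecutive blocks then satisfy
     log|g3 g2 g1 g0| + log|g2| + log|g1| = log|g3 g2| + log|g2 g1| + log|g1 g0|
   up to an exponentially small error, and integrating (the exceptional set is
   absorbed by Hoelder's inequality) shows that v(n) := 2 l_{2n} - l_n changes by
   O(iota(cn)^(1-1/p)) from n to 2n. The condition on phi_iota says that
   iota(2t) <= q iota(t) with q < 1 for large t, so these errors are summable along
   n, 2n, 4n, ... and |L_1(B) - v(n)| = O(iota(cn)^(1-1/p)), uniformly near A.
   At scale n, l_n(B) varies by as little when B moves by exp(-Cn); choosing n of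
   order log(1/h) gives the modulus of continuity of L_1, and that of Lambda_k
   follows by applying this to the k-th exterior power.
   For continuity, every Lambda_k is upper semicontinuous by subadditivity, and
   lower semicontinuous at gaps by the above and at k = m because the determinant
   is a one-dimensional cocycle; monotonicity of the exponents does the rest. *)

Require Import Defs.
From HB Require Import structures.
From mathcomp Require Import all_boot all_order all_algebra.
From mathcomp Require Import all_classical all_reals all_analysis.
From mathcomp Require Import fingroup perm measurable_realfun ess_sup_inf ring lra zify.

Set Implicit Arguments.
Unset Strict Implicit.
Unset Printing Implicit Defensive.
Import Order.TTheory GRing.Theory Num.Theory.
Import numFieldNormedType.Exports.
Local Open Scope classical_set_scope.
Local Open Scope ring_scope.

(** * Operator norms, singular values and exterior powers *)

(** The obstacle is that a cocycle B near A comes with no lower bound: upper bounds on its exponents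
    are inherited from A by subadditivity, but neither L_1(B) close to L_1(A) nor a gap of B is
    known. The block estimate at scale n only asks that l_{2n}(B) be not far below L_1(A). At one
    scale this follows from closeness to A, and the estimate itself hands it on from n to 2n;
    summability of the errors keeps the total loss bounded, so no gap of B is ever assumed. For the
    exterior square only an upper deviation estimate is used. Such an estimate is one-sided and asks
    for no gap of the exterior square, which is why observables lying above indicator functions are
    enough for it. Each doubling involves four blocks of length n and three of length 2n, hence
    seven exceptional sets whatever n is, and its error stays within a fixed multiple of
    iota(cn)^(1-1/p). Integrals of log norms may be -oo, so subadditivity and the identities among
    exponents are proved in [-oo, +oo); finiteness near A enters only with the L^p bound. *)

Section EuclideanNorm.
Context {R : realType}.
Implicit Types (m n : nat).

Lemma enorm_ge0 n (v : 'cV[R]_n) : 0 <= enorm v.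
Proof. exact: sqrtr_ge0. Qed.

Definition dotmx n (u v : 'cV[R]_n) : R := (u^T *m v) 0 0.

Lemma dotmxC n (u v : 'cV[R]_n) : dotmx u v = dotmx v u.
Proof. by rewrite /dotmx -[u^T *m v]trmxK trmx_mul trmxK mxE. Qed.

Lemma dotmxDr n (u v w : 'cV[R]_n) : dotmx u (v + w) = dotmx u v + dotmx u w.
Proof. by rewrite /dotmx mulmxDr mxE. Qed.

Lemma dotmxDl n (u v w : 'cV[R]_n) : dotmx (v + w) u = dotmx v u + dotmx w u.
Proof. by rewrite dotmxC dotmxDr !(dotmxC u). Qed.

Lemma dotmxZr n a (u v : 'cV[R]_n) : dotmx u (a *: v) = a * dotmx u v.
Proof. by rewrite /dotmx -scalemxAr mxE. Qed.

Lemma dotmxZl n a (u v : 'cV[R]_n) : dotmx (a *: u) v = a * dotmx u v.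
Proof. by rewrite dotmxC dotmxZr dotmxC. Qed.

Lemma enorm_sqr n (v : 'cV[R]_n) : enorm v ^+ 2 = dotmx v v.
Proof.
rewrite /dotmx sqr_sqrtr ?sumr_ge0// => [|i _]; last exact: sqr_ge0.
by rewrite mxE; apply: eq_bigr => i _; rewrite mxE expr2.
Qed.

Lemma enorm0 n : enorm (0 : 'cV[R]_n) = 0.
Proof. by rewrite /enorm big1 ?sqrtr0// => i _; rewrite mxE expr0n. Qed.

Lemma enormZ n a (v : 'cV[R]_n) : enorm (a *: v) = `|a| * enorm v.
Proof.
apply/eqP; rewrite -(@eqrXn2 _ 2)// ?mulr_ge0 ?enorm_ge0//.
by rewrite exprMn !enorm_sqr dotmxZl dotmxZr real_normK ?num_real// mulrA expr2.
Qed.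

Lemma enorm_eq0 n (v : 'cV[R]_n) : (enorm v == 0) = (v == 0).
Proof.
apply/idP/eqP => [|->]; last by rewrite enorm0.
rewrite sqrtr_eq0 => v0.
have : \sum_(i < n) v i ord0 ^+ 2 == 0.
  by rewrite eq_le v0 sumr_ge0// => i _; exact: sqr_ge0.
rewrite psumr_eq0 => [/allP h|i _]; last exact: sqr_ge0.
apply/colP => i; rewrite mxE; apply/eqP; rewrite -sqrf_eq0.
by apply: h; rewrite mem_index_enum.
Qed.

Lemma enorm_coord n (v : 'cV[R]_n) i : `|v i ord0| <= enorm v.
Proof.
rewrite -sqrtr_sqr /enorm ler_wsqrtr// (bigD1 i)//= lerDl sumr_ge0// => j _.
exact: sqr_ge0.
Qed.

Lemma cauchy_schwarz n (u v : 'cV[R]_n) : dotmx u v <= enorm u * enorm v.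
Proof.
have [/eqP|u0] := eqVneq (enorm u) 0.
  by rewrite enorm_eq0 => /eqP ->; rewrite /dotmx trmx0 mul0mx mxE enorm0 mul0r.
have [/eqP|v0] := eqVneq (enorm v) 0.
  by rewrite enorm_eq0 => /eqP ->; rewrite /dotmx mulmx0 mxE enorm0 mulr0.
have up : 0 < enorm u by rewrite lt_def u0 enorm_ge0.
have vp : 0 < enorm v by rewrite lt_def v0 enorm_ge0.
have := sqr_ge0 (enorm (enorm v *: u + (- enorm u) *: v)).
rewrite enorm_sqr !(dotmxDl, dotmxDr, dotmxZl, dotmxZr) -!enorm_sqr.
rewrite (dotmxC v u) => h.
have {}h : 0 <= (enorm u * enorm v) * (enorm u * enorm v - dotmx u v) by lra.
by rewrite pmulr_rge0 ?mulr_gt0// subr_ge0 in h.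
Qed.

Lemma enormD n (u v : 'cV[R]_n) : enorm (u + v) <= enorm u + enorm v.
Proof.
rewrite -(@ler_pXn2r _ 2)// ?nnegrE ?addr_ge0 ?enorm_ge0//.
rewrite enorm_sqr !(dotmxDl, dotmxDr) -!enorm_sqr (dotmxC v u).
have := cauchy_schwarz u v; lra.
Qed.

Lemma enorm_orthogonal n (Q : 'M[R]_n) (v : 'cV[R]_n) :
  Q^T *m Q = 1%:M -> enorm (Q *m v) = enorm v.
Proof.
move=> hQ; apply/eqP; rewrite -(@eqrXn2 _ 2)// ?enorm_ge0// !enorm_sqr.
by rewrite /dotmx trmx_mul mulmxA -(mulmxA v^T) hQ mulmx1.
Qed.

Lemma enorm_le_sum n (v : 'cV[R]_n) : enorm v <= \sum_i `|v i ord0|.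
Proof.
rewrite -(@ler_pXn2r _ 2)// ?nnegrE ?sumr_ge0 ?enorm_ge0//.
rewrite sqr_sqrtr ?sumr_ge0// => [|i _]; last exact: sqr_ge0.
rewrite expr2 mulr_suml ler_sum// => i _.
rewrite -real_normK ?num_real// expr2 ler_wpM2l// (bigD1 i)//= lerDl.
by rewrite sumr_ge0.
Qed.

End EuclideanNorm.

Section OperatorNorm.
Context {R : realType}.
Implicit Types (m n : nat).

Let img m (g : 'M[R]_m) :=
  [set enorm (g *m v) | v in [set v : 'cV[R]_m | enorm v <= 1]].

Let enorm_mulmx_sum m (g : 'M[R]_m) (v : 'cV[R]_m) :
  enorm (g *m v) <= (\sum_i \sum_j `|g i j|) * enorm v.
Proof.
apply: le_trans (enorm_le_sum _) _; rewrite mulr_suml ler_sum// => i _.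
rewrite mxE mulr_suml (le_trans (ler_norm_sum _ _ _))// ler_sum// => j _.
by rewrite normrM ler_wpM2l// enorm_coord.
Qed.

Let img_sup m (g : 'M[R]_m) : has_sup (img g).
Proof.
split; first by exists (enorm (g *m 0)), 0 => //=; rewrite enorm0.
exists (\sum_i \sum_j `|g i j|) => _ [v /= v1 <-].
by rewrite (le_trans (enorm_mulmx_sum _ _))// ler_piMr// !sumr_ge0// => i _;
  rewrite sumr_ge0.
Qed.

Lemma opnorm_ge0 m (g : 'M[R]_m) : 0 <= opnorm g.
Proof.
apply: le_trans (_ : enorm (g *m 0) <= _); first exact: enorm_ge0.
by apply: ub_le_sup; [case: (img_sup g)|exists 0 => //=; rewrite enorm0].
Qed.

Lemma enorm_mulmx m (g : 'M[R]_m) (v : 'cV[R]_m) :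
  enorm (g *m v) <= opnorm g * enorm v.
Proof.
have [/eqP|v0] := eqVneq (enorm v) 0.
  by rewrite enorm_eq0 => /eqP ->; rewrite mulmx0 !enorm0 mulr0.
have vp : 0 < enorm v by rewrite lt_def v0 enorm_ge0.
rewrite -ler_pdivrMr//.
have -> : enorm (g *m v) / enorm v = enorm (g *m ((enorm v)^-1 *: v)).
  by rewrite -scalemxAr enormZ mulrC ger0_norm// invr_ge0 ltW.
apply: ub_le_sup; first by case: (img_sup g).
exists ((enorm v)^-1 *: v) => //=.
by rewrite enormZ ger0_norm ?invr_ge0 ?enorm_ge0// mulVf.
Qed.

Lemma opnorm_le m (g : 'M[R]_m) c : 0 <= c ->
  (forall v : 'cV[R]_m, enorm (g *m v) <= c * enorm v) -> opnorm g <= c.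
Proof.
move=> c0 h; apply: ge_sup; first by case: (img_sup g).
by move=> _ [v /= v1 <-]; rewrite (le_trans (h v))// ler_piMr.
Qed.

Lemma opnorm_ge m (g : 'M[R]_m) (v : 'cV[R]_m) :
  enorm v <= 1 -> enorm (g *m v) <= opnorm g.
Proof.
move=> v1; apply: le_trans (enorm_mulmx _ _) _.
by rewrite ler_piMr// opnorm_ge0.
Qed.

Lemma opnorm0 m : opnorm (0 : 'M[R]_m) = 0.
Proof.
apply/eqP; rewrite eq_le opnorm_ge0 andbT; apply: opnorm_le => // v.
by rewrite mul0mx enorm0 mul0r.
Qed.

Lemma opnormM m (g h : 'M[R]_m) : opnorm (g *m h) <= opnorm g * opnorm h.
Proof.
apply: opnorm_le => [|v]; first by rewrite mulr_ge0// opnorm_ge0.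
rewrite -mulmxA (le_trans (enorm_mulmx _ _))// -mulrA ler_wpM2l ?opnorm_ge0//.
exact: enorm_mulmx.
Qed.

Lemma opnormD m (g h : 'M[R]_m) : opnorm (g + h) <= opnorm g + opnorm h.
Proof.
apply: opnorm_le => [|v]; first by rewrite addr_ge0// opnorm_ge0.
by rewrite mulmxDl (le_trans (enormD _ _))// mulrDl lerD ?enorm_mulmx.
Qed.

Lemma opnormZ m a (g : 'M[R]_m) : opnorm (a *: g) = `|a| * opnorm g.
Proof.
have le b (h : 'M[R]_m) : opnorm (b *: h) <= `|b| * opnorm h.
  apply: opnorm_le => [|v]; first by rewrite mulr_ge0 ?opnorm_ge0.
  by rewrite -scalemxAl enormZ -mulrA ler_wpM2l// enorm_mulmx.
apply/eqP; rewrite eq_le le /=.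
have [->|a0] := eqVneq a 0; first by rewrite normr0 mul0r opnorm_ge0.
rewrite -ler_pdivlMl ?normr_gt0// -normfV (le_trans _ (le _ _))//.
by rewrite scalerA mulVf// scale1r.
Qed.

Lemma opnormN m (g : 'M[R]_m) : opnorm (- g) = opnorm g.
Proof. by rewrite -scaleN1r opnormZ normrN1 mul1r. Qed.

Lemma opnorm_distC m (g h : 'M[R]_m) : opnorm (g - h) = opnorm (h - g).
Proof. by rewrite -opnormN opprB. Qed.

Lemma opnorm_dist m (g h : 'M[R]_m) : `|opnorm g - opnorm h| <= opnorm (g - h).
Proof.
have le (a b : 'M[R]_m) : opnorm a - opnorm b <= opnorm (a - b).
  by rewrite lerBlDr -[in leLHS](subrK b a) opnormD.
by rewrite ler_norml le lerNl opprB opnorm_distC le.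
Qed.

Lemma opnorm1_le1 m : opnorm (1%:M : 'M[R]_m) <= 1.
Proof. by apply: opnorm_le => // v; rewrite mul1mx mul1r. Qed.

Lemma opnorm1 m : (0 < m)%N -> opnorm (1%:M : 'M[R]_m) = 1.
Proof.
case: m => // m _; apply/eqP; rewrite eq_le opnorm1_le1 /=.
have e : enorm (delta_mx ord0 ord0 : 'cV[R]_m.+1) = 1.
  rewrite /enorm (bigD1 ord0)//= mxE !eqxx expr1n big1 ?addr0 ?sqrtr1//.
  by move=> i /negPf i0; rewrite mxE i0 expr0n.
by rewrite -[leLHS]e -[in leLHS](mul1mx (delta_mx _ _)) opnorm_ge ?e.
Qed.

Lemma opnorm_le_sum m (g : 'M[R]_m) : opnorm g <= \sum_i \sum_j `|g i j|.
Proof.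
apply: opnorm_le => [|v]; last exact: enorm_mulmx_sum.
by rewrite sumr_ge0// => i _; rewrite sumr_ge0.
Qed.

Lemma opnorm_rank1 m (a b : 'cV[R]_m) : opnorm (a *m b^T) = enorm a * enorm b.
Proof.
have e (v : 'cV[R]_m) : enorm (a *m b^T *m v) = enorm a * `|dotmx b v|.
  by rewrite -mulmxA [b^T *m v]mx11_scalar mul_mx_scalar enormZ mulrC.
apply/eqP; rewrite eq_le; apply/andP; split.
  apply: opnorm_le => [|v]; first by rewrite mulr_ge0 ?enorm_ge0.
  rewrite e -mulrA ler_wpM2l ?enorm_ge0// ler_norml cauchy_schwarz andbT lerNl.
  have -> : - dotmx b v = dotmx b (- 1 *: v) by rewrite dotmxZr mulN1r.
  apply: le_trans (cauchy_schwarz _ _) _.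
  by rewrite enormZ normrN1 mul1r.
have [/eqP b0|b0] := eqVneq (enorm b) 0.
  by rewrite (eqP b0) mulr0 opnorm_ge0.
have bp : 0 < enorm b by rewrite lt_def b0 enorm_ge0.
rewrite -(ler_pM2r bp) (le_trans _ (enorm_mulmx _ b))// e -enorm_sqr.
by rewrite ger0_norm ?sqr_ge0// expr2 mulrA.
Qed.

End OperatorNorm.

Section MatrixProducts.
Context {R : realType}.
Variable m : nat.
Implicit Types g h : 'M[R]_m.

(* Along the top singular direction [g1] is the rank one matrix [s u v^T], for
   which the norm of a product with [g1] in the middle factors exactly; the
   remainder has norm at most [t], the second singular value. *)
Lemma opnorm_prod3 g2 g1 g0 (u v : 'cV[R]_m) (s t : R) :
  0 <= s -> enorm u = 1 -> enorm v = 1 -> opnorm g1 = s ->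
  opnorm (g1 - s *: (u *m v^T)) <= t ->
  `|opnorm (g2 *m g1 *m g0) * s - opnorm (g2 *m g1) * opnorm (g1 *m g0)|
    <= 3 * (s * t * opnorm g2 * opnorm g0).
Proof.
move=> s0 u1 v1 g1s rt; set r := g1 - _ in rt.
have g1E : g1 = s *: (u *m v^T) + r by rewrite addrC subrK.
have t0 : 0 <= t by apply: le_trans (opnorm_ge0 _) rt.
pose a := enorm (g2 *m u); pose b := enorm (g0^T *m v).
have norm_uv (h : 'M[R]_m) : opnorm (u *m v^T *m h) = enorm (h^T *m v).
  by rewrite -mulmxA -[v^T *m h]trmxK trmx_mul trmxK opnorm_rank1 u1 mul1r.
have ap : a <= opnorm g2 by rewrite opnorm_ge// u1.
have bq : b <= opnorm g0.
  rewrite /b -norm_uv (le_trans (opnormM _ _))// opnorm_rank1 u1 v1 !mul1r.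
  by [].
have a0 : 0 <= a by exact: enorm_ge0.
have b0 : 0 <= b by exact: enorm_ge0.
have dist (f h w : 'M[R]_m) : f - h = w -> `|opnorm f - opnorm h| <= opnorm w.
  by move=> <-; exact: opnorm_dist.
have e3 : `|opnorm (g2 *m g1 *m g0) - s * a * b|
    <= opnorm g2 * t * opnorm g0.
  have -> : s * a * b = opnorm (g2 *m (s *: (u *m v^T)) *m g0).
    rewrite -scalemxAr -scalemxAl opnormZ ger0_norm// -!mulrA; congr (_ * _).
    by rewrite mulmxA -[RHS]/(opnorm (g2 *m u *m v^T *m g0))
      -mulmxA -[v^T *m g0]trmxK trmx_mul trmxK opnorm_rank1.
  apply: le_trans (dist _ _ (g2 *m r *m g0) _) _.
    by rewrite -mulmxBl -mulmxBr.
  rewrite (le_trans (opnormM _ _))// ler_wpM2r ?opnorm_ge0//.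
  by rewrite (le_trans (opnormM _ _))// ler_wpM2l ?opnorm_ge0.
have e2 : `|opnorm (g2 *m g1) - s * a| <= opnorm g2 * t.
  have -> : s * a = opnorm (g2 *m (s *: (u *m v^T))).
    by rewrite -scalemxAr opnormZ ger0_norm// mulmxA opnorm_rank1 v1 mulr1.
  apply: le_trans (dist _ _ (g2 *m r) _) _; first by rewrite -mulmxBr.
  by rewrite (le_trans (opnormM _ _))// ler_wpM2l ?opnorm_ge0.
have e1 : `|opnorm (g1 *m g0) - s * b| <= t * opnorm g0.
  have -> : s * b = opnorm (s *: (u *m v^T) *m g0).
    by rewrite -scalemxAl opnormZ ger0_norm// norm_uv.
  apply: le_trans (dist _ _ (r *m g0) _) _; first by rewrite -mulmxBl.
  by rewrite (le_trans (opnormM _ _))// ler_wpM2r ?opnorm_ge0.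
have e0 : opnorm (g1 *m g0) <= s * opnorm g0 by rewrite -g1s opnormM.
(* For the rank one matrix [s u v^T] the two products agree, [(s a b) s = (s a) (s b)], so only the
   errors of [e3], [e2] and [e1] remain, each contributing at most [s t |g2| |g0|]. *)
have -> : opnorm (g2 *m g1 *m g0) * s - opnorm (g2 *m g1) * opnorm (g1 *m g0)
  = (opnorm (g2 *m g1 *m g0) - s * a * b) * s
    - (opnorm (g2 *m g1) - s * a) * opnorm (g1 *m g0)
    - s * a * (opnorm (g1 *m g0) - s * b) by ring.
apply: le_trans (ler_normB _ _) _; apply: le_trans (lerD (ler_normB _ _) (lexx _)) _.
rewrite !normrM (ger0_norm s0) (ger0_norm a0) (ger0_norm (opnorm_ge0 _)).
have h1 := ler_wpM2r s0 e3.
have h2 : `|opnorm (g2 *m g1) - s * a| * opnorm (g1 *m g0) <=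
    opnorm g2 * t * (s * opnorm g0).
  by rewrite ler_pM ?opnorm_ge0.
have h3 : s * a * `|opnorm (g1 *m g0) - s * b| <=
    s * opnorm g2 * (t * opnorm g0).
  by rewrite ler_pM ?mulr_ge0// ler_wpM2l.
lra.
Qed.

End MatrixProducts.

(** * Diagonalization of Gram matrices, singular values and rank one approximation *)

Section RealSpectralTheorem.
Context {R : realType}.

Lemma orthogonal_first_col n (v : 'cV[R]_n.+1) : enorm v = 1 ->
  exists2 H : 'M[R]_n.+1, H^T *m H = 1%:M & H *m delta_mx 0 0 = v.
Proof.
move=> v1; pose e : 'cV[R]_n.+1 := delta_mx 0 0.
have e1 : dotmx e e = 1.
  by rewrite /dotmx trmx_delta mul_delta_mx mxE.
have vv : dotmx v v = 1 by rewrite -enorm_sqr v1 expr1n.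
have [ve|ve] := eqVneq v e.
  by exists 1%:M; rewrite ?trmx1 ?mul1mx// ve.
pose w := e - v; pose c := dotmx w w.
have wE x : dotmx w x = dotmx e x - dotmx v x.
  by rewrite /w dotmxDl -scaleN1r dotmxZl mulN1r.
(* Both vectors have length one, so [|e - v|^2 = 2 <e - v, e>]; this is the value for which the
   reflection sends [e] to [v]. *)
have cE : c = 2 * dotmx w e.
  rewrite /c wE ![dotmx _ w]dotmxC !wE e1 vv (dotmxC e v); ring.
have c0 : c != 0.
  by rewrite /c -enorm_sqr sqrf_eq0 enorm_eq0 subr_eq0 eq_sym.
have wwT (x : 'cV[R]_n.+1) : w *m w^T *m x = dotmx w x *: w.
  by rewrite -mulmxA [w^T *m x]mx11_scalar mul_mx_scalar.
(* the reflection exchanging [e] and [v] *)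
pose H := 1%:M - (2 / c) *: (w *m w^T).
have HT : H^T = H.
  by rewrite /H linearB /= trmx1 linearZ /= trmx_mul trmxK.
exists H; last first.
  rewrite mulmxBl mul1mx -scalemxAl wwT scalerA -[dotmx w _]/(dotmx w e).
  have -> : 2 / c * dotmx w e = 1.
    have d0 : dotmx w e != 0.
      by apply: contra_neq c0; rewrite cE => ->; rewrite mulr0.
    by rewrite cE; field.
  by rewrite scale1r /w opprB addrC subrK.
rewrite HT {2}/H mulmxBr mulmx1 -scalemxAr {2}/H mulmxBl mul1mx.
rewrite -scalemxAl mulmxA wwT -/c -scalemxAl [(2 / c) *: (c *: _)]scalerA.
rewrite /H divfK// scalerBr scalerA.
have -> : 2 / c * 2 = 2 / c + 2 / c by ring.
by rewrite scalerDl opprB addrK subrK.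
Qed.

Lemma char_poly_orthogonal n (G Q : 'M[R]_n) : Q^T *m Q = 1%:M ->
  char_poly (Q^T *m G *m Q) = char_poly G.
Proof.
move=> QQ.
have e : char_poly_mx (Q^T *m G *m Q) =
    (map_mx polyC Q)^T *m char_poly_mx G *m map_mx polyC Q.
  rewrite /char_poly_mx !map_mxM /= -map_trmx mulmxBr mulmxBl; congr (_ - _).
  rewrite mul_mx_scalar -scalemxAl map_trmx -map_mxM QQ map_mx1.
  by rewrite scalemx1.
rewrite /char_poly e !det_mulmx mulrAC -!det_mulmx map_trmx -map_mxM QQ.
by rewrite map_mx1 det_mulmx det1 mul1r.
Qed.

(** Deflation: the head of [s] is a real eigenvalue, a unit eigenvector is rotated to the first
    basis vector, and symmetry then makes the matrix block diagonal, with the tail of [s] as roots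
    for the remaining block. Eigenvalues are split off in the order of the list, so the diagonal is
    [s] itself and not a permutation of it. *)
Theorem symmetric_diagonalization n (G : 'M[R]_n) (s : seq R) : G^T = G ->
  char_poly G = \prod_(t <- s) ('X - t%:P) ->
  exists2 Q : 'M[R]_n, Q^T *m Q = 1%:M &
    Q^T *m G *m Q = diag_mx (\row_i s`_i).
Proof.
elim: n G s => [|n IH] G s GT Gs.
  by exists 1%:M; apply/matrixP => -[].
have ss : size s = n.+1.
  by have := size_char_poly G; rewrite Gs size_prod_XsubC => -[].
case: s ss Gs => // t s [ss] Gs.
have : root (char_poly G) t by rewrite Gs root_prod_XsubC mem_head.
rewrite -eigenvalue_root_char => /eigenvalueP[v0 v0G v00].
have nv0 : enorm v0^T != 0.
  by rewrite enorm_eq0; apply: contra_neq v00 => /(congr1 trmx); rewrite trmxK trmx0.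
pose v := (enorm v0^T)^-1 *: v0^T.
have v1 : enorm v = 1.
  by rewrite enormZ ger0_norm ?invr_ge0 ?enorm_ge0// mulVf.
have Gv : G *m v = t *: v.
  rewrite /v -scalemxAr -[G]GT -trmx_mul v0G linearZ /= scalerA mulrC.
  by rewrite -scalerA.
have [H HH He] := orthogonal_first_col v1.
have HHT : H *m H^T = 1%:M by exact: mulmx1C.
(* [K] is retyped over [1 + n] for the block decomposition and kept opaque, so that only [KdE]
   unfolds it. *)
have [K KdE] : {K : 'M[R]_(1 + n) | K = H^T *m G *m H} by exists (H^T *m G *m H).
have KT : K^T = K by rewrite KdE !trmx_mul trmxK GT mulmxA.
have Ke : K *m delta_mx 0 0 = t *: (delta_mx 0 0 : 'cV_(1 + n)).
  by rewrite KdE -(mulmxA (H^T *m G)) He -mulmxA Gv -scalemxAr -He mulmxA HH mul1mx.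
have Kl i : K i 0 = (i == 0)%:R * t.
  have := congr1 (fun M : 'cV[R]_(1 + n) => M i 0) Ke.
  rewrite -colE !mxE => ->; rewrite eqxx andbT mulrC.
  by [].
have Kr j : K 0 j = (j == 0)%:R * t by rewrite -KT mxE Kl.
pose G' := drsubmx K.
have l0 : lshift n ord0 = 0 :> 'I_(1 + n) by exact/val_inj.
have KE : K = block_mx t%:M 0 0 G'.
  rewrite -[K in LHS]submxK; congr block_mx.
  - apply/matrixP => i j; by rewrite !ord1 !mxE l0 Kl eqxx mul1r mulr1n.
  - apply/matrixP => i j; by rewrite !ord1 !mxE l0 Kr mul0r.
  - apply/matrixP => i j; by rewrite !ord1 !mxE l0 Kl mul0r.
have sim : char_poly K = char_poly G by rewrite KdE char_poly_orthogonal.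
have G's : char_poly G' = \prod_(x <- s) ('X - x%:P).
  have tX : 'X - t%:P != 0 by rewrite polyXsubC_eq0.
  move: sim; rewrite Gs big_cons KE /char_poly char_block_diag_mx det_ublock.
  rewrite [\det (char_poly_mx t%:M)]det_mx11 !mxE eqxx mulr1n.
  exact: mulfI.
have G'T : G'^T = G' by rewrite /G' trmx_drsub KT.
have [Q QQ Qd] := IH _ _ G'T G's.
pose Q1 : 'M[R]_(1 + n) := block_mx 1%:M 0 0 Q.
have QT : Q1^T = block_mx 1%:M 0 0 Q^T by rewrite tr_block_mx trmx1 !trmx0.
have Q11 : Q1^T *m Q1 = 1%:M :> 'M[R]_(1 + n).
  rewrite QT /Q1 mulmx_block.
  by rewrite !(mulmx1, mul1mx, mulmx0, mul0mx, addr0, add0r) QQ -scalar_mx_block.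
have QK : Q1^T *m K *m Q1 = diag_mx (\row_i (t :: s)`_i) :> 'M[R]_(1 + n).
  rewrite QT KE /Q1 !mulmx_block.
  rewrite !(mulmx1, mul1mx, mulmx0, mul0mx, addr0, add0r) Qd.
  have -> : \row_i (t :: s)`_i = row_mx t%:M (\row_i s`_i) :> 'rV[R]_(1 + n).
    apply/rowP => i; rewrite !mxE; case: splitP => j -> /=.
      by rewrite !ord1 mxE eqxx mulr1n.
    by rewrite mxE.
  rewrite diag_mx_row; congr block_mx.
  by apply/matrixP => i j; rewrite !ord1 !mxE.
exists (H *m Q1).
  by rewrite trmx_mul -mulmxA (mulmxA H^T) HH mul1mx.
by rewrite -QK KdE trmx_mul !mulmxA.
Qed.

End RealSpectralTheorem.

Section SingularValues.
Context {R : realType}.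
Implicit Types (m : nat).

Lemma size_singular_values m (g : 'M[R]_m) : size (singular_values g) = m.
Proof.
have [_ _ /(congr1 (fun p : {poly R} => size p))] := singular_valuesP g.
rewrite size_char_poly -(big_map (fun t => t ^+ 2) xpredT (fun t => 'X - t%:P)).
by rewrite size_prod_XsubC size_map => -[].
Qed.

Lemma singval_ge0 m k (g : 'M[R]_m) : 0 <= singval k g.
Proof.
have [_ /allP s0 _] := singular_valuesP g.
have [lt|ge] := ltnP k.-1 (size (singular_values g)).
  by apply: s0; exact: mem_nth.
by rewrite /singval nth_default.
Qed.

Lemma singval_anti m k l (g : 'M[R]_m) :
  (k <= l)%N -> singval l g <= singval k g.
Proof.
move=> kl; have [ss _ _] := singular_valuesP g.
have {}kl : (k.-1 <= l.-1)%N by lia.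
have [lt|ge] := ltnP l.-1 (size (singular_values g)); last first.
  by rewrite [leLHS]/singval nth_default// singval_ge0.
apply: (sorted_leq_nth _ _ 0 ss) => //.
- by move=> y x z /= yx zy; exact: le_trans zy yx.
- by move=> x /=.
- by rewrite inE (leq_ltn_trans kl).
Qed.

(** The columns of [Q] are right singular vectors. The diagonal is in decreasing order because
    [symmetric_diagonalization] respects the order of the roots. *)
Lemma gram_diagonalization m (g : 'M[R]_m) : exists2 Q : 'M[R]_m,
  Q^T *m Q = 1%:M &
  Q^T *m (g^T *m g) *m Q = diag_mx (\row_i singval i.+1 g ^+ 2).
Proof.
have [_ _] := singular_valuesP g.
rewrite -(big_map (fun t => t ^+ 2) xpredT (fun t => 'X - t%:P)).
have GT : (g^T *m g)^T = g^T *m g by rewrite trmx_mul trmxK.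
move=> /(symmetric_diagonalization GT)[Q QQ QE]; exists Q => //.
rewrite QE; congr diag_mx; apply/rowP => i; rewrite !mxE.
by rewrite (nth_map 0) ?size_singular_values.
Qed.

Lemma enorm_gram m (g Q : 'M[R]_m) (v : 'cV[R]_m) (D : 'rV[R]_m) :
  Q *m Q^T = 1%:M -> Q^T *m (g^T *m g) *m Q = diag_mx D ->
  enorm (g *m v) ^+ 2 = \sum_i D 0 i * (Q^T *m v) i 0 ^+ 2.
Proof.
move=> QQ QE; rewrite enorm_sqr /dotmx.
have -> : (g *m v)^T *m (g *m v) = (Q^T *m v)^T *m diag_mx D *m (Q^T *m v).
  rewrite -QE !trmx_mul trmxK !mulmxA -(mulmxA _ Q Q^T) QQ mulmx1.
  by rewrite -(mulmxA _ Q Q^T) QQ mulmx1.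
set y := Q^T *m v; rewrite mxE; apply: eq_bigr => i _.
by rewrite mul_mx_diag mxE [y^T _ _]mxE; ring.
Qed.

(** In the coordinates [Q^T v] the form [|g v|^2] is a sum of squares weighted by the squared
    singular values, and the first weight is the largest. *)
Lemma singval1 m (g : 'M[R]_m) : (0 < m)%N -> singval 1 g = opnorm g.
Proof.
case: m g => // m g _; have [Q QQ QE] := gram_diagonalization g.
have QQ' := mulmx1C QQ.
have QT v : enorm (Q^T *m v) = enorm v by rewrite enorm_orthogonal// trmxK.
apply/eqP; rewrite eq_le; apply/andP; split.
  pose v := Q *m (delta_mx 0 0 : 'cV_m.+1).
  have v1 : enorm v = 1.
    rewrite enorm_orthogonal// /enorm (bigD1 ord0)//= mxE !eqxx expr1n.
    rewrite big1 ?addr0 ?sqrtr1// => i /negPf i0.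
    by rewrite mxE i0 expr0n.
  apply: le_trans (opnorm_ge g (_ : enorm v <= 1)); last by rewrite v1.
  rewrite -(@ler_pXn2r _ 2)// ?nnegrE ?enorm_ge0 ?singval_ge0//.
  rewrite (enorm_gram _ QQ' QE) /v mulmxA QQ mul1mx (bigD1 ord0)//=.
  rewrite !mxE !eqxx expr1n mulr1 lerDl sumr_ge0// => i _.
  by rewrite mulr_ge0 ?sqr_ge0// mxE sqr_ge0.
apply: opnorm_le => [|v]; first exact: singval_ge0.
rewrite -(@ler_pXn2r _ 2)// ?nnegrE ?mulr_ge0 ?enorm_ge0 ?singval_ge0//.
rewrite (enorm_gram _ QQ' QE) exprMn -[in leRHS]QT [in leRHS]/enorm.
rewrite sqr_sqrtr ?sumr_ge0// => [|i _]; last exact: sqr_ge0.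
rewrite mulr_sumr ler_sum// => i _; rewrite mxE ler_wpM2r ?sqr_ge0//.
by rewrite ler_pXn2r ?nnegrE ?singval_ge0 ?singval_anti.
Qed.

(** Here [v] is the top right singular vector and [u] the direction of [g v]. Subtracting [g v v^T]
    removes the first coordinate in the singular basis, and the remaining weights are at most the
    square of [singval 2 g]. For [m = 1] the latter is the default value 0, and the remainder
    vanishes. *)
Lemma rank1_approximation m (g : 'M[R]_m) : (0 < m)%N -> opnorm g != 0 ->
  exists u v : 'cV[R]_m, [/\ enorm u = 1, enorm v = 1 &
    opnorm (g - opnorm g *: (u *m v^T)) <= singval 2 g].
Proof.
case: m g => // m g _ g0; have [Q QQ QE] := gram_diagonalization g.
have QQ' := mulmx1C QQ.
have QT v : enorm (Q^T *m v) = enorm v by rewrite enorm_orthogonal// trmxK.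
pose v := Q *m (delta_mx 0 0 : 'cV_m.+1).
have v1 : enorm v = 1.
  rewrite enorm_orthogonal// /enorm (bigD1 ord0)//= mxE !eqxx expr1n.
  rewrite big1 ?addr0 ?sqrtr1// => i /negPf i0.
  by rewrite mxE i0 expr0n.
have gv : enorm (g *m v) = opnorm g.
  apply/eqP; rewrite -(@eqrXn2 _ 2)// ?enorm_ge0 ?opnorm_ge0//.
  rewrite (enorm_gram _ QQ' QE) /v mulmxA QQ mul1mx (bigD1 ord0)//=.
  rewrite !mxE !eqxx expr1n mulr1 singval1// big1 ?addr0// => i /negPf i0.
  by rewrite !mxE i0 expr0n mulr0.
exists ((opnorm g)^-1 *: (g *m v)), v; split=> //.
  by rewrite enormZ gv ger0_norm ?invr_ge0 ?opnorm_ge0// mulVf.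
rewrite -scalemxAl scalerA divff// scale1r.
apply: opnorm_le => [|w]; first exact: singval_ge0.
have -> : (g - g *m v *m v^T) *m w = g *m (w - v *m (v^T *m w)).
  by rewrite mulmxBl mulmxBr !mulmxA.
rewrite -(@ler_pXn2r _ 2)// ?nnegrE ?mulr_ge0 ?enorm_ge0 ?singval_ge0//.
rewrite (enorm_gram _ QQ' QE) exprMn -[in leRHS]QT [in leRHS]/enorm.
rewrite sqr_sqrtr ?sumr_ge0// => [|i _]; last exact: sqr_ge0.
have -> : Q^T *m (w - v *m (v^T *m w)) =
    Q^T *m w - (Q^T *m w) 0 0 *: (delta_mx 0 0 : 'cV_m.+1).
  rewrite mulmxBr; congr (_ - _).
  have -> : v^T *m w = (((Q^T *m w) 0 0)%:M : 'M[R]_1).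
    rewrite [LHS]mx11_scalar; congr (_%:M).
    rewrite /v trmx_mul -mulmxA trmx_delta -rowE [in LHS]mxE.
    by [].
  by rewrite mul_mx_scalar -scalemxAr /v mulmxA QQ mul1mx.
move: (Q^T *m w) => y; rewrite mulr_sumr ler_sum// => i _; rewrite !mxE.
case: (eqVneq i 0) => [->|i0].
  by rewrite mulr1 subrr expr0n mulr0 mulr_ge0 ?sqr_ge0.
rewrite mulr0 subr0 ler_wpM2r ?sqr_ge0//.
rewrite ler_pXn2r ?nnegrE ?singval_ge0// singval_anti// ltnS lt0n.
by apply: contra i0 => /eqP i0; apply/eqP/val_inj.
Qed.

End SingularValues.

(** * Increasing tuples, the Cauchy-Binet formula and compound matrices *)

Section KTuples.
Variables m k : nat.
Implicit Types i : 'I_('C(m, k)).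

Lemma ktuple_sorted i : sorted ltn [seq val j | j <- @ktuple m k i].
Proof.
have : @ktuple m k i \in ktuples m k by exact: Order.enum_valP.
by rewrite inE.
Qed.

Lemma ktuple_inj : injective (@ktuple m k).
Proof. move=> i j ij; apply: (@cast_ord_inj _ _ (esym (card_ktuples m k))).
by apply: (@Order.enum_val_inj _ (k.-tuplelexi 'I_m) (mem (ktuples m k))). Qed.

Lemma ktuple_surj (t : k.-tuple 'I_m) : sorted ltn [seq val j | j <- t] ->
  exists i, ktuple i = t.
Proof.
move=> st; have tk : (t : k.-tuplelexi 'I_m) \in ktuples m k by rewrite inE.
exists (cast_ord (card_ktuples m k) (Order.enum_rank_in tk t)).
by rewrite /ktuple cast_ordK Order.enum_rankK_in.
Qed.

Lemma ktuple_mono i : {mono tnth (ktuple i) : a b / (a < b)%N}.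
Proof.
have lt (a b : 'I_k) : (a < b)%N -> (tnth (ktuple i) a < tnth (ktuple i) b)%N.
  move=> ab; have [x0 _] : exists x : 'I_m, True by exists (tnth (ktuple i) a).
  rewrite !(tnth_nth x0).
  rewrite -!(nth_map x0 (val x0) val) ?size_tuple//.
  rewrite (sorted_ltn_nth ltn_trans _ (ktuple_sorted i))//.
    by rewrite inE size_map size_tuple.
  by rewrite inE size_map size_tuple.
move=> a b; case: (ltngtP a b) => [/lt//|/lt ba|/val_inj ->].
  by rewrite ltnNge ltnW.
by rewrite ltnn.
Qed.

Lemma tnth_ktuple_inj i : injective (tnth (ktuple i)).
Proof.
move=> a b ab; case: (ltngtP a b) => [lt|lt|/val_inj//]; move: lt;
by rewrite -(ktuple_mono i) ab ltnn.
Qed.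

Lemma ktuple_uniq i : uniq (ktuple i).
Proof. by apply/tuple_uniqP/tnth_ktuple_inj. Qed.

Lemma ktuple_eq_mem i j : ktuple i =i ktuple j -> i = j.
Proof.
move=> ij; apply/ktuple_inj/val_inj/(inj_map val_inj).
apply: (irr_sorted_eq ltn_trans ltnn); [exact: ktuple_sorted..|].
move=> x; apply/mapP/mapP => -[y yi ->]; exists y => //; first by rewrite -ij.
by rewrite ij.
Qed.

Lemma ktuple_notin i j : i != j -> exists a, tnth (ktuple i) a \notin ktuple j.
Proof.
move=> ij; apply/existsP; apply: contra_neqT ij => /existsPn h.
have sub : {subset ktuple i <= ktuple j}.
  by move=> x /tnthP[a ->]; have := h a; rewrite negbK.
apply: ktuple_eq_mem; apply: (uniq_min_size (ktuple_uniq i) sub _).2.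
by rewrite !size_tuple.
Qed.

(** The increasing tuple lists the image of [f], and the permutation records the order in which [f]
    visits it. Cauchy-Binet is reindexed along this factorization. *)
Lemma ktuple_of_inj (f : 'I_k -> 'I_m) : injective f ->
  exists i (s : {perm 'I_k}), f =1 tnth (ktuple i) \o s.
Proof.
move=> finj; pose s := sort leq [seq val j | j <- codom f].
pose t := [seq j <- enum 'I_m | j \in codom f].
have ts : sorted ltn [seq val j | j <- t].
  apply: (subseq_sorted ltn_trans _ (iota_ltn_sorted 0 m)).
  by rewrite -val_enum_ord map_subseq ?filter_subseq.
have tu : uniq t by rewrite filter_uniq ?enum_uniq.
have tE : t =i codom f by move=> x; rewrite mem_filter mem_enum andbT.
have st : size t == k.
  have : perm_eq t (codom f).
    by rewrite uniq_perm//; apply/injectiveP.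
  by move/perm_size ->; rewrite size_codom card_ord.
have [i iE] := @ktuple_surj (Tuple st) ts.
have fi a : f a \in ktuple i by rewrite iE tE codom_f.
have idx a : (index (f a) (ktuple i) < k)%N.
  by rewrite -[ltnRHS](size_tuple (ktuple i)) index_mem.
pose g a := Ordinal (idx a).
have gE a : tnth (ktuple i) (g a) = f a.
  by rewrite (tnth_nth (f a)) /= nth_index.
have ginj : injective g by move=> a b /(congr1 (tnth (ktuple i))); rewrite !gE => /finj.
by exists i, (perm ginj) => a /=; rewrite permE gE.
Qed.

End KTuples.

Section ExteriorPower.
Context {R : realType}.
Variable k : nat.

(** Multiplying out the entries of the product gives a sum over all maps [f] from rows to indices. A
    map that is not injective contributes a determinant with two equal rows; an injective one is an
    increasing tuple after a permutation, and summing the signed products over the permutations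
    rebuilds the minor of [A]. *)
Theorem cauchy_binet m (A : 'M[R]_(k, m)) (B : 'M[R]_(m, k)) :
  \det (A *m B) = \sum_(i < 'C(m, k))
    \det (colsub (tnth (ktuple i)) A) * \det (rowsub (tnth (ktuple i)) B).
Proof.
pose F (f : {ffun 'I_k -> 'I_m}) := \prod_i A i (f i) * \det (rowsub f B).
have -> : \det (A *m B) = \sum_f F f.
  rewrite /determinant.
  under eq_bigr => s _.
    under eq_bigr => i _ do rewrite mxE.
    rewrite bigA_distr_bigA /= mulr_sumr.
    under eq_bigr => f _ do rewrite big_split /= mulrCA.
    over.
  rewrite exchange_big /=; apply: eq_bigr => f _; rewrite -mulr_sumr; congr (_ * _).
  by apply: eq_bigr => s _; congr (_ * _); apply: eq_bigr => i _; rewrite !mxE.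
rewrite (bigID (fun f : {ffun 'I_k -> 'I_m} => injectiveb f)) /=.
rewrite [X in _ + X]big1 ?addr0; last first.
  move=> f /injectivePn[a [b ab fab]]; rewrite /F.
  by rewrite (determinant_alternate ab) ?mulr0// => c; rewrite !mxE fab.
pose h (p : 'I_('C(m, k)) * {perm 'I_k}) : {ffun 'I_k -> 'I_m} :=
  [ffun a => tnth (ktuple p.1) (p.2 a)].
have hinj : {in [set: 'I_('C(m, k)) * {perm 'I_k}]%SET &, injective h}.
  move=> [i s] [j t] _ _ /ffunP hij.
  have ij : i = j.
    apply: ktuple_eq_mem; apply: (uniq_min_size (ktuple_uniq i) _ _).2.
      move=> x /tnthP[a ->]; have := hij (s^-1%g a).
      by rewrite !ffunE /= permKV => ->; rewrite mem_tnth.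
    by rewrite !size_tuple.
  rewrite -{}ij in hij *; congr (_, _); apply/permP => a.
  by have := hij a; rewrite !ffunE /= => /tnth_ktuple_inj.
rewrite (eq_bigl (fun f => f \in [set h x | x in [set: 'I_('C(m, k)) * {perm 'I_k}]]%SET)); last first.
  move=> f; apply/injectiveP/imsetP => [finj|[[i s] _ ->]].
    have [i [s fE]] := ktuple_of_inj finj.
    by exists (i, s); rewrite ?inE//; apply/ffunP => a; rewrite ffunE fE.
  by move=> a b; rewrite !ffunE => /tnth_ktuple_inj/perm_inj.
rewrite (big_imset _ hinj) /= (eq_bigl xpredT) => [|x]; last by rewrite inE.
rewrite -(pair_bigA _ (fun i s => F (h (i, s)))) /=.
apply: eq_bigr => i _; rewrite /determinant mulr_suml.
apply: eq_bigr => s _.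
rewrite /F; have -> : rowsub (h (i, s)) B = row_perm s (rowsub (tnth (ktuple i)) B).
  by apply/matrixP => a b; rewrite !mxE ffunE.
rewrite row_permE det_mulmx det_perm mulrA [_ * (-1) ^+ s]mulrC; congr (_ * _ * _).
by apply: eq_bigr => a _; rewrite !mxE ffunE.
Qed.

Lemma extmxM m (g h : 'M[R]_m) : extmx k (g *m h) = extmx k g *m extmx k h.
Proof.
apply/matrixP => i j; rewrite !mxE.
have -> : mxsub (tnth (ktuple i)) (tnth (ktuple j)) (g *m h) =
    rowsub (tnth (ktuple i)) g *m colsub (tnth (ktuple j)) h.
  by apply/matrixP => a b; rewrite !mxE; apply: eq_bigr => c _; rewrite !mxE.
rewrite cauchy_binet; apply: eq_bigr => l _; rewrite !mxE.
by congr (_ * _); congr determinant; apply/matrixP => a b; rewrite !mxE.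
Qed.

Lemma extmx_tr m (g : 'M[R]_m) : extmx k g^T = (extmx k g)^T.
Proof.
apply/matrixP => i j; rewrite !mxE -det_tr.
by congr (\det _); apply/matrixP => a b; rewrite !mxE.
Qed.

Lemma extmx_diag m (D : 'rV[R]_m) : extmx k (diag_mx D) =
  diag_mx (\row_(i < 'C(m, k)) \prod_(l < k) D 0 (tnth (ktuple i) l)).
Proof.
apply/matrixP => i j; rewrite !mxE.
have [->|ij] := eqVneq i j.
  rewrite mulr1n.
  have -> : mxsub (tnth (ktuple j)) (tnth (ktuple j)) (diag_mx D) =
      diag_mx (\row_l D 0 (tnth (ktuple j) l)).
    apply/matrixP => a b; rewrite !mxE (inj_eq (@tnth_ktuple_inj _ _ j)).
    by have [->|] := eqVneq a b.
  by rewrite det_diag; apply: eq_bigr => l _; rewrite mxE.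
have [a ai] := ktuple_notin ij.
rewrite mulr0n (expand_det_row _ a) big1// => b _; rewrite !mxE.
have [ab|] := eqVneq (tnth (ktuple i) a) (tnth (ktuple j) b).
  by rewrite ab mem_tnth in ai.
by rewrite mulr0n mul0r.
Qed.

Lemma extmx1 m : extmx k (1%:M : 'M[R]_m) = 1%:M.
Proof.
rewrite -diag_const_mx extmx_diag -diag_const_mx; congr diag_mx.
by apply/rowP => i; rewrite !mxE big1// => l _; rewrite mxE.
Qed.

(** Compound matrices respect products and transposes, so the compound of [Q] diagonalizes the Gram
    matrix of the compound of [g], and nonnegativity allows taking roots of the squares. The two
    lists agree only up to permutation: lexicographic order of the tuples does not sort the
    products. *)
Lemma singular_values_extmx m (g : 'M[R]_m) :
  perm_eq (singular_values (extmx k g))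
    [seq \prod_(l < k) singval (tnth (ktuple i) l).+1 g | i : 'I_('C(m, k))].
Proof.
set r := [seq _ | i : _].
have [Q QQ QE] := gram_diagonalization g.
have [_ /allP s0] := singular_valuesP (extmx k g).
set G := extmx k g; set s := singular_values G in s0 *.
have EQ : (extmx k Q)^T *m extmx k Q = 1%:M by rewrite -extmx_tr -extmxM QQ extmx1.
have r0 x : x \in r -> 0 <= x.
  by move=> /mapP[i _ ->]; rewrite prodr_ge0// => l _; exact: singval_ge0.
have sqrK (l : seq R) : (forall x, x \in l -> 0 <= x) ->
    [seq Num.sqrt y | y <- [seq x ^+ 2 | x <- l]] = l.
  move=> l0; rewrite -map_comp map_id_in// => x /l0 x0 /=.
  by rewrite sqrtr_sqr ger0_norm.
move=> Gs; rewrite -(sqrK s)// -(sqrK r)// perm_map//.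
apply: prod_XsubC_eq; rewrite !big_map -Gs.
pose D := diag_mx (\row_(i < 'C(m, k)) \prod_(l < k) singval (tnth (ktuple i) l).+1 g ^+ 2).
have DE : (extmx k Q)^T *m (G^T *m G) *m extmx k Q = D.
  rewrite -!extmx_tr -!extmxM QE extmx_diag; congr diag_mx.
  by apply/rowP => i; rewrite !mxE; apply: eq_bigr => l _; rewrite mxE.
rewrite -(char_poly_orthogonal _ EQ) DE char_poly_trig ?diag_mx_is_trig//.
rewrite -enumT big_enum /=; apply: eq_bigr => i _.
by rewrite !mxE eqxx mulr1n prodrXl.
Qed.

End ExteriorPower.

Section ExteriorPowerNorm.
Context {R : realType}.

Let first_ktuple m k (km : (k <= m)%N) : exists i : 'I_('C(m, k)),
  forall l, tnth (ktuple i) l = l :> nat.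
Proof.
pose t := [tuple widen_ord km l | l < k].
have vt : [seq val j | j <- t] = iota 0 k.
  by rewrite /= -map_comp -[RHS]val_enum_ord; apply: eq_map.
have [i iE] : exists i, ktuple i = t.
  by apply: ktuple_surj; rewrite vt iota_ltn_sorted.
by exists i => l; rewrite iE tnth_mktuple.
Qed.

Let ktuple_ge m k (i : 'I_('C(m, k))) (l : 'I_k) : (l <= tnth (ktuple i) l)%N.
Proof.
case: l => l; elim: l => // l IH lk; have lk' : (l < k)%N by lia.
by apply: leq_ltn_trans (IH lk') _; rewrite ktuple_mono.
Qed.

Lemma singval_ge m (g : 'M[R]_m) x : x \in singular_values g ->
  x <= singval 1 g.
Proof.
have [ss _ _] := singular_valuesP g; rewrite /singval /=.
case: (singular_values g) ss => //= y s ss; rewrite inE => /predU1P[->//|xs].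
have := order_path_min _ ss => /(_ _)/allP; apply=> //.
by move=> a b c /= ba cb; exact: le_trans cb ba.
Qed.

Lemma opnorm_extmx m k (g : 'M[R]_m) : (k <= m)%N ->
  opnorm (extmx k g) = \prod_(l < k) singval l.+1 g.
Proof.
move=> km; rewrite -singval1 ?bin_gt0//.
have pe := perm_mem (singular_values_extmx k g).
have le i : \prod_(l < k) singval (tnth (ktuple i) l).+1 g <=
    \prod_(l < k) singval l.+1 g.
  apply: ler_prod => l _; rewrite singval_ge0 singval_anti//.
  exact: (ktuple_ge i l).
apply/eqP; rewrite eq_le; apply/andP; split.
  have : singval 1 (extmx k g) \in singular_values (extmx k g).
    by rewrite mem_nth// size_singular_values bin_gt0.
  by rewrite pe => /mapP[i _ ->]; exact: le.
have [i iE] := first_ktuple km.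
apply: singval_ge; rewrite pe; apply/mapP; exists i; rewrite ?mem_enum//.
by apply: eq_bigr => l _; rewrite iE.
Qed.

(** Every tuple other than the initial one has its last index, counted from 0, at least [k + 1], so
    its product is at most the right-hand side. A second singular value above this bound would need
    two tuples exceeding it, and only the initial one can. *)
Lemma singval2_extmx m k (g : 'M[R]_m) : (k < m)%N ->
  singval 2 (extmx k.+1 g) <= \prod_(l < k) singval l.+1 g * singval k.+2 g.
Proof.
move=> km; set c := _ * _; rewrite leNgt; apply/negP => ltc.
have [ss _ _] := singular_valuesP (extmx k.+1 g).
have pe := singular_values_extmx k.+1 g.
have [i0 i0E] := first_ktuple km.
have le i : i != i0 ->
    \prod_(l < k.+1) singval (tnth (ktuple i) l).+1 g <= c.
  move=> /ktuple_notin[a an]; rewrite big_ord_recr /= /c ler_pM//.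
  - by apply: prodr_ge0 => l _; exact: singval_ge0.
  - exact: singval_ge0.
  - apply: ler_prod => l _; rewrite singval_ge0 singval_anti// ltnS.
    exact: (ktuple_ge i (widen_ord (leqnSn k) l)).
  apply: singval_anti; rewrite ltnS.
  apply: (@leq_trans (tnth (ktuple i) a)).
    rewrite ltnNge; apply: contra an => ak.
    have ak' : (tnth (ktuple i) a < k.+1)%N by [].
    rewrite (_ : tnth (ktuple i) a = tnth (ktuple i0) (Ordinal ak')) ?mem_tnth//.
    by apply/val_inj; rewrite /= i0E.
  have [->//|aM] := eqVneq a ord_max.
  apply: ltnW; rewrite ktuple_mono ltn_neqAle -ltnS ltn_ord andbT.
  by apply: contra aM => /eqP aM; apply/eqP/val_inj.
have : (count (fun x => (c < x)%R) (singular_values (extmx k.+1 g)) <= 1)%N.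
  rewrite (seq.permP pe) count_map -size_filter.
  apply: (@leq_trans (size [:: i0])) => //; apply: uniq_leq_size.
    by rewrite filter_uniq// enum_uniq.
  move=> i; rewrite mem_filter /= inE => /andP[h _].
  by apply/eqP; move: h; apply: contraTeq => /le; rewrite leNgt.
move: ltc; rewrite /singval /=.
case: (singular_values _) ss => [|x [|y s]] //= ss.
- by rewrite ltNge mulr_ge0 ?singval_ge0// prodr_ge0// => l _; exact: singval_ge0.
- by rewrite ltNge mulr_ge0 ?singval_ge0// prodr_ge0// => l _; exact: singval_ge0.
move=> cy; case/andP: ss => yx _.
by rewrite cy (lt_le_trans cy yx).
Qed.

End ExteriorPowerNorm.

(** * Logarithms of norms of products of three and four matrices *)

Section ProductsOfLogarithms.
Context {R : realType}.
Variable m : nat.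
Hypothesis m_gt0 : (0 < m)%N.
Implicit Types g h : 'M[R]_m.
Local Notation L g := (ln (opnorm g)).

Let ln_near1 (x y d : R) : 0 < x -> 0 < y -> 0 <= d -> 2 * d <= 1 ->
  `|x - y| <= d * y -> `|ln x - ln y| <= 2 * d.
Proof.
move=> x0 y0 d0 d1; rewrite ler_norml => /andP[l u].
have up (a b : R) : 0 < a -> 0 < b -> ln a - ln b <= (a - b) / b.
  move=> a0 b0; rewrite -ln_div ?posrE//.
  rewrite (_ : a / b = 1 + (a - b) / b); last by field; rewrite gt_eqF.
  by apply: le_ln1Dx; rewrite mulrBl divff ?gt_eqF// ltrBrDr addNr divr_gt0.
have h1 : ln x - ln y <= d.
  by rewrite (le_trans (up _ _ x0 y0))// ler_pdivrMr.
have h2 : ln y - ln x <= 2 * d.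
  rewrite (le_trans (up _ _ y0 x0))// ler_pdivrMr//.
  have : d * y <= y / 2.
    by rewrite mulrC ler_pM2l// -[leRHS]mul1r ler_pdivlMr// mulrC.
  nra.
by rewrite ler_norml; apply/andP; split; lra.
Qed.

(** An avalanche principle for three factors: [a] bounds the norm lost when neighbours are
    multiplied, [exp(-b)] bounds the ratio of the two top singular values of the middle factor. By
    [opnorm_prod3] the error is at most [3 exp(-b) |g1|^2 |g2| |g0|], while [Y] is at least
    [exp(-2a) |g1|^2 |g2| |g0|]; passing to logarithms doubles the relative error. *)
Lemma ln_opnorm_prod3 g2 g1 g0 (a b : R) :
  0 < opnorm (g2 *m g1) -> 0 < opnorm (g1 *m g0) ->
  L g2 + L g1 - a <= L (g2 *m g1) -> L g1 + L g0 - a <= L (g1 *m g0) ->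
  singval 2 g1 <= expR (- b) * opnorm g1 -> 6 * expR (2 * a - b) <= 1 ->
  0 < opnorm (g2 *m g1 *m g0) /\
  `|L (g2 *m g1 *m g0) + L g1 - L (g2 *m g1) - L (g1 *m g0)|
    <= 6 * expR (2 * a - b).
Proof.
move=> g21 g10 a21 a10 s2 small.
have pos2 g h : 0 < opnorm (g *m h) -> 0 < opnorm g /\ 0 < opnorm h.
  move=> gh; have := lt_le_trans gh (opnormM g h).
  have := opnorm_ge0 g; have := opnorm_ge0 h.
  by rewrite !le_eqVlt => /orP[/eqP<-|->] /orP[/eqP<-|->]; rewrite ?mulr0 ?mul0r ?ltxx.
have [p2 p1] := pos2 _ _ g21; have [_ p0] := pos2 _ _ g10.
have [u [v [u1 v1 uv]]] := rank1_approximation m_gt0 (lt0r_neq0 p1).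
have := opnorm_prod3 g2 g0 (ltW p1) u1 v1 erefl uv.
set X := opnorm (g2 *m g1 *m g0) * opnorm g1.
set Y := opnorm (g2 *m g1) * opnorm (g1 *m g0) => XY.
have Y0 : 0 < Y by rewrite mulr_gt0.
set d := 3 * expR (2 * a - b).
have d0 : 0 <= d by rewrite mulr_ge0// expR_ge0.
have hd : 6 * expR (2 * a - b) = 2 * d by rewrite /d; ring.
have XYd : `|X - Y| <= d * Y.
  have aY : expR (- (2 * a)) * (opnorm g2 * opnorm g1 * (opnorm g1 * opnorm g0)) <= Y.
    rewrite -ler_ln ?posrE ?mulr_gt0 ?expR_gt0//.
    rewrite !lnM ?posrE ?mulr_gt0 ?expR_gt0// expRK; move: a21 a10; clear.
    by move: (L g2) (L g1) (L g0) (L _) (L _) => x y z u v; lra.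
  apply: le_trans XY _; rewrite /d expRD.
  have := expRxMexpNx_1 (2 * a); move: aY s2 (expR_gt0 (2 * a)) (expR_gt0 (- b)).
  move: (expR _) (expR _) (expR _) => x y z aY s2 z0 y0 zx.
  have -> : opnorm g1 * singval 2 g1 * opnorm g2 * opnorm g0 =
    singval 2 g1 * (opnorm g1 * opnorm g2 * opnorm g0) by ring.
  apply: (@le_trans _ _ (3 * ((y * opnorm g1) * (opnorm g1 * opnorm g2 * opnorm g0)))).
    by rewrite ler_pM2l// ler_pM2r ?mulr_gt0.
  have -> : 3 * (x * y) * Y = 3 * (y * (x * Y)) by ring.
  rewrite -[y * opnorm g1 * _]mulrA ler_pM2l// ler_pM2l//.
  apply: (@le_trans _ _ (x * (z * (opnorm g2 * opnorm g1 * (opnorm g1 * opnorm g0))))).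
    rewrite [x * (z * _)]mulrA zx mul1r le_eqVlt; apply/orP; left; apply/eqP; ring.
  by rewrite ler_pM2l.
have X0 : 0 < X.
  move: XYd; rewrite ler_norml => /andP[h _].
  have : 2 * d <= 1 by rewrite -hd.
  nra.
have XE : 0 < opnorm (g2 *m g1 *m g0) by move: X0; rewrite pmulr_lgt0.
split=> //; rewrite hd.
have := ln_near1 X0 Y0 d0 _ XYd; rewrite -hd small => /(_ isT).
by rewrite !lnM ?posrE// opprD addrA.
Qed.

(** The three-factor estimate is used for [g3, g2, g1], for [g2, g1, g0], and for [g3, g2 g1, g0];
    the norms of the triple products cancel in the sum. The first two uses bound the loss in the
    third by [a + 1], since their errors are at most 1, and the three errors [6 e] add up to
    [18 e]. *)
Lemma ln_opnorm_prod4 g3 g2 g1 g0 (a b : R) : 0 <= a ->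
  0 < opnorm (g3 *m g2) -> 0 < opnorm (g2 *m g1) -> 0 < opnorm (g1 *m g0) ->
  L g3 + L g2 - a <= L (g3 *m g2) -> L g2 + L g1 - a <= L (g2 *m g1) ->
  L g1 + L g0 - a <= L (g1 *m g0) ->
  singval 2 g2 <= expR (- b) * opnorm g2 ->
  singval 2 g1 <= expR (- b) * opnorm g1 ->
  singval 2 (g2 *m g1) <= expR (- b) * opnorm (g2 *m g1) ->
  6 * expR (2 * (a + 1) - b) <= 1 ->
  0 < opnorm (g3 *m (g2 *m g1) *m g0) /\
  `|L (g3 *m (g2 *m g1) *m g0) + L g2 + L g1
     - L (g3 *m g2) - L (g2 *m g1) - L (g1 *m g0)|
    <= 18 * expR (2 * (a + 1) - b).
Proof.
have low (x y z w u t f : R) : f <= 1 -> `|x + y - z - w| <= f ->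
    u + y - t <= z -> u + w - (t + 1) <= x.
  by rewrite ler_norml => ? /andP[? _] ?; lra.
have low' (x y z w u t f : R) : f <= 1 -> `|x + y - z - w| <= f ->
    y + u - t <= w -> z + u - (t + 1) <= x.
  by rewrite ler_norml => ? /andP[? _] ?; lra.
have arith (x1 x2 x3 x4 x5 x6 x7 x8 e f : R) : f <= e ->
    `|x1 + x2 - x3 - x4| <= 6 * f ->
    `|x5 + x6 - x4 - x7| <= 6 * f ->
    `|x8 + x4 - x1 - x5| <= 6 * e ->
    `|x8 + x2 + x6 - x3 - x4 - x7| <= 18 * e.
  rewrite !ler_norml => fe /andP[h1 h2] /andP[h3 h4] /andP[h5 h6].
  by apply/andP; split; lra.
move=> a0 p32 p21 p10 a32 a21 a10 s2 s1 s21 small.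
set e := expR _ in small *.
have ee : expR (2 * a - b) <= e by rewrite ler_expR lerD2r ler_pM2l// lerDl.
have ea : 6 * expR (2 * a - b) <= 1 by apply: le_trans small; rewrite ler_pM2l.
have [p321 h321] := ln_opnorm_prod3 p32 p21 a32 a21 s2 ea.
have [p210 h210] := ln_opnorm_prod3 p21 p10 a21 a10 s1 ea.
have b321 := low _ _ _ _ _ _ _ ea h321 a32.
have b210 := low' _ _ _ _ _ _ _ ea h210 a10.
rewrite -mulmxA in p321 b321 h321.
have [p h] := ln_opnorm_prod3 p321 p210 b321 b210 s21 small.
by split=> //; exact: (arith _ _ _ _ _ _ _ _ _ _ ee h321 h210 h).
Qed.

End ProductsOfLogarithms.

(** * Integrals bounded above and tails of L^p functions *)

Section UpperIntegrable.
Context {d : measure_display} {X : measurableType d} {R : realType}.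
Variable mu : probability X R.
Implicit Types f g : X -> \bar R.
Local Open Scope ereal_scope.

Let muT : (mu : {measure set X -> \bar R}) [set: X] = 1 := probability_setT mu.

(** Log norms of iterates are bounded above, but their integral may be [-oo]. Finiteness of the
    positive part alone makes the integral well defined below [+oo], and additive. *)
Definition upper_integrable f := [/\ measurable_fun [set: X] f,
  forall x, f x < +oo & \int[mu]_x f^\+ x < +oo].

(** No integrability is required: positive and negative parts are compared separately, and
    subtraction in [\bar R] is monotone because [+oo - +oo] is [-oo]. *)
Lemma ui_le f g : measurable_fun [set: X] f -> measurable_fun [set: X] g ->
  {ae mu, forall x, f x <= g x} -> \int[mu]_x f x <= \int[mu]_x g x.
Proof.
move=> mf mg fg; rewrite integralE [leRHS]integralE; apply: leeB.
  apply: ae_ge0_le_integral => //; [exact: measurable_funepos..|].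
  apply: filterS fg => x fg _; rewrite !funeposE.
  by rewrite ge_max !le_max fg lexx orbT.
apply: ae_ge0_le_integral => //; [exact: measurable_funeneg..|].
apply: filterS fg => x fg _; rewrite !funenegE.
by rewrite ge_max !le_max leeN2 fg lexx orbT.
Qed.

(** The identity [(f + g)^+ + f^- + g^- = (f + g)^- + f^+ + g^+] holds pointwise between nonnegative
    functions. It is integrated as such, and the positive parts, having finite integrals, can then
    be moved across. *)
Lemma ui_add f g : upper_integrable f -> upper_integrable g ->
  upper_integrable (f \+ g) /\
  \int[mu]_x (f x + g x) = \int[mu]_x f x + \int[mu]_x g x.
Proof.
move=> [mf f1 fp] [mg g1 gp].
have mfp := measurable_funepos mf; have mfn := measurable_funeneg mf.
have mgp := measurable_funepos mg; have mgn := measurable_funeneg mg.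
have mh : measurable_fun [set: X] (f \+ g) by exact: emeasurable_funD.
have mhp := measurable_funepos mh; have mhn := measurable_funeneg mh.
have hp : \int[mu]_x (f \+ g)^\+ x <= \int[mu]_x f^\+ x + \int[mu]_x g^\+ x.
  rewrite -ge0_integralD//; apply: ge0_le_integral => //.
    exact: emeasurable_funD.
  move=> x _; rewrite !funeposE ge_max; apply/andP; split.
    by apply: leeD; rewrite le_max lexx.
  by rewrite adde_ge0// le_max lexx orbT.
have hlt : \int[mu]_x (f \+ g)^\+ x < +oo.
  by apply: le_lt_trans hp _; exact: lte_add_pinfty.
split; first by split=> // x; exact: lte_add_pinfty.
have e : \int[mu]_x (f \+ g)^\+ x + \int[mu]_x f^\- x + \int[mu]_x g^\- x
    = \int[mu]_x (f \+ g)^\- x + \int[mu]_x f^\+ x + \int[mu]_x g^\+ x.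
  rewrite -!ge0_integralD//; try exact: emeasurable_funD;
    try (by move=> x _; exact: adde_ge0).
  apply: eq_integral => x _; rewrite !funeposE !funenegE /=.
  have := f1 x; have := g1 x.
  have m1 : maxe (-oo) 0 = 0 :> \bar R by rewrite max_r// leNye.
  have m2 : maxe +oo 0 = +oo :> \bar R by rewrite max_l// leey.
  have m3 (y : R) : +oo + maxe y%:E 0 = +oo by rewrite -EFin_max.
  have m4 (y : R) : maxe y%:E 0 + +oo = +oo by rewrite -EFin_max.
  case: (f x) => [r| |]//; case: (g x) => [s| |]// _ _; last 3 first.
  - by rewrite addeNy /= m1 m2 add0e m4 m3 adde0.
  - by rewrite addNye /= m1 m2 add0e adde0 !m3.
  - by rewrite addNye /= m1 m2 !adde0.
  rewrite -!EFinD -!EFinN -!EFin_max -!EFinD; congr (_%:E).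
  have maxE (y : R) : (Num.max y 0 = y + Num.max (- y) 0)%R.
    by rewrite /Num.max; do 2 case: ifPn => ?; lra.
  by rewrite (maxE (r + s)%R) (maxE r) (maxE s); ring.
rewrite -[LHS]/(\int[mu]_x (f \+ g) x) integralE [in RHS]integralE.
rewrite [\int[mu]_x g x]integralE.
move: e hlt fp gp.
have : 0 <= \int[mu]_x (f \+ g)^\- x by exact: integral_ge0.
have : 0 <= \int[mu]_x f^\- x by exact: integral_ge0.
have : 0 <= \int[mu]_x g^\- x by exact: integral_ge0.
have : 0 <= \int[mu]_x (f \+ g)^\+ x by exact: integral_ge0.
have : 0 <= \int[mu]_x f^\+ x by exact: integral_ge0.
have : 0 <= \int[mu]_x g^\+ x by exact: integral_ge0.
case: (\int[mu]_x g^\+ x) => [a| |]// _.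
case: (\int[mu]_x f^\+ x) => [b| |]// _.
case: (\int[mu]_x (f \+ g)^\+ x) => [c| |]// _.
case: (\int[mu]_x g^\- x) => [a'| |]// _;
case: (\int[mu]_x f^\- x) => [b'| |]// _;
case: (\int[mu]_x (f \+ g)^\- x) => [c'| |]//= _.
rewrite -!EFinD => -[e] _ _ _; congr (_%:E); lra.
Qed.

Lemma ui_scale (c : R) f : (0 <= c)%R -> upper_integrable f ->
  upper_integrable (fun x => c%:E * f x) /\
  \int[mu]_x (c%:E * f x) = c%:E * \int[mu]_x f x.
Proof.
move=> c0 [mf f1 fp].
have mfp := measurable_funepos mf; have mfn := measurable_funeneg mf.
split.
  split=> [|x|].
  - exact: measurable_funeM.
  - have := f1 x; case: (f x) => [r| |]// _; first by rewrite ltry.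
    move: c0; rewrite le_eqVlt => /predU1P[<-|c0]; first by rewrite mul0e.
    by rewrite gt0_muleNy.
  - rewrite ge0_funeposM// ge0_integralZl_EFin//.
    have : 0 <= \int[mu]_x f^\+ x by exact: integral_ge0.
    move: fp; case: (\int[mu]_x f^\+ x) => [p| |]// _ _.
    by rewrite ltry.
rewrite integralE ge0_funeposM// ge0_funenegM// !ge0_integralZl_EFin//.
rewrite [in RHS]integralE [RHS]muleBr//.
apply: fin_num_adde_defr; rewrite ge0_fin_numE//.
exact: integral_ge0.
Qed.

Lemma ui_cst (c : R) : upper_integrable (cst c%:E).
Proof.
split=> // [x|]; first by rewrite ltry.
rewrite (_ : (cst c%:E)^\+ = cst (maxe c%:E 0)); last by apply/funext=> x; rewrite funeposE.
by rewrite integral_cst// muT mule1 -EFin_max ltry.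
Qed.

Lemma ui_le_cst f (c : R) : measurable_fun [set: X] f ->
  {ae mu, forall x, f x <= c%:E} -> \int[mu]_x f x <= c%:E.
Proof.
move=> mf fc; rewrite -[leRHS]mule1 -muT -integral_cst//.
exact: ui_le.
Qed.

Lemma ui_bounded f (c : R) : measurable_fun [set: X] f ->
  (forall x, f x < +oo) -> {ae mu, forall x, f x <= c%:E} -> upper_integrable f.
Proof.
move=> mf f1 fc; split=> //.
apply: (@le_lt_trans _ _ (maxe c%:E 0)); last by rewrite -EFin_max ltry.
rewrite -EFin_max; apply: ui_le_cst; first exact: measurable_funepos.
apply: filterS fc => x; rewrite EFin_max funeposE => fc.
by rewrite ge_max !le_max fc lexx orbT.
Qed.

End UpperIntegrable.

Section LpSmallSets.
Context {d : measure_display} {X : measurableType d} {R : realType}.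
Variable mu : probability X R.
Local Open Scope ereal_scope.

Let muT : (mu : {measure set X -> \bar R}) [set: X] = 1 := probability_setT mu.

Lemma Lnorm_fin_num (p : \bar R) (f : X -> \bar R) (K : R) : 1 < p ->
  measurable_fun [set: X] f -> 'N[mu]_p[f] < K%:E ->
  {ae mu, forall x, f x \is a fin_num}.
Proof.
move=> p1 mf fK.
have mf' : measurable_fun [set: X] (fun x => `|f x|) by exact: measurableT_comp.
case: p p1 fK => [p| |]// p1 fK; last first.
  move: fK; rewrite unlock muT lte01 => fK.
  have := ess_supP (ltW fK); apply: filterS => x /= fx.
  by rewrite fin_num_abs (le_lt_trans fx) ?ltry.
rewrite lte_fin in p1; have p0 : (0 < p)%R by lra.
have : mu.-integrable [set: X] (fun x => `|f x| `^ p).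
  apply/integrableP; split; first exact: (measurableT_comp (measurable_poweR _)).
  under eq_integral do rewrite gee0_abs ?poweR_ge0//.
  rewrite -poweR_Lnorm ?gt_eqF//; move: fK (Lnorm_ge0 mu p%:E f).
  by case: ('N[mu]_p%:E[f]) => // r _ _; rewrite poweR_EFin ltry.
move=> /(integrable_ae measurableT); apply: filterS => x /(_ I).
rewrite ge0_fin_numE ?poweR_ge0// fin_num_abs; exact: lty_poweRy (lt0r_neq0 p0).
Qed.

(** Hoelder's inequality against the indicator of [F], with [1/q = 1 - 1/p]; for [p = +oo] the
    essential bound is used directly. Since [f] is finite almost everywhere it may be replaced by
    its real part [fine]. *)
Lemma Lnorm_small_set (p : \bar R) (f : X -> \bar R) (K v : R) (F : set X) :
  1 < p -> measurable_fun [set: X] f -> 'N[mu]_p[f] < K%:E ->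
  measurable F -> mu F <= v%:E ->
  \int[mu]_(x in F) `|f x| <= (K * v `^ fine (1 - p^-1))%:E.
Proof.
move=> p1 mf fK mF Fv.
have K0 : (0 <= K)%R.
  by rewrite -lee_fin (le_trans (Lnorm_ge0 mu p f))// ltW.
have v0 : (0 <= v)%R by rewrite -lee_fin (le_trans _ Fv).
have mf' : measurable_fun [set: X] (fun x => `|f x|) by exact: measurableT_comp.
case: p p1 fK => [p| |]// p1 fK; last first.
  rewrite invey sube0 /= powRr1//.
  move: fK; rewrite unlock muT lte01 => fK.
  have fKae := ess_supP (ltW fK).
  apply: (@le_trans _ _ (\int[mu]_(x in F) cst K%:E x)).
    apply: ae_ge0_le_integral => //; first exact: measurable_funTS.
    by apply: filterS fKae => x /= fx _.
  by rewrite integral_cst// EFinM lee_wpmul2l// lee_fin.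
have fin := Lnorm_fin_num p1 mf fK.
rewrite lte_fin in p1; have p0 : (0 < p)%R by lra.
have mff : measurable_fun [set: X] (fun x => fine (f x)) by exact: measurableT_comp.
have mi : measurable_fun [set: X] (\1_F : X -> R) by exact: measurable_indic.
pose q := (p / (p - 1))%R.
have q0 : (0 < q)%R by rewrite divr_gt0// subr_gt0.
have pq : (p^-1 + q^-1 = 1)%R by rewrite /q invf_div mulrBl divff ?lt0r_neq0// mul1r addrC subrK.
have := hoelder mu mff mi p0 q0 pq.
rewrite Lnorm1.
have -> : \int[mu]_x `|(EFin \o ((fun x => fine (f x)) \* \1_F)%R) x| =
    \int[mu]_(x in F) `|f x|.
  rewrite [RHS]integral_mkcond; apply: ge0_ae_eq_integral => //.
  - apply: measurableT_comp => //; apply/measurable_EFinP.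
    exact: measurable_funM.
  - by apply/(measurable_restrictT _ mF); exact: measurable_funTS.
  - by move=> x _; rewrite /patch; case: ifP.
  apply: filterS fin => x fx _; rewrite /patch /= indicE.
  case: ifP => xF; last by rewrite mulr0 normr0.
  by rewrite mulr1 -abse_EFin fineK.
have -> : 'N[mu]_q%:E[EFin \o \1_F] = mu F `^ q^-1.
  rewrite unlock; congr (_ `^ _).
  under eq_integral => x _.
    have -> : `|(EFin \o \1_F) x| `^ q = (\1_F x)%:E.
      rewrite /= indicE; case: (x \in F).
        by rewrite normr1 powR1.
      by rewrite normr0 powR0 ?gt_eqF.
    over.
  by rewrite integral_indic// setIT.
move=> /le_trans; apply.
have -> : 'N[mu]_p%:E[EFin \o (fun x => fine (f x))] = 'N[mu]_p%:E[f].
  rewrite unlock; congr (_ `^ _); apply: ge0_ae_eq_integral => //.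
  - apply: (measurableT_comp (measurable_poweR _)).
    by apply: measurableT_comp => //; exact/measurable_EFinP.
  - exact: (measurableT_comp (measurable_poweR _)).
  - by move=> x _; exact: poweR_ge0.
  - by move=> x _; exact: poweR_ge0.
  by apply: filterS fin => x fx _; rewrite /comp fineK.
rewrite EFinM; apply: lee_pmul; rewrite ?Lnorm_ge0 ?poweR_ge0 ?(ltW fK)//.
have -> : fine (1 - p%:E^-1) = (q^-1)%R.
  by rewrite inver gt_eqF// /= -pq addrAC subrr add0r.
rewrite -poweR_EFin; apply: gt0_ler_poweR; rewrite ?in_itv/= ?leey ?andbT ?lee_fin//.
by rewrite invr_ge0 ltW.
Qed.

End LpSmallSets.

(** * Iterates and exponents of one cocycle *)

Section MeasurableMatrices.
Context {d : measure_display} {X : measurableType d} {R : realType}.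

Definition measurable_mx m n (A : X -> 'M[R]_(m, n)) :=
  forall i j, measurable_fun [set: X] (fun x => A x i j).

(* A Lipschitz function of the entries is measurable, since rational matrices
   are dense. *)
Lemma measurable_opnorm m (A : X -> 'M[R]_m) : measurable_mx A ->
  measurable_fun [set: X] (fun x => opnorm (A x)).
Proof.
have arith1 (a b e D c : R) : a - b <= D -> D < e -> e < (a - c) / 2 -> c + e < b.
  by move=> *; lra.
have arith2 (a b e D c : R) : - D <= a - b -> D < e -> c + e < b -> c < a.
  by move=> *; lra.
move=> mA; pose D x (q : 'M[rat]_m) : R := \sum_i \sum_j `|A x i j - ratr (q i j)|.
have mD q : measurable_fun [set: X] (D ^~ q).
  apply: measurable_sum => i; apply: measurable_sum => j.
  by apply: measurableT_comp => //; exact: measurable_funB.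
pose Q (q : 'M[rat]_m) : R := opnorm (map_mx ratr q).
have lip x q : `|opnorm (A x) - Q q| <= D x q.
  apply: le_trans (opnorm_dist _ _) _; apply: le_trans (opnorm_le_sum _) _.
  by apply: ler_sum => i _; apply: ler_sum => j _; rewrite !mxE.
have dens x (e : R) : 0 < e -> exists q, D x q < e.
  move=> e0; pose e' := e / (m * m).+1%:R.
  have e'0 : 0 < e' by rewrite divr_gt0.
  have h (ij : 'I_m * 'I_m) : {q : rat | `|A x ij.1 ij.2 - ratr q| < e'}.
    have lt : A x ij.1 ij.2 - e' < A x ij.1 ij.2 + e' by rewrite ltrD2l gtrN.
    apply: cid; have [q] := rat_in_itvoo lt.
    by rewrite in_itv /= => /andP[q1 q2]; exists q; rewrite distrC ltr_distl q1.
  exists (\matrix_(i, j) sval (h (i, j))).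
  apply: (@le_lt_trans _ _ (\sum_(i < m) \sum_(j < m) e')).
    apply: ler_sum => i _; apply: ler_sum => j _; rewrite mxE.
    by case: (h (i, j)) => q /= /ltW.
  rewrite big_const_ord iter_addr_0 big_const_ord iter_addr_0 -mulrnA /e'.
  by rewrite -[ltLHS]mulr_natr mulrAC ltr_pdivrMr// ltr_pM2l// ltr_nat.
move=> _; apply: (measurability _ (RGenOInfty.measurableE R)) => //.
move=> _ [_ [c ->] <-]; rewrite setTI.
have -> : (fun x => opnorm (A x)) @^-1` `]c, +oo[ =
    \bigcup_(qk : 'M[rat]_m * nat)
      (if c + qk.2.+1%:R^-1 < Q qk.1 then [set x | D x qk.1 < qk.2.+1%:R^-1] else set0).
  apply/seteqP; split => x /=; rewrite in_itv /= andbT.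
    move=> cA; have e0 : 0 < (opnorm (A x) - c) / 2 by rewrite divr_gt0// subr_gt0.
    have [k _ /(_ k (leqnn k)) hk] := near_infty_natSinv_lt (PosNum e0).
    have k0 : 0 < k.+1%:R^-1 :> R by rewrite invr_gt0.
    have [q hq] := dens x _ k0; exists (q, k) => //=.
    case: ifPn => // /negP; apply.
    move: (lip x q) hk; rewrite ler_norml => /andP[_ h] /= hk.
    exact: arith1 h hq hk.
  move=> [[q k] _ /=]; case: ifPn => // cQ /= hD.
  have := lip x q; rewrite ler_norml => /andP[h _]; exact: arith2 h hD cQ.
apply: countable_bigcupT_measurable => [|[q k] /=]; first exact: countableP.
case: ifPn => // _; rewrite -[X in measurable X]setTI.
have := mD q; move=> /(_ measurableT `]-oo, k.+1%:R^-1[%classic (measurable_itv _)).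
by congr measurable; apply/seteqP; split => x [] //=; rewrite in_itv.
Qed.

Lemma measurable_mulmx m n p (A : X -> 'M[R]_(m, n)) (B : X -> 'M[R]_(n, p)) :
  measurable_mx A -> measurable_mx B -> measurable_mx (fun x => A x *m B x).
Proof.
move=> mA mB i j; under eq_fun do rewrite mxE.
by apply: measurable_sum => k; exact: measurable_funM.
Qed.

Lemma measurable_lne (f : X -> R) : measurable_fun [set: X] f ->
  measurable_fun [set: X] (fun x => lne (f x)%:E).
Proof.
move=> mf; rewrite /lne; apply: measurable_fun_ifT => //.
  exact: measurable_fun_ler.
by apply/measurable_EFinP; apply: measurableT_comp.
Qed.

End MeasurableMatrices.

Section MeasurePreserving.
Context {d : measure_display} {X : measurableType d} {R : realType}.
Variables (mu : probability X R) (T : X -> X).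
Hypothesis hT : measure_preserving mu T.

Lemma measurable_iter n : measurable_fun [set: X] (iter n T).
Proof.
elim: n => [|n IH] /=; first exact: measurable_id.
by apply: measurableT_comp IH; case: hT.
Qed.

Lemma measure_iter n (F : set X) : measurable F -> mu (iter n T @^-1` F) = mu F.
Proof.
move=> mF; elim: n => [//|n IH].
have -> : iter n.+1 T @^-1` F = T @^-1` (iter n T @^-1` F).
  by apply/seteqP; split => x; rewrite /preimage /= -iterSr.
case: hT => _ ->//; rewrite -[X in measurable X]setTI.
exact: measurable_iter.
Qed.

Lemma ae_iter n (Q : X -> Prop) : {ae mu, forall x, Q x} ->
  {ae mu, forall x, Q (iter n T x)}.
Proof.
move=> [N [mN N0 QN]]; exists (iter n T @^-1` N); split.
- by rewrite -[X in measurable X]setTI; exact: measurable_iter.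
- by rewrite -[RHS]N0; exact: measure_iter.
- by move=> x /= Qx; exact: QN.
Qed.

Local Open Scope ereal_scope.

Lemma integral_iter n (f : X -> \bar R) : measurable_fun [set: X] f ->
  \int[mu]_x f (iter n T x) = \int[mu]_x f x.
Proof.
move=> mf.
have pos (g : X -> \bar R) : measurable_fun [set: X] g -> (forall x, 0 <= g x) ->
    \int[mu]_x g (iter n T x) = \int[mu]_x g x.
  move=> mg g0.
  have := @ge0_integral_pushforward _ _ _ _ _ _ (measurable_iter n) mu setT g
    measurableT mg (fun x _ => g0 x).
  rewrite preimage_setT => <-; apply: eq_measure_integral => [|mi F mF _].
    exact: measurable_iter.
  exact: measure_iter.
rewrite integralE [RHS]integralE.
rewrite -(pos _ (measurable_funepos mf)) => [|x]; last exact: funepos_ge0.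
rewrite -(pos _ (measurable_funeneg mf)) => [|x]; last exact: funeneg_ge0.
by congr (_ - _); apply: eq_integral => x _; rewrite ?funeposE ?funenegE.
Qed.

End MeasurePreserving.

Section Iterates.
Context {d : measure_display} {X : measurableType d} {R : realType}.
Variable T : X -> X.

Lemma iterateD m (A : X -> 'M[R]_m) n p x :
  iterate T A (n + p) x = iterate T A n (iter p T x) *m iterate T A p x.
Proof.
elim: n => [|n IH]; first by rewrite add0n /= mul1mx.
by rewrite addSn /= IH mulmxA -iterD.
Qed.

Lemma iterate_ext m k (A : X -> 'M[R]_m) n x :
  iterate T (ext_cocycle k A) n x = extmx k (iterate T A n x).
Proof. by elim: n => [|n IH] /=; rewrite ?extmx1// IH extmxM. Qed.

Lemma measurable_iterate m (A : X -> 'M[R]_m) n : measurable_fun [set: X] T ->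
  measurable_mx A -> measurable_mx (iterate T A n).
Proof.
move=> mT mA; elim: n => [|n IH] /=; first by move=> i j; exact: measurable_cst.
apply: measurable_mulmx IH => i j.
apply: (@measurableT_comp _ _ _ _ _ _ (fun x => A x i j)) => //.
by elim: n => [|n IH] /=; [exact: measurable_id|exact: measurableT_comp].
Qed.

End Iterates.

Section ErealSequences.
Context {R : realType}.
Local Open Scope ereal_scope.
Implicit Types (u v : nat -> \bar R) (l : \bar R).

Lemma cvge_from_above u l : l < +oo -> (\forall n \near \oo, l <= u n) ->
  (forall t : R, l < t%:E -> \forall n \near \oo, u n < t%:E) -> u @ \oo --> l.
Proof.
case: l => [l| |]// _ lu ut; last first.
  apply/cvgeNyPle => t; apply: filterS (ut t (ltNyr _)) => n; exact: ltW.
apply/fine_cvgP; split.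
  near=> n; rewrite fin_numE; apply/andP; split.
    by rewrite -ltNye (lt_le_trans (ltNyr l))//; near: n.
  rewrite -ltey (@lt_trans _ _ (l + 1)%:E) ?ltry//; near: n.
  by apply: ut; rewrite lte_fin ltrDl.
apply/cvgrPdist_lt => e e0; near=> n.
have h1 : l%:E <= u n by near: n.
have h2 : u n < (l + e)%:E by near: n; apply: ut; rewrite lte_fin ltrDl.
move: h1 h2 => /=; case: (u n) => [r| |]//=; rewrite ?ltNyr// lee_fin lte_fin.
by rewrite distrC ltr_norml => ? ?; apply/andP; split; lra.
Unshelve. all: by end_near. Qed.

End ErealSequences.

Section LogNorms.
Context {R : realType}.
Local Open Scope ereal_scope.

Lemma lne_lty (x : R) : lne x%:E < +oo.
Proof. by rewrite /lne; case: ifP => _; rewrite ?ltNyy ?ltry. Qed.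

Lemma lneM_ge0 (x y : R) : (0 <= x)%R -> (0 <= y)%R ->
  lne (x * y)%:E = lne x%:E + lne y%:E.
Proof.
rewrite !le_eqVlt => /predU1P[<-|x0] /predU1P[<-|y0].
- by rewrite mul0r le0_lneNy.
- by rewrite mul0r le0_lneNy//.
- by rewrite mulr0 le0_lneNy// addeNy.
- by rewrite !lne_EFin ?mulr_gt0// lnM.
Qed.

Lemma le_lne (x y : R) : (0 <= x)%R -> (x <= y)%R -> lne x%:E <= lne y%:E.
Proof.
move=> x0 xy; have y0 := le_trans x0 xy.
by rewrite lee_lne ?lee_fin// in_itv/= lee_fin leey andbT.
Qed.

Lemma lne_le_expR (x c : R) : (0 <= x)%R -> (x <= expR c)%R -> lne x%:E <= c%:E.
Proof.
move=> x0 xc; apply: le_trans (le_lne x0 xc) _.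
by rewrite lne_EFin ?expR_gt0// expRK.
Qed.

Lemma lne_le_expR_inv (y r : R) : lne y%:E <= r%:E -> (y <= expR r)%R.
Proof.
have [y0|y0] := ltP 0%R y; last by move=> _; rewrite (le_trans y0)// expR_ge0.
by rewrite lne_EFin// lee_fin -{2}(lnK y0) ler_expR.
Qed.

End LogNorms.

Section BoundedCocycles.
Context {d : measure_display} {X : measurableType d} {R : realType}.
Variables (mu : probability X R) (T : X -> X).
Hypothesis hT : measure_preserving mu T.
Local Open Scope ereal_scope.

(** The bound is written as an exponential with [0 <= c], so that log norms of iterates are at most
    [n c], a quantity nondecreasing in [n]. The constant is a parameter because it will be shared by
    all cocycles near a given one. *)
Definition bounded_cocycle m (A : X -> 'M[R]_m) (c : R) :=
  [/\ (0 < m)%N, measurable_mx A, (0 <= c)%R &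
    {ae mu, forall x, (opnorm (A x) <= expR c)%R}].

Definition log_norm m (A : X -> 'M[R]_m) n x : \bar R :=
  lne (opnorm (iterate T A n x))%:E.

Lemma log_norm_lty m (A : X -> 'M[R]_m) n x : log_norm A n x < +oo.
Proof. exact: lne_lty. Qed.

Lemma log_normD m (A : X -> 'M[R]_m) n p x :
  log_norm A (n + p) x <= log_norm A n (iter p T x) + log_norm A p x.
Proof.
rewrite /log_norm iterateD -lneM_ge0 ?opnorm_ge0//.
by rewrite le_lne ?opnorm_ge0 ?opnormM.
Qed.

Lemma lyap1_fin_int m (A : X -> 'M[R]_m) n :
  lyap1_fin mu T n A = \int[mu]_x ((n%:R^-1)%:E * log_norm A n x).
Proof. by []. Qed.

Section OneCocycle.
Variables (m : nat) (A : X -> 'M[R]_m) (c : R).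
Hypothesis hA : bounded_cocycle A c.

Lemma iterate_bounded : {ae mu, forall x, forall n,
  (opnorm (iterate T A n x) <= expR (n%:R * c))%R}.
Proof.
have [m0 mA c0 bA] := hA.
have : {ae mu, forall x, forall j, (opnorm (A (iter j T x)) <= expR c)%R}.
  by apply: ae_foralln => j; exact: (ae_iter hT j (Q := fun x => (opnorm (A x) <= expR c)%R)).
apply: filterS => x bx; elim=> [|n IH].
  by rewrite mul0r expR0 opnorm1_le1.
rewrite /= (le_trans (opnormM _ _))// -natr1 mulrDl mul1r addrC expRD.
by rewrite ler_pM ?opnorm_ge0.
Qed.

Lemma measurable_iterate_mx n : measurable_mx (iterate T A n).
Proof. by have [_ mA _ _] := hA; apply: measurable_iterate mA; case: hT. Qed.

Lemma measurable_log_norm n : measurable_fun [set: X] (log_norm A n).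
Proof. exact/measurable_lne/measurable_opnorm/measurable_iterate_mx. Qed.

Lemma log_norm_le n : {ae mu, forall x, log_norm A n x <= (n%:R * c)%:E}.
Proof.
apply: filterS iterate_bounded => x /(_ n) h.
by apply: lne_le_expR => //; exact: opnorm_ge0.
Qed.

Lemma log_norm_ui n : upper_integrable mu (log_norm A n).
Proof.
apply: (ui_bounded (c := n%:R * c)) => //; first exact: measurable_log_norm.
  by move=> x; exact: lne_lty.
exact: log_norm_le.
Qed.

Definition log_int n := \int[mu]_x log_norm A n x.

Lemma log_int_le n : log_int n <= (n%:R * c)%:E.
Proof. exact: (ui_le_cst (measurable_log_norm n) (log_norm_le n)). Qed.

Lemma log_intD n p : log_int (n + p) <= log_int n + log_int p.
Proof.
have mn := measurable_log_norm n.
have mnp : measurable_fun [set: X] (fun x => log_norm A n (iter p T x)).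
  exact: (measurableT_comp mn (measurable_iter hT p)).
have uin : upper_integrable mu (fun x => log_norm A n (iter p T x)).
  apply: (ui_bounded (c := n%:R * c)) => //.
    by move=> x; exact: log_norm_lty.
  exact: ae_iter hT _ _ (log_norm_le n).
have [[mD _ _] e] := ui_add uin (log_norm_ui p).
rewrite /log_int -(integral_iter hT p mn) -e.
apply: ui_le => //; first exact: measurable_log_norm.
by apply: aeW => x; exact: log_normD.
Qed.

Lemma log_intM N q : log_int (q * N) <= q%:R%:E * log_int N.
Proof.
elim: q => [|q IH]; first by rewrite mul0n mul0e; have := log_int_le 0; rewrite mul0r.
rewrite mulSn addnC -natr1 EFinD.
apply: le_trans (log_intD _ _) _; apply: le_trans (leeD IH (lexx _)) _.
have := log_int_le N; case: (log_int N) => [r| |]// _.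
  by rewrite -EFinM -!EFinD -EFinM lee_fin mulrDl mul1r.
by rewrite addeNy leNye.
Qed.

(* The explicit rate makes Fekete's lemma uniform over all cocycles sharing [c]. *)
Lemma log_int_fekete N n (b : R) : (0 < N)%N -> log_int N <= b%:E ->
  log_int n <= (n%:R / N%:R * b + `|b| + N%:R * c)%:E.
Proof.
move=> N0 Nb; have [_ _ c0 _] := hA.
rewrite {1}(divn_eq n N); apply: le_trans (log_intD _ _) _.
have qb : log_int (n %/ N * N) <= ((n %/ N)%:R * b)%:E.
  apply: le_trans (log_intM _ _) _.
  by rewrite EFinM lee_wpmul2l// lee_fin ler0n.
apply: le_trans (leeD qb (log_int_le _)) _; rewrite -EFinD lee_fin.
apply: lerD; last by rewrite ler_wpM2r// ler_nat ltnW// ltn_mod.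
have -> : (n%:R / N%:R * b = (n %/ N)%:R * b + (n %% N)%:R / N%:R * b)%R.
  rewrite {1}(divn_eq n N) natrD natrM; field.
  by rewrite pnatr_eq0 -lt0n.
rewrite -addrA lerDl addrC -lerBlDr sub0r.
have := ler_norm (- ((n %% N)%:R / N%:R * b)); move/le_trans; apply.
rewrite normrN normrM ler_piMl// ger0_norm// ler_pdivrMr ?ltr0n// mul1r.
by rewrite ler_nat ltnW// ltn_mod.
Qed.

Lemma lyap1_finE n : lyap1_fin mu T n A = (n%:R^-1)%:E * log_int n.
Proof.
rewrite lyap1_fin_int; apply: (ui_scale _ (log_norm_ui n)).2.
by rewrite invr_ge0.
Qed.

Lemma lyap1_fin_lty n : lyap1_fin mu T n A < +oo.
Proof.
rewrite lyap1_finE; have := log_int_le n; case: (log_int n) => [r| |]// _.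
  by rewrite ltry.
have : (0 <= n%:R^-1 :> R)%R by rewrite invr_ge0.
rewrite le_eqVlt => /predU1P[<-|n0]; first by rewrite mul0e.
by rewrite gt0_muleNy.
Qed.

Lemma lyap1_fin_fekete N n (t : R) : (0 < N)%N -> (0 < n)%N ->
  lyap1_fin mu T N A <= t%:E ->
  lyap1_fin mu T n A <= (t + (N%:R * `|t| + N%:R * c) / n%:R)%:E.
Proof.
move=> N0 n0; rewrite !lyap1_finE.
rewrite muleC lee_pdivrMr ?ltr0n// -EFinM => Nt.
rewrite muleC lee_pdivrMr ?ltr0n// -EFinM.
apply: le_trans (log_int_fekete n N0 Nt) _; rewrite lee_fin.
rewrite normrM (@ger0_norm _ N%:R)// le_eqVlt; apply/orP; left; apply/eqP.
by field; rewrite !pnatr_eq0 -!lt0n N0 n0.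
Qed.

(** By subadditivity the infimum is the limit, hence the top exponent. In this form it lies below
    the finite scale exponent at every positive scale. *)
Definition lyap_inf : \bar R := ereal_inf [set lyap1_fin mu T n A | n in [set n | (0 < n)%N]].

Lemma lyap_inf_le n : (0 < n)%N -> lyap_inf <= lyap1_fin mu T n A.
Proof. by move=> n0; apply: ereal_inf_lbound; exists n. Qed.

Lemma lyap_inf_lt (t : \bar R) : lyap_inf < t ->
  exists2 n, (0 < n)%N & lyap1_fin mu T n A < t.
Proof.
by move=> /ereal_inf_lt[_ [n n0 <-] nt]; exists n.
Qed.

Lemma lyap_inf_lty : lyap_inf < +oo.
Proof. exact: le_lt_trans (lyap_inf_le (ltn0Sn 0)) (lyap1_fin_lty _). Qed.

Lemma cvg_lyap_inf : lyap1_fin mu T n A @[n --> \oo] --> lyap_inf.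
Proof.
apply: cvge_from_above; first exact: lyap_inf_lty.
  by exists 1%N => // n /= n0; exact: lyap_inf_le.
move=> t /lyap_inf_lt[N N0 Nt].
have [s Ns st] : exists2 s : R, lyap1_fin mu T N A <= s%:E & (s < t)%R.
  move: Nt; case: (lyap1_fin mu T N A) => [s| |]//.
    by rewrite lte_fin => st; exists s.
  by move=> _; exists (t - 1)%R; rewrite ?leNye// ltrBlDr ltrDl.
set K := (N%:R * `|s| + N%:R * c)%R.
near=> n; have n0 : (0 < n)%N by near: n; exists 1%N.
apply: le_lt_trans (lyap1_fin_fekete N0 n0 Ns) _; rewrite lte_fin -/K.
have : (K / (t - s) < n%:R)%R by near: n; exact: nbhs_infty_gtr.
rewrite ltr_pdivrMr ?subr_gt0// mulrC -ltr_pdivrMr ?ltr0n// => ?; lra.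
Unshelve. all: by end_near. Qed.

Lemma lyap1E : lyap mu T 1 A = lyap_inf.
Proof.
have [m0 _ _ _] := hA; apply: cvg_lim => //.
under eq_fun do under eq_integral do rewrite singval1//.
exact: cvg_lyap_inf.
Qed.

End OneCocycle.
End BoundedCocycles.

(** * All Lyapunov exponents through exterior powers *)

Section Exponents.
Context {d : measure_display} {X : measurableType d} {R : realType}.
Variables (mu : probability X R) (T : X -> X).
Hypothesis hT : measure_preserving mu T.
Local Open Scope ereal_scope.

Lemma bounded_ext m (A : X -> 'M[R]_m) c k : (k <= m)%N ->
  bounded_cocycle mu A c -> bounded_cocycle mu (ext_cocycle k A) (k%:R * c).
Proof.
move=> km [m0 mA c0 bA]; split.
- by rewrite bin_gt0.
- move=> i j; rewrite /ext_cocycle /extmx; under eq_fun do rewrite mxE.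
  rewrite /determinant; apply: measurable_sum => s; apply: measurable_funM => //.
  by apply: measurable_prod => l _; under eq_fun do rewrite mxE; exact: mA.
- by rewrite mulr_ge0.
apply: filterS bA => x Ax; rewrite /ext_cocycle opnorm_extmx//.
rewrite expRM_natl -[k in (expR c ^+ k)%R](card_ord k) -prodr_const.
apply: ler_prod => l _; rewrite singval_ge0/=.
by apply: le_trans Ax; rewrite -singval1// singval_anti.
Qed.

Section OneCocycle.
Variables (m : nat) (A : X -> 'M[R]_m) (c : R).
Hypothesis hA : bounded_cocycle mu A c.

Definition singval_avg k n := \int[mu]_x
  ((n%:R^-1)%:E * lne (singval k (iterate T A n x))%:E).

Let M k n := lyap1_fin mu T n (ext_cocycle k A).

(** When the denominator vanishes the quotient is 0 by convention, and this is the right value: some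
    earlier singular value is 0, hence so is this one. The formula also yields the measurability of
    singular values. *)
Lemma singval_ext_div k (g : 'M[R]_m) : (k < m)%N ->
  singval k.+1 g = (opnorm (extmx k.+1 g) / opnorm (extmx k g))%R.
Proof.
move=> km; rewrite !opnorm_extmx ?(ltnW km)// big_ord_recr /=.
set p := (\prod_(i < k) _)%R; have [p0|p0] := eqVneq p 0%R; last first.
  by rewrite mulrAC divff// mul1r.
rewrite p0 !mul0r; apply/eqP; rewrite eq_le singval_ge0 andbT.
have /eqP := p0; rewrite prodf_seq_eq0 => /hasP[l _ /= /eqP <-].
by apply: singval_anti; rewrite ltnS ltnW.
Qed.

Lemma lne_singval_ui k n : (0 < k <= m)%N ->
  upper_integrable mu (fun x => lne (singval k (iterate T A n x))%:E).
Proof.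
case: k => // k /= km; have mit := measurable_iterate_mx hT hA n.
have me j : measurable_fun [set: X] (fun x => opnorm (extmx j (iterate T A n x))).
  apply: measurable_opnorm => a b; rewrite /extmx; under eq_fun do rewrite mxE.
  rewrite /determinant; apply: measurable_sum => s; apply: measurable_funM => //.
  by apply: measurable_prod => l _; under eq_fun do rewrite mxE; exact: mit.
apply: (ui_bounded (c := n%:R * c)).
- apply: measurable_lne.
  under eq_fun do rewrite singval_ext_div// -powR_inv1 ?opnorm_ge0//.
  apply: measurable_funM => //.
  by apply: (@measurableT_comp _ _ _ _ _ _ (@powR R ^~ (-1)%R)).
- by move=> x; exact: lne_lty.
apply: filterS (iterate_bounded hT hA) => x /(_ n) h.
apply: lne_le_expR; first exact: singval_ge0.
apply: le_trans h; have [m0 _ _ _] := hA.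
by rewrite -singval1// singval_anti.
Qed.

Lemma lyap1_fin_ext0 n : M 0 n = 0.
Proof.
rewrite /M /lyap1_fin; under eq_integral => x _.
  rewrite /log_growth iterate_ext opnorm_extmx// big_ord0 lne1 mule0. over.
exact: integral0.
Qed.

Lemma lyap1_fin_extS k n : (k < m)%N -> M k.+1 n = M k n + singval_avg k.+1 n.
Proof.
move=> km; have n0 : (0 <= n%:R^-1 :> R)%R by rewrite invr_ge0.
have [u1 _] := ui_scale n0 (log_norm_ui hT (bounded_ext (ltnW km) hA) n).
have k1 : (0 < k.+1 <= m)%N by [].
have [u2 _] := ui_scale n0 (lne_singval_ui n k1).
have [_ <-] := ui_add u1 u2; rewrite /M /lyap1_fin; apply: eq_integral => x _.
rewrite /log_growth /log_norm !iterate_ext !opnorm_extmx ?(ltnW km)//.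
set g := iterate T A n x.
have -> : (\prod_(l < k.+1) singval l.+1 g =
    (\prod_(l < k) singval l.+1 g) * singval k.+1 g)%R by rewrite big_ord_recr.
rewrite lneM_ge0 ?singval_ge0 ?prodr_ge0//; last first.
  by move=> l _; exact: singval_ge0.
rewrite muleDr//; apply: ltpinfty_adde_def; rewrite inE; exact: lne_lty.
Qed.

Lemma singval_avg_anti k n : (0 < k < m)%N ->
  singval_avg k.+1 n <= singval_avg k n.
Proof.
move=> /andP[k0 km]; have n0 : (0 <= n%:R^-1 :> R)%R by rewrite invr_ge0.
have k1 : (0 < k.+1 <= m)%N by [].
have k2 : (0 < k <= m)%N by rewrite k0 ltnW.
have [[m1 _ _] _] := ui_scale n0 (lne_singval_ui n k1).
have [[m2 _ _] _] := ui_scale n0 (lne_singval_ui n k2).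
apply: ui_le => //; apply: aeW => x; apply: lee_wpmul2l => //.
by apply: le_lne; rewrite ?singval_ge0 ?singval_anti.
Qed.

Let L k := lyap_inf mu T (ext_cocycle k A).

Let cvgM k : (k <= m)%N -> M k n @[n --> \oo] --> L k.
Proof. by move=> km; exact: cvg_lyap_inf hT _ _ _ (bounded_ext km hA). Qed.

Let L_lty k : (k <= m)%N -> L k < +oo.
Proof. by move=> km; exact: lyap_inf_lty hT _ _ _ (bounded_ext km hA). Qed.

Lemma lyap_inf_ext0 : L 0 = 0.
Proof.
have := cvgM (leq0n m); under eq_fun do rewrite lyap1_fin_ext0.
by move=> /cvg_lim <-//; rewrite lim_cst.
Qed.

Lemma lyap_cvgE k l : singval_avg k n @[n --> \oo] --> l -> lyap mu T k A = l.
Proof. by move=> /cvg_lim <-. Qed.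

Opaque lyap lyap_inf lyap1_fin.

(** As long as the top exponent of the previous exterior power is finite, the next exponent is a
    difference of two convergent sequences. Once that exponent is [-oo] the difference means
    nothing; the last clause then carries the induction, since the averages of smaller singular
    values are dominated by those of larger ones and also tend to [-oo]. *)
Lemma lyap_spec k : (k < m)%N -> [/\
  singval_avg k.+1 n @[n --> \oo] --> lyap mu T k.+1 A,
  lyap mu T k.+1 A < +oo, L k.+1 = L k + lyap mu T k.+1 A &
  L k.+1 = -oo -> lyap mu T k.+1 A = -oo].
Proof.
elim: k => [|k IH] km.
  have e n : singval_avg 1 n = M 1 n by rewrite lyap1_fin_extS// lyap1_fin_ext0 add0e.
  have cv : singval_avg 1 n @[n --> \oo] --> L 1.
    by under eq_fun do rewrite e; exact: cvgM.
  by rewrite (lyap_cvgE cv) lyap_inf_ext0 add0e; split=> //; exact: L_lty.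
have km' := ltnW km; have [cv1 lt1 e1 ny1] := IH km'.
have [fin|] := boolP (L k.+1 \is a fin_num).
  have Mfin n : (0 < n)%N -> M k.+1 n \is a fin_num.
    move=> n0; have h1 : M k.+1 n < +oo by exact: lyap1_fin_lty hT _ _ _ (bounded_ext km' hA) n.
    have h2 : L k.+1 <= M k.+1 n by exact: lyap_inf_le.
    by rewrite fin_numElt h1 (lt_le_trans _ h2)// ltNye; case/fin_numP: fin.
  have cv : singval_avg k.+2 n @[n --> \oo] --> L k.+2 - L k.+1.
    have : M k.+2 n - M k.+1 n @[n --> \oo] --> L k.+2 - L k.+1.
      by apply: cvgeB; [apply: fin_num_adde_defl; rewrite fin_numN|exact: cvgM|exact: cvgM].
    apply: cvg_trans; apply: near_eq_cvg; exists 1%N => // n /= n0.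
    by rewrite lyap1_fin_extS// addeAC subee ?Mfin// add0e.
  rewrite (lyap_cvgE cv); split=> //.
  - by move: (L_lty km) fin; case: (L k.+2) => [?||]//; case: (L k.+1) => [?||]//= _ _; rewrite ltry.
  - by rewrite addeCA subee// adde0.
  - by move=> ->.
rewrite fin_numE negb_and !negbK => /orP[/eqP ny|/eqP py]; last first.
  by have := L_lty km'; rewrite py.
have cv : singval_avg k.+2 n @[n --> \oo] --> -oo.
  move: cv1; rewrite (ny1 ny) => /cvgeNyPle h; apply/cvgeNyPle => t.
  by apply: filterS (h t) => n; apply: le_trans; exact: singval_avg_anti.
have L2 : L k.+2 = -oo.
  have := cvgM km' => /=; rewrite ny => /cvgeNyPle M1.
  have : M k.+2 n @[n --> \oo] --> -oo.
    apply/cvgeNyPle => t; move/cvgeNyPle: cv => /(_ 0%R) s0.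
    near=> n; rewrite lyap1_fin_extS// -[t%:E]adde0.
    by apply: leeD; near: n.
  by move=> h; rewrite -(cvg_lim _ (cvgM km))//; exact: cvg_lim h.
by rewrite (lyap_cvgE cv) ny; split=> //.
Unshelve. all: by end_near. Qed.

Lemma lyap_lty k : (0 < k <= m)%N -> lyap mu T k A < +oo.
Proof. by case: k => // k /= km; case: (lyap_spec km). Qed.

Lemma lyap_anti k : (0 < k < m)%N -> lyap mu T k.+1 A <= lyap mu T k A.
Proof.
case: k => // k /= km; have [cv1 _ _ _] := lyap_spec km.
have [cv0 _ _ _] := lyap_spec (ltnW km).
by apply: (lee_cvg_to cv1 cv0); apply: nearW => n; exact: singval_avg_anti.
Qed.

Lemma lyap_sum_ext k : (k <= m)%N -> lyap_sum mu T k A = L k.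
Proof.
elim: k => [|k IH] km; first by rewrite lyap_inf_ext0 /lyap_sum big_geq.
have [_ _ -> _] := lyap_spec km.
by rewrite -IH 1?ltnW// /lyap_sum big_nat_recr.
Qed.

Lemma lyap1_ext k : (k <= m)%N -> lyap mu T 1 (ext_cocycle k A) = lyap_sum mu T k A.
Proof. by move=> km; rewrite lyap_sum_ext// (lyap1E hT (bounded_ext km hA)). Qed.

Lemma lyap_sum_fin k : (k < m)%N -> -oo < lyap mu T k.+1 A ->
  lyap_sum mu T k.+1 A \is a fin_num /\ lyap_sum mu T k A \is a fin_num.
Proof.
move=> km gt; have [_ lt e ny] := lyap_spec km.
rewrite lyap_sum_ext// lyap_sum_ext; last exact: ltnW.
have f1 : L k.+1 \is a fin_num.
  rewrite fin_numElt (L_lty km) andbT ltNye; apply/eqP => /ny h.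
  by rewrite h in gt.
by split; [exact: f1|move: f1; rewrite e fin_numD => /andP[]].
Qed.

End OneCocycle.

(** By [singval2_extmx] the second exponent of the exterior power is at most
    [L_1 + ... + L_k + L_{k+2}], and its first one is [L_1 + ... + L_{k+1}]. The strict inequality
    survives the addition because the common part is finite, [L_{k+1}] being greater than [-oo]. *)
Lemma lyap2_ext_lt m (A : X -> 'M[R]_m) c k : bounded_cocycle mu A c ->
  (k.+1 < m)%N -> lyap mu T k.+2 A < lyap mu T k.+1 A ->
  lyap mu T 2 (ext_cocycle k.+1 A) < lyap mu T 1 (ext_cocycle k.+1 A).
Proof.
move=> hA km gap; have km' := ltnW km; have km'' := ltnW km'.
have [cv2 _ _ _] := lyap_spec hA km; have [_ lt1 e1 _] := lyap_spec hA km'.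
have gt1 : -oo < lyap mu T k.+1 A by apply: le_lt_trans gap; rewrite leNye.
have [_] := lyap_sum_fin hA km' gt1; rewrite (lyap_sum_ext hA km'') => Lf.
rewrite [ltRHS](lyap1_ext hA km') (lyap_sum_ext hA km') e1.
apply: (@le_lt_trans _ _ (lyap_inf mu T (ext_cocycle k A) + lyap mu T k.+2 A)).
  have hE := bounded_ext km' hA; have C2 : (1 < 'C(m, k.+1))%N.
    by apply: (@leq_trans 'C(k.+2, k.+1)); [rewrite binSn|exact: leq_bin2l].
  have [cvE _ _ _] := lyap_spec hE C2.
  have C2' : (0 < 2 <= 'C(m, k.+1))%N by exact: C2.
  have cvR : lyap1_fin mu T n (ext_cocycle k A) + singval_avg A k.+2 n @[n --> \oo]
      --> lyap_inf mu T (ext_cocycle k A) + lyap mu T k.+2 A.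
    apply: cvgeD; [exact: fin_num_adde_defr| |exact: cv2].
    exact: (cvg_lyap_inf hT (bounded_ext km'' hA)).
  apply: (lee_cvg_to cvE cvR); apply: nearW => n.
  have n0 : (0 <= n%:R^-1 :> R)%R by rewrite invr_ge0.
  have [u1 _] := ui_scale n0 (log_norm_ui hT (bounded_ext km'' hA) n).
  have k2 : (0 < k.+2 <= m)%N by [].
  have [u2 _] := ui_scale n0 (lne_singval_ui hA n k2).
  have [[m12 _ _] e] := ui_add u1 u2.
  have [[mE _ _] _] := ui_scale n0 (lne_singval_ui hE n C2').
  rewrite lyap1_fin_int -[leRHS]e; apply: ui_le => //; apply: aeW => x.
  rewrite /log_norm !iterate_ext -muleDr//; last first.
    by apply: ltpinfty_adde_def; rewrite inE; exact: lne_lty.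
  rewrite -lneM_ge0 ?opnorm_ge0 ?singval_ge0//.
  apply: lee_wpmul2l => //; apply: le_lne; first exact: singval_ge0.
  by rewrite (opnorm_extmx _ km''); exact: singval2_extmx.
by rewrite lteD2lE.
Qed.

End Exponents.

(** * Upper semicontinuity *)

Section Truncation.
Context {d : measure_display} {X : measurableType d} {R : realType}.
Variables (mu : probability X R) (T : X -> X).
Hypothesis hT : measure_preserving mu T.
Local Open Scope ereal_scope.

(** Cutting the log norm below at [-M] makes it real valued and Lipschitz in the norm, with constant
    [exp M]. The maximum is taken inside the logarithm so that no extended value appears. *)
Definition trunc_log m (A : X -> 'M[R]_m) (M : R) n x : R :=
  ln (Num.max (opnorm (iterate T A n x)) (expR (- M))).

Section OneCocycle.
Variables (m : nat) (A : X -> 'M[R]_m) (c : R).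
Hypothesis hA : bounded_cocycle mu A c.

Lemma trunc_logE M n x : (trunc_log A M n x)%:E = maxe (log_norm T A n x) (- M)%:E.
Proof.
rewrite /trunc_log /log_norm; set y := opnorm _.
have [y0|y0] := ltP 0%R y; last first.
  rewrite max_r; last by rewrite (le_trans y0)// expR_ge0.
  by rewrite le0_lneNy// max_r ?leNye// expRK.
rewrite lne_EFin// -EFin_max; congr (_%:E).
rewrite /Num.max; have [lt|ge] := ltP y (expR (- M)).
  by rewrite -[(- M)%R in RHS]expRK ltr_ln ?posrE ?expR_gt0// lt !expRK.
by rewrite -[(- M)%R in RHS]expRK ltr_ln ?posrE ?expR_gt0// ltNge ge.
Qed.

Lemma trunc_log_ge M n x : (- M <= trunc_log A M n x)%R.
Proof. by rewrite -lee_fin trunc_logE le_max lexx orbT. Qed.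

Lemma measurable_trunc_log M n : measurable_fun [set: X] (trunc_log A M n).
Proof.
apply/measurable_EFinP; rewrite /comp; under eq_fun do rewrite trunc_logE.
by apply: measurable_maxe => //; exact: measurable_log_norm hT _ _ _ hA n.
Qed.

Lemma trunc_log_le M n : (0 <= M)%R ->
  {ae mu, forall x, (trunc_log A M n x <= n%:R * c)%R}.
Proof.
move=> M0; apply: filterS (log_norm_le hT hA n) => x h.
rewrite -lee_fin trunc_logE ge_max h lee_fin (@le_trans _ _ 0%R) ?oppr_le0//.
by rewrite mulr_ge0//; case: hA.
Qed.

(** For [M >= 0] truncation leaves the positive part unchanged and replaces the negative part by its
    minimum with [M], which increases to it. Monotone convergence then covers the case where the
    integral is [-oo] as well. *)
Lemma trunc_log_int_lt n (b : R) : log_int mu T A n < b%:E ->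
  exists2 M, (0 <= M)%R & \int[mu]_x (trunc_log A M n x)%:E < b%:E.
Proof.
move=> fb; set f := log_norm T A n; have mf := measurable_log_norm hT hA n.
have [_ _ fp] := log_norm_ui hT hA n.
pose g (M : nat) x := (fun x => (trunc_log A M%:R n x)%:E)^\- x.
have gE M x : g M x = mine (f^\- x) M%:R%:E.
  rewrite /g funenegE trunc_logE oppe_max EFinN oppeK -/f funenegE.
  have M0 : 0 <= M%:R%:E :> \bar R by rewrite lee_fin.
  rewrite -[0 as X in maxe _ X](_ : maxe 0 0 = 0) ?maxxx//.
  have [h|h] := leP (- f x) 0.
    by rewrite (min_l (le_trans h M0)) (max_r h) (min_l M0).
  by rewrite max_l// le_min (ltW h).
have mg M : measurable_fun [set: X] (g M).
  by apply: measurable_funeneg; apply/measurable_EFinP; exact: measurable_trunc_log.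
have gcv x : g M x @[M --> \oo] --> f^\- x.
  under eq_fun do rewrite gE.
  have := funeneg_ge0 f x; case: (f^\- x) => [r| |]// r0.
    apply: cvg_near_cst; near=> M; rewrite min_l// lee_fin.
    by near: M; exact: nbhs_infty_ger.
  under eq_fun do rewrite min_r ?leey//.
  by apply/cvgeryP; exact: cvgr_idn.
have cvI : \int[mu]_x g M x @[M --> \oo] --> \int[mu]_x f^\- x.
  have := @cvg_monotone_convergence _ _ _ mu setT measurableT g mg.
  have -> : (fun x => limn (g^~ x)) = f^\-.
    by apply/funext => x; exact: cvg_lim (gcv x).
  apply; first by move=> M x _; exact: funeneg_ge0.
  move=> x _ p q pq; rewrite !gE.
  by rewrite le_min !ge_min lexx/= lee_fin ler_nat pq orbT.
have pos M : \int[mu]_x (fun x => (trunc_log A M%:R n x)%:E)^\+ x = \int[mu]_x f^\+ x.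
  have M0 : (- M%:R)%:E <= 0 :> \bar R by rewrite lee_fin oppr_le0.
  by apply: eq_integral => x _; rewrite !funeposE trunc_logE -/f -maxA (max_r M0).
have cv : \int[mu]_x (trunc_log A M%:R n x)%:E @[M --> \oo] --> log_int mu T A n.
  rewrite /log_int integralE; under eq_fun do rewrite integralE pos.
  apply: cvgeB => //; last exact: cvg_cst.
  apply: fin_num_adde_defr; rewrite ge0_fin_numE//; exact: integral_ge0.
have [N _ /(_ N (leqnn N)) /= h] := cv _ (open_ereal_lt' fb).
by exists N%:R.
Unshelve. all: by end_near. Qed.

End OneCocycle.

Lemma iterate_dist m (A B : X -> 'M[R]_m) c h : (0 <= h)%R ->
  bounded_cocycle mu A c -> bounded_cocycle mu B c ->
  {ae mu, forall x, (opnorm (B x - A x) <= h)%R} ->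
  {ae mu, forall x, forall n,
    (opnorm (iterate T B n x - iterate T A n x) <= n%:R * expR (n%:R * c) * h)%R}.
Proof.
move=> h0 hA hB BA.
have BA' : {ae mu, forall x, forall j, (opnorm (B (iter j T x) - A (iter j T x)) <= h)%R}.
  by apply: ae_foralln => j; exact: (ae_iter hT j (Q := fun x => (opnorm (B x - A x) <= h)%R)).
have B' : {ae mu, forall x, forall j, (opnorm (B (iter j T x)) <= expR c)%R}.
  apply: ae_foralln => j; apply: (ae_iter hT j (Q := fun x => (opnorm (B x) <= expR c)%R)).
  by case: hB.
have [_ _ c0 _] := hA.
move: (iterate_bounded hT hA) BA' B'; apply: filterS3 => x itA BA' B'.
elim=> [|n IH]; first by rewrite subrr opnorm0 !mul0r.
have -> : (iterate T B n.+1 x - iterate T A n.+1 x =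
    B (iter n T x) *m (iterate T B n x - iterate T A n x) +
    (B (iter n T x) - A (iter n T x)) *m iterate T A n x)%R.
  by rewrite /= mulmxBr mulmxBl addrA subrK.
apply: le_trans (opnormD _ _) _.
apply: le_trans (lerD (opnormM _ _) (opnormM _ _)) _.
have e1 : (opnorm (B (iter n T x)) * opnorm (iterate T B n x - iterate T A n x)
    <= expR c * (n%:R * expR (n%:R * c) * h))%R by rewrite ler_pM ?opnorm_ge0.
have e2 : (opnorm (B (iter n T x) - A (iter n T x)) * opnorm (iterate T A n x)
    <= h * expR (n%:R * c))%R by rewrite ler_pM ?opnorm_ge0.
apply: le_trans (lerD e1 e2) _.
rewrite -natr1 [((n%:R + 1) * c)%R]mulrDl mul1r expRD.
have := expR_ge0 (n%:R * c); have : (1 <= expR c)%R by rewrite -expR0 ler_expR.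
move: (expR c) (expR (n%:R * c)) => a b a1 b0.
have : (h * b <= h * b * a)%R by rewrite ler_peMr// mulr_ge0.
have n0 : (0 <= n%:R :> R)%R by [].
nra.
Qed.

(** With [y] the truncated norm, [y >= exp(-M)] turns the additive error into a factor: [y + eta <=
    y (1 + eta exp M) <= y exp(eta exp M)]. *)
Lemma trunc_log_close m (A B : X -> 'M[R]_m) M n x (eta : R) : (0 <= eta)%R ->
  (opnorm (iterate T B n x - iterate T A n x) <= eta)%R ->
  log_norm T B n x <= (trunc_log A M n x + eta * expR M)%:E.
Proof.
move=> eta0 h; set a := opnorm (iterate T A n x).
have ba : (opnorm (iterate T B n x) <= a + eta)%R.
  have := le_trans (ler_norm _) (opnorm_dist (iterate T B n x) (iterate T A n x)).
  by rewrite -/a lerBlDl => /le_trans; apply; rewrite lerD2l.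
rewrite /log_norm /trunc_log -/a; set y := Num.max _ _.
have y0 : (0 < y)%R by rewrite lt_max expR_gt0 orbT.
apply: lne_le_expR; first exact: opnorm_ge0.
rewrite expRD lnK ?posrE//; apply: le_trans ba _.
apply: (@le_trans _ _ (y * (1 + eta * expR M))%R); last first.
  by rewrite ler_pM2l// expR_ge1Dx.
rewrite mulrDr mulr1 lerD//; first by rewrite le_max lexx.
rewrite mulrCA ler_peMr// -(expRxMexpNx_1 M) mulrC ler_pM2r ?expR_gt0//.
by rewrite le_max lexx orbT.
Qed.

End Truncation.

Section SubadditiveBlocks.
Context {R : realType}.
Implicit Types (a f : nat -> R).

(* Sums of [N] consecutive terms change by at most [f i] from one index to the
   next, so no bookkeeping of residues modulo [N] is needed. *)
Lemma subadditive_blocks a f (c M : R) N n : (N <= n)%N -> 0 <= c -> 0 <= M ->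
  a 0%N <= 0 -> (forall i k, (i + k <= n)%N -> a (i + k)%N <= a i + k%:R * c) ->
  (forall i, (i + N <= n)%N -> a (i + N)%N <= a i + f i) ->
  (forall i, - M <= f i) ->
  N%:R * a n <= 2 * N%:R ^+ 2 * c + N%:R * M + \sum_(i < n) f i.
Proof.
move=> Nn c0 M0 a0 lip block fM.
pose U i := \sum_(r < N) a (i + r)%N.
have gen K i : \sum_(r < K) a (i.+1 + r)%N =
    \sum_(r < K) a (i + r)%N + (a (i + K)%N - a i).
  case: K => [|K]; first by rewrite !big_ord0 addn0 subrr addr0.
  rewrite big_ord_recr big_ord_recl /= addn0 addSnnS.
  have -> : \sum_(r < K) a (i.+1 + r)%N = \sum_(r < K) a (i + bump 0 r)%N.
    by apply: eq_bigr => r _; rewrite addSnnS.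
  by rewrite addrC; ring.
have US i : U i.+1 = U i + (a (i + N)%N - a i) by exact: gen.
have Ule i : (i + N <= n)%N -> U i <= U 0%N + \sum_(j < i) f j.
  elim: i => [|i IH] iN; first by rewrite big_ord0 addr0.
  have iN' : (i + N <= n)%N by apply: leq_trans iN; rewrite leq_add2r.
  rewrite US big_ord_recr /= [leRHS]addrA; apply: lerD; first exact: IH.
  by rewrite lerBlDl; exact: block.
have sumc (y : R) : \sum_(r < N) y = N%:R * y.
  by rewrite sumr_const card_ord mulr_natl.
have U0 : U 0%N <= N%:R * (N%:R * c).
  rewrite -sumc.
  apply: ler_sum => r _; rewrite add0n.
  have rn : (0 + r <= n)%N by rewrite add0n (leq_trans (ltnW (ltn_ord r))).
  apply: le_trans (lip 0%N r rn) _; rewrite -[leRHS]add0r lerD//.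
  by rewrite ler_wpM2r// ler_nat ltnW.
have Un : N%:R * a n <= U (n - N)%N + N%:R * (N%:R * c).
  rewrite -(sumc (a n)) -(sumc (N%:R * c)) -big_split /=.
  apply: ler_sum => r _.
  have e : (n = (n - N + r) + (N - r))%N by have := ltn_ord r; lia.
  rewrite {1}e (le_trans (lip _ _ _)) -?e// lerD2l.
  by rewrite ler_wpM2r// ler_nat leq_subr.
(* The windows only reach the index [n - N]. Extending the sum to all [i < n] costs at most [M] for
   each of the [N] missing terms. *)
have fE : \sum_(i < n - N) f i <= \sum_(i < n) f i + N%:R * M.
  rewrite -(big_mkord xpredT f) -(big_mkord xpredT f (n := n)).
  rewrite [X in _ <= X + _](@big_cat_nat _ _ _ (n - N)) ?leq_subr//=.
  rewrite -addrA lerDl -[X in _ + X]opprK subr_ge0.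
  apply: (@le_trans _ _ (\sum_(n - N <= i < n) - M)).
    by rewrite big_const_nat iter_addr_0 subKn// mulNrn mulr_natl.
  by apply: ler_sum => i _.
have := Ule (n - N)%N; rewrite subnK// leqnn => /(_ isT) h.
move: U0 Un fE h; rewrite expr2; move: (U _) (U _) (\sum_(i < n) f i) (\sum_(i < n - N) f i).
by move=> u v w z *; nra.
Qed.

(** The count is the integer part of [z], written as a sum of indicators of levels; this is what
    turns a truncated log norm into a step function on level sets. *)
Lemma level_count J (z : R) : 0 <= z -> z <= J%:R ->
  (\sum_(i < J) (i.+1%:R <= z)%R)%:R <= z <= (\sum_(i < J) (i.+1%:R <= z)%R)%:R + 1.
Proof.
move=> z0; elim: J => [|J IH] zJ.
  by rewrite big_ord0 z0/=; apply: le_trans zJ _; rewrite lerDl.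
have full K : (K%:R <= z) -> (\sum_(i < K) (i.+1%:R <= z)%R)%N = K.
  move=> Kz; rewrite (eq_bigr (fun=> 1%N)) ?sum_nat_const ?card_ord ?muln1// => i _.
  by rewrite (le_trans _ Kz)// ler_nat.
have [lt|ge] := ltP z J.+1%:R; last by rewrite full// ge (le_trans zJ)// lerDl.
have ltF : (J.+1%:R <= z) = false by rewrite leNgt lt.
rewrite big_ord_recr /= ltF addn0.
have [/IH//|/ltW Jz] := leP z J%:R.
by rewrite full// Jz/= natr1 ltW.
Qed.

End SubadditiveBlocks.

Section UpperSemicontinuity.
Context {d : measure_display} {X : measurableType d} {R : realType}.
Variables (mu : probability X R) (T : X -> X).
Hypothesis hT : measure_preserving mu T.
Variables (C : forall m : nat, set (X -> 'M[R]_m))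
  (dist : forall m : nat, (X -> 'M[R]_m) -> (X -> 'M[R]_m) -> R).
Hypothesis hC : cocycle_space mu C dist.

Let muT : (mu : {measure set X -> \bar R}) [set: X] = 1%E := probability_setT mu.

Lemma Linfty_norm_le m (A : X -> 'M[R]_m) (K : R) : (Linfty_norm mu A <= K%:E)%E ->
  {ae mu, forall x, opnorm (A x) <= K}.
Proof.
rewrite /Linfty_norm unlock muT lte01 => /ess_supP; apply: filterS => x /=.
by rewrite lee_fin ger0_norm ?opnorm_ge0.
Qed.

Lemma class_dist m (B1 B2 : X -> 'M[R]_m) : (0 < m)%N -> C B1 -> C B2 ->
  {ae mu, forall x, opnorm (B1 x - B2 x) <= dist B1 B2}.
Proof.
move=> m0 c1 c2; apply: Linfty_norm_le.
exact: (cocycle_dist_Linfty hC m0 c2 c1).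
Qed.

Lemma class_bounded m (A : X -> 'M[R]_m) : (0 < m)%N -> C A ->
  exists c, forall B, C B -> dist B A < 1 -> bounded_cocycle mu B c.
Proof.
move=> m0 CA; have AK := cocycle_bounded hC m0 CA.
have [K K0 {}AK] : exists2 K : R, 0 <= K & (Linfty_norm mu A <= K%:E)%E.
  move: AK (Lnorm_ge0 mu +oo%E (fun x => (opnorm (A x))%:E)).
  rewrite /Linfty_norm; case: ('N[mu]_+oo[_])%E => [r| |]// _ r0; exists r => //.
exists (ln (K + 1)) => B CB BA; split=> //.
- by move=> i j; exact: (cocycle_measurable hC m0 CB).
- by rewrite ln_ge0// lerDr.
move: (Linfty_norm_le AK) (class_dist m0 CB CA); apply: filterS2 => x Ax BAx.
rewrite lnK ?posrE ?ltr_wpDl//.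
rewrite -(subrK (A x) (B x)) (le_trans (opnormD _ _))// addrC lerD//.
by rewrite (le_trans BAx)// ltW.
Qed.

Lemma lyap1_inf m (A : X -> 'M[R]_m) : (0 < m)%N -> C A ->
  lyap mu T 1 A = lyap_inf mu T A.
Proof.
move=> m0 CA; have [c hc] := class_bounded m0 CA.
by apply: (lyap1E hT (hc _ CA _)); rewrite (cocycle_dist_refl hC m0 CA).
Qed.

Lemma usc_scale m (A : X -> 'M[R]_m) (t : R) : (0 < m)%N -> C A ->
  (lyap mu T 1 A < t%:E)%E -> exists (N : nat) (M s : R), [/\ (0 < N)%N, 0 <= M, s < t &
    (\int[mu]_x (trunc_log T A M N x)%:E < (N%:R * s)%:E)%E].
Proof.
move=> m0 CA; rewrite lyap1_inf// => /lyap_inf_lt[N N0].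
have [c hc] := class_bounded m0 CA.
have hA : bounded_cocycle mu A c by apply: hc; rewrite ?(cocycle_dist_refl hC m0 CA).
rewrite (lyap1_finE hT hA) muleC lte_pdivrMr ?ltr0n// -EFinM => Nt.
have [s st Ns] : exists2 s : R, s < t & (log_int mu T A N < (N%:R * s)%:E)%E.
  move: Nt; case: (log_int mu T A N) => [r| |]//.
    rewrite lte_fin => rt; exists ((r / N%:R + t) / 2).
      by rewrite -ltr_pdivrMr ?ltr0n// in rt; lra.
    rewrite lte_fin -ltr_pdivrMl ?ltr0n// mulrC.
    by rewrite -ltr_pdivrMr ?ltr0n// in rt; lra.
  by move=> _; exists (t - 1); rewrite ?ltNyr// ltrBlDr ltrDl.
have [M M0 hM] := trunc_log_int_lt hT hA Ns.
by exists N, M, s.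
Qed.

(** One scale [N] is enough: the integral at scale [N] hardly increases from [A] to [B], and the
    explicit Fekete bound carries it to all large [n]. The conclusion at every such scale, with [n0]
    common to all [B], is stronger than semicontinuity of the limit and is needed later. *)
Lemma lyap1_usc m (A : X -> 'M[R]_m) (t : R) : (0 < m)%N -> C A ->
  (lyap mu T 1 A < t%:E)%E -> exists (delta : R) (n0 : nat), [/\ 0 < delta, (0 < n0)%N &
    forall B, C B -> dist B A < delta -> forall n, (n0 <= n)%N ->
      (lyap1_fin mu T n B <= t%:E)%E].
Proof.
move=> m0 CA /usc_scale[]// N [M [s [N0 M0 st Ns]]].
have [c hc] := class_bounded m0 CA.
have hA : bounded_cocycle mu A c by apply: hc; rewrite ?(cocycle_dist_refl hC m0 CA).
(* [N exp(N c)] is the Lipschitz constant of the iterate from [iterate_dist], and [exp M] that of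
   the truncated logarithm. Half of [t - s] is spent on moving from [A] to [B], the other half on
   the Fekete remainder [K / n]. *)
pose D := N%:R * expR (N%:R * c) * expR M.
have NR : 0 < N%:R :> R by rewrite ltr0n.
have D0 : 0 < D by rewrite !mulr_gt0 ?expR_gt0.
pose t' := (s + t) / 2.
pose r : R := N%:R * (t - s) / 2.
have r0 : 0 < r by rewrite divr_gt0// mulr_gt0// subr_gt0.
pose K := N%:R * `|t'| + N%:R * c.
have c0 : 0 <= c by case: hA.
have K0 : 0 <= K by rewrite addr_ge0 ?mulr_ge0.
have [n0 _ /(_ n0 (leqnn n0)) hn0] := nbhs_infty_gtr (K / (t - t')).
exists (Num.min 1 (r / D)), n0.+1; split=> //.
  by rewrite lt_min ltr01 divr_gt0.
move=> B CB; rewrite lt_min => /andP[B1 BD] n nn.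
have hB := hc _ CB B1.
have n_gt0 : (0 < n)%N by exact: leq_trans nn.
have BN : (lyap1_fin mu T N B <= t'%:E)%E.
  rewrite (lyap1_finE hT hB) muleC lee_pdivrMr ?ltr0n// -EFinM.
  have mtr := measurable_trunc_log hT hA M N.
  have utr : upper_integrable mu (fun x => (trunc_log T A M N x)%:E).
    apply: (ui_bounded (c := N%:R * c)); first exact/measurable_EFinP.
      by move=> x; exact: ltry.
    by apply: filterS (trunc_log_le hT hA N M0) => x; rewrite lee_fin.
  have [[mm _ _] e] := ui_add utr (ui_cst mu r).
  apply: (@le_trans _ _ (\int[mu]_x ((trunc_log T A M N x)%:E + cst r%:E x))%E).
    apply: ui_le => //; first exact: measurable_log_norm hT _ _ _ hB N.
    have := iterate_dist hT (cocycle_dist_ge0 hC m0 CB CA) hA hB (class_dist m0 CB CA).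
    apply: filterS => x /(_ N) h.
    apply: le_trans (trunc_log_close M _ h) _.
      by rewrite !mulr_ge0 ?expR_ge0// (cocycle_dist_ge0 hC m0 CB CA).
    rewrite -EFinD lee_fin lerD2l mulrAC -/D mulrC -ler_pdivlMr//.
    exact: ltW.
  rewrite e integral_cst// muT mule1.
  apply: le_trans (leeD (ltW Ns) (lexx _)) _.
  by rewrite -EFinD lee_fin /r /t'; lra.
apply: le_trans (lyap1_fin_fekete hT hB N0 n_gt0 BN) _.
rewrite lee_fin -/K -lerBrDl ler_pdivrMr ?ltr0n//.
have tt : 0 < t - t' by rewrite /t'; lra.
rewrite mulrC -ler_pdivrMr//; apply: le_trans (ltW hn0) _.
by rewrite ler_nat ltnW.
Qed.

Variables (Xi : set (X -> R)) (E I : set (R -> R))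
  (P : set (nat * (R -> R) * (R -> R))).
Hypothesis hXi : forall xi : X -> R, Xi xi -> measurable_fun [set: X] xi.
Hypothesis hP : LDT_parameters E I P.
Hypothesis hcompat : forall (m : nat) (A : X -> 'M[R]_m), (0 < m)%N -> C A ->
  compatible mu T Xi A.
Hypothesis hbase : forall xi : X -> R, Xi xi -> base_LDT mu T P xi.

Lemma deviation_sum J (iota : nat -> R -> R) : (forall i, I (iota i)) ->
  I (fun t => \sum_(i < J.+1) iota i t).
Proof.
move=> Ii; elim: J => [|J IH].
  by rewrite (_ : (fun t => _) = iota 0%N)//; apply/funext => t; rewrite big_ord1.
rewrite (_ : (fun t => _) = fun t => (\sum_(i < J.+1) iota i t) + iota J.+1 t).
  exact: (ldt_add hP).
by apply/funext => t; rewrite big_ord_recr.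
Qed.

(** The observable dominates the indicator and its mean exceeds the measure of [F] by at most [eps];
    the deviation size [e_n <= eps] accounts for the second [eps]. Only excess visits to [F] are
    controlled. The threshold and the deviation function form one pair so that [choice] can select
    them level by level. *)
Lemma birkhoff_indic_LDT m (A : X -> 'M[R]_m) N (F : set X) (eps : R) :
  (0 < m)%N -> C A -> norm_algebra T A N F -> measurable F -> 0 < eps ->
  exists q : nat * (R -> R), I q.2 /\ forall n : nat, (q.1 <= n)%N -> (0 < n)%N ->
    (mu [set x | (n%:R * (fine (mu F) + 2 * eps) < \sum_(j < n) \1_F (iter j T x))%R]
      <= (q.2 n%:R)%:E)%E.
Proof.
move=> m0 CA AF mF e0; have [xi [Xxi Fxi xiF]] := hcompat m0 CA AF e0.
have [ixi /(_ _ e0)[n0 [e [iota [Pe he]]]]] := hbase Xxi.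
have [_ _ Ii] := ldt_triplet hP Pe.
exists (n0, iota); split=> // n /= n0n n_gt0; have [en bad] := he n n0n.
have miT j : measurable_fun [set: X] (iter j T) by exact: measurable_iter hT j.
have m1 : measurable_fun [set: X] (fun x => \sum_(j < n) (\1_F (iter j T x) : R)).
  apply: measurable_sum => j; apply: (measurableT_comp _ (miT j)).
  exact: measurable_indic.
have m2 : measurable_fun [set: X] (fun x => \sum_(0 <= j < n) xi (iter j T x)).
  by apply: measurable_sum => j; apply: (measurableT_comp _ (miT j)); exact: hXi.
apply: le_trans (ltW bad); apply: le_measure.
- apply: mem_set; rewrite -[X in measurable X]setTI.
  apply: (@measurable_fun_ltr _ _ _ _ (cst _) _ _ m1 measurableT [set true]) => //.
- apply: mem_set; rewrite -[X in measurable X]setTI.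
  apply: (@measurable_fun_ltr _ _ _ _ (cst _) _ _ _ measurableT [set true]) => //.
  apply: measurableT_comp => //; apply: measurable_funB => //.
  exact: measurable_funM.
move=> x /= big.
have muF : (mu F < +oo)%E by rewrite (le_lt_trans (probability_le1 mu mF)) ?ltry.
have xiF' : \int[mu]_y xi y <= fine (mu F) + eps.
  have fI : (\int[mu]_y (xi y)%:E)%E \is a fin_num by exact: integrable_fin_num ixi.
  have muFE : (fine (mu F))%:E = mu F by rewrite fineK// ge0_fin_numE.
  by rewrite -lee_fin EFinD muFE /Rintegral fineK.
have sums : \sum_(j < n) \1_F (iter j T x) <= \sum_(0 <= j < n) xi (iter j T x).
  by rewrite big_mkord; apply: ler_sum => j _; exact: Fxi.
apply: lt_le_trans (ler_norm _).
have := lt_le_trans big sums; rewrite -ltr_pdivlMl ?ltr0n// => h; lra.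
Qed.

(** Fekete's lemma along a single orbit: [subadditive_blocks] applied to the log norms of the
    successive iterates at [x]. If the norm at time [n] is 0 the bound is trivial; otherwise every
    shorter block has nonzero norm and all logarithms are real. *)
Lemma log_norm_birkhoff m (B : X -> 'M[R]_m) (c M : R) N (F : X -> R) x n :
  (N <= n)%N -> (0 < N)%N -> 0 <= c -> 0 <= M ->
  (forall i k, opnorm (iterate T B k (iter i T x)) <= expR (k%:R * c)) ->
  (forall i, (log_norm T B N (iter i T x) <= (F (iter i T x))%:E)%E) ->
  (forall i, - M <= F (iter i T x)) ->
  (log_norm T B n x <= (N%:R^-1 * (2 * N%:R ^+ 2 * c + N%:R * M
     + \sum_(i < n) F (iter i T x)))%:E)%E.
Proof.
move=> Nn N0 c0 M0 bnd block FM.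
have [y0|y0] := ltP 0 (opnorm (iterate T B n x)); last first.
  by rewrite /log_norm le0_lneNy// leNye.
have pos i k : (i + k <= n)%N -> 0 < opnorm (iterate T B k (iter i T x)).
  move=> ikn; have e : (n = (n - k - i) + k + i)%N by lia.
  move: y0; rewrite e !iterateD => y0.
  have := lt_le_trans y0 (opnormM _ _); rewrite [in X in _ -> X]lt_neqAle.
  rewrite opnorm_ge0 andbT eq_sym; apply: contraTneq => e0.
  rewrite -leNgt; apply: mulr_le0_ge0; last exact: opnorm_ge0.
  by rewrite (le_trans (opnormM _ _))// e0 mulr0.
pose a k := ln (opnorm (iterate T B k x)).
have pa k : (k <= n)%N -> 0 < opnorm (iterate T B k x) by exact: (pos 0%N).
have aD i k : (i + k <= n)%N -> a (i + k)%N <= a i + ln (opnorm (iterate T B k (iter i T x))).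
  move=> ikn; rewrite /a -lnM ?posrE ?pa ?pos//; last exact: leq_trans (leq_addr _ _) ikn.
  rewrite ler_ln ?posrE ?pa// ?mulr_gt0 ?pos ?pa//.
    by rewrite addnC iterateD mulrC opnormM.
  exact: leq_trans (leq_addr _ _) ikn.
rewrite /log_norm lne_EFin// lee_fin -/(a n) ler_pdivlMl ?ltr0n//.
apply: (@subadditive_blocks _ a (fun i => F (iter i T x))) => //.
- by rewrite /a ln_le0// opnorm1_le1.
- move=> i k ikn; apply: le_trans (aD i k ikn) _; rewrite lerD2l.
  by rewrite -[leRHS]expRK ler_ln ?posrE ?expR_gt0 ?pos.
move=> i iN; apply: le_trans (aD i N iN) _; rewrite lerD2l.
by move: (block i); rewrite /log_norm lne_EFin ?lee_fin// pos.
Qed.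

(* A truncation of [log_norm T A N] is bounded above by a step function built on
   level sets of the norm of an iterate, whose Birkhoff sums obey the base-LDT. *)
Lemma lyap1_nusc m (A : X -> 'M[R]_m) (t : R) : (0 < m)%N -> C A ->
  (lyap mu T 1 A < t%:E)%E -> exists (delta : R) (n0 : nat) (iota : R -> R),
  [/\ 0 < delta, (0 < n0)%N, I iota &
    forall B, C B -> dist B A < delta -> forall n, (n0 <= n)%N ->
      (mu [set x | (n%:R * t)%:E < log_norm T B n x] <= (iota n%:R)%:E)%E].
Proof.
have arith (r n z M u v : R) : 0 < r -> 0 <= n -> v <= n * (u + 1) ->
    - M + r / 8 * u <= z -> n * (- M + r / 8 + r / 8) + r / 8 * v <= n * (z + 3 / 8 * r).
  move=> r0 n0 h1 h2.
  have e1 : r / 8 * v <= r / 8 * (n * (u + 1)) by rewrite ler_pM2l ?divr_gt0.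
  have e2 : n * (- M + r / 8 * u) <= n * z by rewrite ler_wpM2l.
  lra.
move=> m0 CA /(usc_scale m0 CA)[N [M [s [N0 M0 st Ns]]]].
have [c hc] := class_bounded m0 CA.
have hA : bounded_cocycle mu A c by apply: hc; rewrite ?(cocycle_dist_refl hC m0 CA).
have c0 : 0 <= c by case: hA.
have NR : 0 < N%:R :> R by rewrite ltr0n.
pose r : R := N%:R * (t - s).
have r0 : 0 < r by rewrite mulr_gt0// subr_gt0.
pose D := N%:R * expR (N%:R * c) * expR M.
have D0 : 0 < D by rewrite !mulr_gt0 ?expR_gt0.
(* The budget [r] per block is split: one eighth for the width of the levels, one for replacing [A]
   by [B], one for the deviations of the Birkhoff sums, and a quarter for the boundary term [K0]. *)
pose eps := r / 8; have eps0 : 0 < eps by rewrite divr_gt0.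
have [J _ /(_ J (leqnn J)) hJ] := nbhs_infty_gtr ((N%:R * c + M) / eps).
pose F i := [set x | opnorm (iterate T A N x) >= expR (- M + i.+1%:R * eps)].
have mop : measurable_fun [set: X] (fun x => opnorm (iterate T A N x)).
  exact/measurable_opnorm/(measurable_iterate_mx hT hA).
have mF i : measurable (F i).
  rewrite -[X in measurable X]setTI.
  apply: (@measurable_fun_ler _ _ _ _ (cst _) _ _ mop measurableT [set true]) => //.
have AF i : norm_algebra T A N (F i).
  move=> G [_ GF]; apply: GF; exists N, (expR (- M + i.+1%:R * eps)).
  by split=> //; right.
(* [birkhoff_indic_LDT] loses twice this amount on each of the [J + 1] levels, so all levels
   together lose exactly 1, that is one level width [eps]. *)
have e'0 : 0 < (2 * J.+1%:R)^-1 :> R by rewrite invr_gt0 mulr_gt0.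
have [q hq] := choice (fun i => birkhoff_indic_LDT m0 CA (AF i) (mF i) e'0).
have F_indic i x : (\1_(F i) x = ((i.+1%:R <= (trunc_log T A M N x + M) / eps)%R)%:R :> R).
  rewrite indicE; congr (_%:R); congr nat_of_bool; rewrite ler_pdivlMr//.
  rewrite -lerBlDr addrC -[X in _ = (X <= _)]expRK /trunc_log.
  rewrite ler_ln ?posrE ?expR_gt0 ?lt_max ?expR_gt0 ?orbT//.
  rewrite le_max ler_expR gerDl [X in _ || X]leNgt mulr_gt0// orbF.
  by apply/idP/idP => h; [exact: (set_mem h)|exact: mem_set].
have z_ge0 x : 0 <= (trunc_log T A M N x + M) / eps.
  by rewrite divr_ge0 ?(ltW eps0)// -lerBlDr sub0r trunc_log_ge.
have z_le x : trunc_log T A M N x <= N%:R * c -> (trunc_log T A M N x + M) / eps <= J.+1%:R.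
  move=> h; apply: le_trans (_ : (N%:R * c + M) / eps <= _).
    by rewrite ler_pM2r ?invr_gt0// lerD2r.
  by apply: le_trans (ltW hJ) _; rewrite ler_nat.
have count x : trunc_log T A M N x <= N%:R * c ->
    - M + eps * \sum_(i < J.+1) \1_(F i) x <= trunc_log T A M N x <=
    - M + eps + eps * \sum_(i < J.+1) \1_(F i) x.
  move=> h; have := level_count (z_ge0 x) (z_le x h).
  rewrite natr_sum; under eq_bigr do rewrite -F_indic.
  rewrite ler_pdivlMr// ler_pdivrMr//.
  by move: (\sum_(i < J.+1) _) (trunc_log _ _ _ _ _) => u v /andP[? ?]; apply/andP; split; lra.
have muF i : (fine (mu (F i)))%:E = mu (F i).
  by rewrite fineK// ge0_fin_numE// (le_lt_trans (probability_le1 mu (mF i))) ?ltry.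
have mean : - M + eps * \sum_(i < J.+1) fine (mu (F i)) <= N%:R * s.
  rewrite -lee_fin; apply: le_trans (ltW Ns).
  have mind : measurable_fun [set: X] (fun x => \sum_(i < J.+1) \1_(F i) x : R).
    by apply: measurable_sum => i; exact: measurable_indic.
  have mtr := measurable_trunc_log hT hA M N.
  apply: (@le_trans _ _ (\int[mu]_x (cst (- M)%:E x + (eps * \sum_(i < J.+1) \1_(F i) x)%:E))%E); last first.
    apply: ui_le; [apply: emeasurable_funD => //|exact/measurable_EFinP|].
      by apply/measurable_EFinP; exact: measurable_funM.
    apply: filterS (trunc_log_le hT hA N M0) => x /count /andP[h _].
    by rewrite -EFinD lee_fin.
  have u2 : upper_integrable mu (fun x => (eps * \sum_(i < J.+1) \1_(F i) x)%:E).
    apply: (ui_bounded (c := eps * J.+1%:R)).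
    - by apply/measurable_EFinP; exact: measurable_funM.
    - by move=> x; exact: ltry.
    apply: aeW => x; rewrite lee_fin ler_wpM2l ?(ltW eps0)//.
    have -> : J.+1%:R = \sum_(i < J.+1) 1 :> R by rewrite sumr_const card_ord.
    by apply: ler_sum => i _; rewrite indicE; case: (_ \in _).
  have e := (ui_add (ui_cst mu (- M)) u2).2; rewrite [leRHS]e.
  rewrite integral_cst// muT mule1 EFinD leeD2l//.
  under eq_integral do rewrite EFinM -sumEFin.
  rewrite ge0_integralZl_EFin ?(ltW eps0)//; last 2 first.
  - by move=> x _; apply: sume_ge0 => i _; rewrite lee_fin.
  - by apply: emeasurable_sum => i; apply/measurable_EFinP; exact: measurable_indic.
  rewrite ge0_integral_sum//; last first.
    by move=> i; apply/measurable_EFinP; exact: measurable_indic.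
  rewrite EFinM lee_wpmul2l ?lee_fin ?(ltW eps0)// -sumEFin lee_sum// => i _.
  by rewrite integral_indic// setIT muF.
pose iota (x : R) := \sum_(i < J.+1) (q i).2 x.
pose K0 := 2 * N%:R ^+ 2 * c + N%:R * M.
have [n1 _ /(_ n1 (leqnn n1)) hn1] := nbhs_infty_gtr (K0 / (r / 4)).
pose n0 := maxn (maxn N n1) (\max_(i < J.+1) (q i).1).
exists (Num.min 1 (r / 8 / D)), n0, iota; split.
- by rewrite lt_min ltr01 !divr_gt0.
- by rewrite leq_max leq_max N0.
- by apply: (@deviation_sum J (fun i => (q i).2)) => i; case: (hq i).
move=> B CB; rewrite lt_min => /andP[B1 BD] n nn.
have hB := hc _ CB B1.
have Nn : (N <= n)%N by apply: leq_trans nn; rewrite /n0 !leq_max leqnn.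
have n1n : (n1 <= n)%N by apply: leq_trans nn; rewrite /n0 !leq_max leqnn orbT.
have n_gt0 : (0 < n)%N by exact: leq_trans Nn.
have qn (i : 'I_J.+1) : ((q i).1 <= n)%N.
  apply: leq_trans nn; rewrite /n0 leq_max; apply/orP; right.
  exact: (leq_bigmax (F := fun i : 'I_J.+1 => (q i).1)).
pose badi i := [set x | n%:R * (fine (mu (F i)) + 2 * (2 * J.+1%:R)^-1) <
   \sum_(j < n) \1_(F i) (iter j T x) :> R].
have miT j : measurable_fun [set: X] (iter j T) by exact: measurable_iter hT j.
have mbad i : measurable (badi i).
  rewrite -[X in measurable X]setTI.
  apply: (@measurable_fun_ltr _ _ _ _ (cst _) _ _ _ measurableT [set true]) => //.
  apply: measurable_sum => j; apply: (measurableT_comp _ (miT j)).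
  exact: measurable_indic.
have bad_le : (mu (\big[setU/set0]_(i < J.+1) badi i) <= (iota n%:R)%:E)%E.
  apply: le_trans (Boole_inequality _ (fun i _ => mbad i)) _.
  rewrite /iota -sumEFin; apply: lee_sum => i _.
  by case: (hq i) => _; exact.
have mlog := measurable_log_norm hT hB n.
have mbig : measurable [set x | (n%:R * t)%:E < log_norm T B n x]%E.
  rewrite -[X in measurable X]setTI.
  exact: emeasurable_fun_o_infty.
have mU : measurable (\big[setU/set0]_(i < J.+1) badi i) by exact: bigsetU_measurable.
suff [Z [mZ Z0 ZP]] : exists Z, [/\ measurable Z, mu Z = 0%E &
    forall x, ~ Z x -> ~ (\big[setU/set0]_(i < J.+1) badi i) x ->
      (log_norm T B n x <= (n%:R * t)%:E)%E].
  apply: (@le_trans _ _ (mu (\big[setU/set0]_(i < J.+1) badi i `|` Z))).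
    apply: le_measure; [exact: mem_set|by apply: mem_set; exact: measurableU|].
    move=> x /= xt; have [|nb] := pselect ((\big[setU/set0]_(i < J.+1) badi i) x).
      by left.
    have [|nZ] := pselect (Z x); first by right.
    by have := ZP x nZ nb; rewrite leNgt xt.
  apply: le_trans (measureU2 _ _ _) _ => //; rewrite [X in (_ + X <= _)%E]Z0 adde0.
  exact: bad_le.
pose h := dist B A; have h0 : 0 <= h by exact: (cocycle_dist_ge0 hC m0 CB CA).
have ae1 : {ae mu, forall x, forall i k,
    opnorm (iterate T B k (iter i T x)) <= expR (k%:R * c)}.
  by apply: ae_foralln => i; exact: (ae_iter hT i (iterate_bounded hT hB)).
have ae2 : {ae mu, forall x, forall i, trunc_log T A M N (iter i T x) <= N%:R * c}.
  by apply: ae_foralln => i; exact: (ae_iter hT i (trunc_log_le hT hA N M0)).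
have ae3 : {ae mu, forall x, forall i k, opnorm (iterate T B k (iter i T x) -
    iterate T A k (iter i T x)) <= k%:R * expR (k%:R * c) * h}.
  apply: ae_foralln => i.
  exact: (ae_iter hT i (iterate_dist hT h0 hA hB (class_dist m0 CB CA))).
have [Z [mZ Z0 ZP]] : {ae mu, forall x, (forall i k,
      opnorm (iterate T B k (iter i T x)) <= expR (k%:R * c)) /\
    (forall i, trunc_log T A M N (iter i T x) <= N%:R * c) /\
    (forall i k, opnorm (iterate T B k (iter i T x) -
      iterate T A k (iter i T x)) <= k%:R * expR (k%:R * c) * h)}.
  by move: ae1 ae2 ae3; apply: filterS3 => x.
exists Z; split=> // x nZ nbad.
have [b1 [b2 b3]] : (forall i k,
      opnorm (iterate T B k (iter i T x)) <= expR (k%:R * c)) /\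
    (forall i, trunc_log T A M N (iter i T x) <= N%:R * c) /\
    (forall i k, opnorm (iterate T B k (iter i T x) -
      iterate T A k (iter i T x)) <= k%:R * expR (k%:R * c) * h).
  by apply: contrapT => nP; apply: nZ; exact: ZP.
pose G y := trunc_log T A M N y + r / 8.
have Dh : N%:R * expR (N%:R * c) * h * expR M <= r / 8.
  rewrite mulrAC -/D mulrC -ler_pdivlMr//; exact: ltW.
apply: le_trans (log_norm_birkhoff (F := G) (M := M) (c := c) Nn N0 _ _ b1 _ _) _ => //.
- move=> i; apply: le_trans (trunc_log_close M _ (b3 i N)) _.
    by rewrite !mulr_ge0 ?expR_ge0.
  by rewrite lee_fin lerD2l.
- move=> i; apply: le_trans (trunc_log_ge T A M N (iter i T x)) _.
  by rewrite lerDl divr_ge0// ltW.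
rewrite lee_fin ler_pdivrMl// -/K0.
have sumG : \sum_(i < n) G (iter i T x) <= n%:R * (N%:R * s + 3 / 8 * r).
  apply: (@le_trans _ _ (\sum_(i < n) (- M + eps + r / 8 +
      eps * \sum_(l < J.+1) \1_(F l) (iter i T x)))).
    apply: ler_sum => i _; rewrite /G; have /andP[_ hi] := count _ (b2 i).
    lra.
  rewrite big_split /= -mulr_sumr exchange_big /= sumr_const card_ord.
  rewrite -[X in X + _ <= _]mulr_natl.
  have cnt : \sum_(l < J.+1) \sum_(i < n) \1_(F l) (iter i T x) <=
      n%:R * (\sum_(l < J.+1) fine (mu (F l)) + 1) :> R.
    apply: (@le_trans _ _ (\sum_(l < J.+1) n%:R * (fine (mu (F l)) + 2 * (2 * J.+1%:R)^-1))).
      apply: ler_sum => l _; rewrite leNgt; apply/negP => hl; apply: nbad.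
      by rewrite -bigcup_mkord; exists l => //=.
    rewrite -mulr_sumr ler_wpM2l// big_split /= lerD2l sumr_const card_ord.
    by rewrite -[leLHS]mulr_natr invfM mulrA divff// mul1r mulVf.
  exact: arith cnt mean.
have K0n : K0 <= n%:R * (r / 4).
  rewrite -ler_pdivrMr ?divr_gt0//; apply: le_trans (ltW hn1) _.
  by rewrite ler_nat.
have rE : N%:R * (n%:R * t) = n%:R * (N%:R * s + r) by rewrite /r; ring.
rewrite rE; have nr : 0 <= n%:R * r by rewrite mulr_ge0// ltW.
lra.
Qed.

End UpperSemicontinuity.

(** * Deviation functions *)

Section DeviationMeasures.
Context {R : realType}.
Variable iota : R -> R.
Hypothesis hi : deviation_measure iota.

Let gt0 (t : R) : 0 < t -> 0 < iota t. Proof. exact: (devm_gt0 hi). Qed.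

Lemma devm_anti s t : 0 < s -> s <= t -> iota t <= iota s.
Proof.
move=> s0; rewrite le_eqVlt => /predU1P[->//|st].
exact/ltW/(devm_decr hi).
Qed.

Let psiE (t : R) : 0 < t -> psi iota t = t / Num.sqrt (iota t).
Proof. by move=> t0; rewrite /psi powRN powR12_sqrt// ltW// gt0. Qed.

Let psi_lt (s t : R) : 0 < s -> s < t -> psi iota s < psi iota t.
Proof.
move=> s0 st; have t0 := lt_trans s0 st; rewrite !psiE//.
apply: ltr_pM => //; rewrite ?(ltW s0) ?invr_ge0 ?sqrtr_ge0//.
by rewrite ltf_pV2 ?posrE ?sqrtr_gt0 ?gt0// ltr_sqrt ?gt0// (devm_decr hi).
Qed.

Let g_cont (t : R) : 0 < t -> {for t, continuous (fun s : R => s / Num.sqrt (iota s))}.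
Proof.
move=> t0; apply: cvgM; first exact: cvg_id.
apply: cvgV; first by rewrite gt_eqF// sqrtr_gt0 gt0.
apply: (@continuous_comp _ _ _ iota Num.sqrt); first exact: (devm_cont hi).
exact: sqrt_continuous.
Qed.

Let psi_inj : {in [set t : R | 0 < t] &, injective (psi iota)}.
Proof.
move=> s t /set_mem /= s0 /set_mem /= t0 e; apply/eqP; rewrite eq_le !leNgt.
by apply/andP; split; apply/negP; [move/(psi_lt t0)|move/(psi_lt s0)]; rewrite e ltxx.
Qed.

(* With s := phi(2 psi(t)) the hypothesis on phi gives s <= r t with r < 2 for
   large t, and then r t / sqrt(iota(r t)) >= psi(s) = 2 t / sqrt(iota(t)). *)
Lemma devm_doubling : exists q t0 : R, [/\ 0 < q, q < 1, 0 < t0 &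
  forall t, t0 <= t -> iota (2 * t) <= q * iota t].
Proof.
have [r [y0 [r0 r2 y00 hr]]] : exists r y0, [/\ 0 < r, r < 2, 0 < y0 &
    forall y, y0 <= y -> phi iota (2 * y) / phi iota y <= r].
  have := devm_phi hi; rewrite /limf_esup => /ereal_inf_lt[_ [V hV <-]] ltV.
  have [y1 [y1r hy1]] : exists y, y \is Num.real /\ forall x, y < x -> V x by exact: hV.
  have ub y : V y -> ((phi iota (2 * y) / phi iota y)%:E <= ereal_sup
     [set (phi iota (2 * t) / phi iota t)%:E | t in V])%E.
    by move=> Vy; apply: ereal_sup_ubound; exists y.
  have Vy1 : V (y1 + 1) by apply: hy1; rewrite ltrDl.
  move: ltV ub; set s := ereal_sup _ => s2 ub.
  have sf : s \is a fin_num.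
    rewrite fin_numE; apply/andP; split; last by rewrite lt_eqF// (lt_trans s2) ?ltry.
    by apply/eqP => sN; have := ub _ Vy1; rewrite sN leeNy_eq.
  exists (Num.max 1 (fine s)), (Num.max 1 (y1 + 1)); split.
  - by rewrite lt_max ltr01.
  - by rewrite gt_max -[X in _ && X]lte_fin fineK// s2 andbT; lra.
  - by rewrite lt_max ltr01.
  move=> y; rewrite ge_max => /andP[_ y1y].
  rewrite le_max; apply/orP; right; rewrite -lee_fin fineK//; apply: ub.
  by apply: hy1; rewrite (lt_le_trans _ y1y)// ltrDl.
have i1 : 0 < iota 1 by exact: gt0.
have s1 : 0 < Num.sqrt (iota 1) by rewrite sqrtr_gt0.
exists ((r / 2) ^+ 2), (Num.max 1 (y0 * Num.sqrt (iota 1))); split.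
- by rewrite exprn_gt0// divr_gt0.
- by rewrite expr_lt1 ?divr_ge0 ?(ltW r0)//; lra.
- by rewrite lt_max ltr01.
move=> t; rewrite ge_max => /andP[t1 ty].
have t0 : 0 < t by exact: lt_le_trans t1.
have st : 0 < Num.sqrt (iota t) by rewrite sqrtr_gt0 gt0.
have psit0 : 0 < psi iota t by rewrite psiE// divr_gt0.
have psity : y0 <= psi iota t.
  rewrite psiE// ler_pdivlMr//; apply: le_trans ty; rewrite ler_pM2l//.
  by rewrite ler_sqrt ?(ltW i1)// devm_anti.
have t2 : 0 < 2 * t by rewrite mulr_gt0.
(* Since [iota] decreases, psi at [2 t] is at least [2 psi(t)]; the intermediate value theorem
   produces the preimage of [2 psi(t)] explicitly, and [phi] can then be evaluated there. *)
have [s st2 sE] : exists2 s, s \in `[t, 2 * t] & psi iota s = 2 * psi iota t.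
  have [|||s st2 sE] := @IVT _ (fun s : R => s / Num.sqrt (iota s)) t (2 * t) (2 * psi iota t).
  - by lra.
  - apply: continuous_in_subspaceT => x /set_mem; rewrite /= in_itv/= => /andP[tx _].
    exact: g_cont (lt_le_trans t0 tx).
  - rewrite -!psiE// ge_min le_max; apply/andP; split; apply/orP; [left; lra|right].
    rewrite !psiE// -mulrA ler_pM2l// ler_pM2l//.
    rewrite lef_pV2 ?posrE ?sqrtr_gt0 ?gt0//.
    by rewrite ler_sqrt ?(ltW (gt0 _))// devm_anti//; lra.
  exists s => //; rewrite psiE//.
  by move: st2; rewrite in_itv/= => /andP[/(lt_le_trans t0)].
move: st2; rewrite in_itv/= => /andP[ts _].
have s0 : 0 < s by exact: lt_le_trans ts.
have phiE u : 0 < u -> phi iota (psi iota u) = u.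
  by move=> u0; rewrite /phi pinvKV//; exact: mem_set.
have srt : s <= r * t.
  by have := hr _ psity; rewrite -sE !phiE// ler_pdivrMr.
have rt0 : 0 < r * t by rewrite mulr_gt0.
have : 2 * psi iota t <= psi iota (r * t).
  rewrite -sE; move: srt; rewrite le_eqVlt => /predU1P[->//|].
  by move/(psi_lt s0)/ltW.
rewrite !psiE// ler_pdivlMr ?sqrtr_gt0 ?gt0// => h.
have h2 : Num.sqrt (iota (r * t)) <= r / 2 * Num.sqrt (iota t).
  rewrite -(ler_pM2l t0) -(ler_pM2l (ltr0n _ 2)).
  have e : 2 * (t / Num.sqrt (iota t)) * Num.sqrt (iota (r * t)) =
      2 * (t * Num.sqrt (iota (r * t))) / Num.sqrt (iota t) by ring.
  by move: h; rewrite e ler_pdivrMr// => /le_trans; apply; lra.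
have -> : (r / 2) ^+ 2 * iota t = (r / 2 * Num.sqrt (iota t)) ^+ 2.
  by rewrite [RHS]exprMn sqr_sqrtr// ltW// gt0.
apply: (@le_trans _ _ (iota (r * t))).
  by apply: devm_anti => //; rewrite ler_pM2r// ltW.
rewrite -[leLHS](sqr_sqrtr (ltW (gt0 rt0))).
by rewrite ler_sqr// nnegrE ?sqrtr_ge0 ?mulr_ge0 ?divr_ge0 ?sqrtr_ge0 ?(ltW r0).
Qed.

(** By [devm_doubling] the terms decay geometrically with ratio [q^th], from the first scale at
    which [c n] passes the doubling threshold. *)
Lemma devm_sum (c th : R) : 0 < c -> 0 < th -> exists (S : R) (n0 : nat), 0 <= S /\
  forall n J : nat, (n0 <= n)%N -> (0 < n)%N ->
    \sum_(j < J) iota (c * (2 ^ j * n)%N%:R) `^ th <= S * iota (c * n%:R) `^ th.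
Proof.
move=> c0 th0; have [q [t0 [q0 q1 t00 hq]]] := devm_doubling.
have [n0 _ /(_ n0 (leqnn n0)) hn0] := nbhs_infty_gtr (t0 / c).
pose Q := q `^ th; have Q0 : 0 < Q by exact: powR_gt0.
have Q1 : Q < 1 by rewrite -[ltRHS](congr1 (@^~ th) (@powR1 R)) gt0_ltr_powR ?nnegrE ?(ltW q0).
exists (1 - Q)^-1, n0; split; first by rewrite invr_ge0; lra.
move=> n J n0n n_gt0.
have term j : iota (c * (2 ^ j * n)%N%:R) `^ th <= Q ^+ j * iota (c * n%:R) `^ th.
  elim: j => [|j IH]; first by rewrite expn0 mul1n expr0 mul1r.
  have cn : 0 < c * (2 ^ j * n)%N%:R by rewrite mulr_gt0// ltr0n muln_gt0 expn_gt0.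
  have t0c : t0 <= c * (2 ^ j * n)%N%:R.
    rewrite mulrC -ler_pdivrMr//; apply: le_trans (ltW hn0) _; rewrite ler_nat.
    by apply: leq_trans n0n _; rewrite leq_pmull// expn_gt0.
  have -> : c * (2 ^ j.+1 * n)%N%:R = 2 * (c * (2 ^ j * n)%N%:R).
    by rewrite expnS !natrM; ring.
  rewrite exprS -mulrA; apply: le_trans (_ : Q * iota (c * (2 ^ j * n)%N%:R) `^ th <= _).
    rewrite /Q -powRM ?(ltW q0) ?(ltW (gt0 _))//.
    apply: ge0_ler_powR; rewrite ?nnegrE ?mulr_ge0 ?(ltW th0) ?(ltW q0) ?(ltW (gt0 _))//.
      by rewrite mulr_gt0.
    exact: hq.
  by rewrite ler_pM2l.
apply: (@le_trans _ _ (\sum_(j < J) Q ^+ j * iota (c * n%:R) `^ th)).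
  by apply: ler_sum => j _.
rewrite -mulr_suml ler_wpM2r ?powR_ge0//.
rewrite -[leRHS]mul1r ler_pdivlMr ?subr_gt0//.
have := subrX1 Q J; have := exprn_ge0 J (ltW Q0); lra.
Qed.

(** At most linear growth of [log(1/iota)] says that [iota] is not smaller than some exponential;
    errors such as [exp(-n gam / 2)] are therefore absorbed by [iota(c n)] once [c] is small. *)
Lemma devm_exp : exists2 K : R, 0 < K &
  exists t0 : R, 0 < t0 /\ forall t, t0 <= t -> expR (- (K * t)) <= iota t.
Proof.
have [K K0 hK] := devm_lin hi; exists K => //.
have [t1 [_ h]] : exists y, y \is Num.real /\ forall x, y < x ->
   ln (1 / iota x) <= K * x by exact: hK.
exists (Num.max 1 (t1 + 1)); split; first by rewrite lt_max ltr01.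
move=> t; rewrite ge_max => /andP[t_1 t1t].
have t0 : 0 < t by exact: lt_le_trans t_1.
have := h t (lt_le_trans _ t1t); rewrite ltrDl ltr01 => /(_ isT).
rewrite div1r lnV ?posrE ?gt0// lerNl => e.
by rewrite -[leRHS]lnK ?posrE ?gt0// ler_expR.
Qed.

Lemma devm_powR_small (c th e : R) : 0 < c -> 0 < th -> 0 < e ->
  exists n0, forall n : nat, (n0 <= n)%N -> iota (c * n%:R) `^ th <= e.
Proof.
move=> c0 th0 e0; pose e' := e `^ th^-1; have e'0 : 0 < e' by exact: powR_gt0.
have [t1 [_ ht1]] : exists y, y \is Num.real /\ forall x, y < x -> iota x <= e'.
  have : \forall x \near +oo, iota x <= e'.
    move/cvgrPdist_le : (devm_cvg0 hi) => /(_ e' e'0); apply: filterS => x.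
    by rewrite sub0r normrN; exact: le_trans (ler_norm _).
  by [].
have [n3 _ /(_ n3 (leqnn n3)) hn3] := nbhs_infty_gtr (t1 / c).
exists (maxn n3 1) => n; rewrite geq_max => /andP[n3n n_gt0].
have -> : e = e' `^ th by rewrite /e' -powRrM mulVf ?gt_eqF// powRr1// ltW.
apply: ge0_ler_powR; rewrite ?nnegrE ?(ltW th0) ?(ltW e'0)//.
  by apply/ltW/gt0; rewrite mulr_gt0 ?ltr0n.
apply: ht1; rewrite mulrC -ltr_pdivrMr//; apply: lt_le_trans hn3 _.
by rewrite ler_nat.
Qed.

End DeviationMeasures.

Section TailBounds.
Context {d : measure_display} {X : measurableType d} {R : realType}.
Variable mu : probability X R.
Implicit Types (f g : X -> R) (F : set X).

Let muT : (mu : {measure set X -> \bar R}) [set: X] = 1%E := probability_setT mu.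

(* The only consequence of an L^p bound that is used; it is stable under sums
   and, unlike integrability, quantitative on sets of small measure. *)
Definition tail_bound (th : R) f (K : R) := [/\ measurable_fun [set: X] f, 0 <= K &
  forall F v, measurable F -> (mu F <= v%:E)%E ->
    (\int[mu]_(x in F) (`|f x|)%:E <= (K * v `^ th)%:E)%E].

Lemma tail_Lnorm (p : \bar R) (f : X -> \bar R) (K : R) : (1 < p)%E ->
  measurable_fun [set: X] f -> ('N[mu]_p[f] < K%:E)%E ->
  tail_bound (fine (1 - p^-1)%E) (fun x => fine (f x)) K.
Proof.
move=> p1 mf fK; have mff : measurable_fun [set: X] (fun x => fine (f x)).
  exact: measurableT_comp.
split=> //.
  by rewrite -lee_fin (le_trans (Lnorm_ge0 mu p f))// ltW.
move=> F v mF Fv; apply: le_trans (Lnorm_small_set p1 mf fK mF Fv).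
apply: ge0_le_integral => //.
- by apply: measurable_funTS; apply/measurable_EFinP; exact: measurableT_comp.
- by apply: measurable_funTS; exact: measurableT_comp.
by move=> x _; case: (f x) => [r| |] //=; rewrite normr0 leey.
Qed.

Lemma tail_integrable th f K : tail_bound th f K ->
  mu.-integrable [set: X] (EFin \o f).
Proof.
move=> [mf K0 fK]; apply/integrableP; split; first exact/measurable_EFinP.
apply: (@le_lt_trans _ _ (K * 1 `^ th)%:E); last exact: ltry.
by apply: fK => //; rewrite muT.
Qed.

Lemma tail_Rintegral th f K F v : tail_bound th f K -> measurable F ->
  (mu F <= v%:E)%E -> \int[mu]_(x in F) `|f x| <= K * v `^ th.
Proof.
move=> tf mF Fv; have [mf K0 fK] := tf.
rewrite -lee_fin /Rintegral fineK; first exact: fK.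
rewrite ge0_fin_numE; last by apply: integral_ge0 => x _; rewrite lee_fin.
exact: le_lt_trans (fK _ _ mF Fv) (ltry _).
Qed.

Lemma tail_mean th f K : tail_bound th f K -> `|\int[mu]_x f x| <= K.
Proof.
move=> tf; apply: le_trans (le_normr_Rintegral measurableT (tail_integrable tf)) _.
apply: le_trans (tail_Rintegral (v := 1) tf measurableT _) _; first by rewrite muT.
by rewrite powR1 mulr1.
Qed.

Lemma tail_add th f g K L : tail_bound th f K -> tail_bound th g L ->
  tail_bound th (fun x => f x + g x) (K + L).
Proof.
move=> [mf K0 fK] [mg L0 gL]; split; [exact: measurable_funD|exact: addr_ge0|].
move=> F v mF Fv; rewrite mulrDl EFinD.
apply: le_trans (leeD (fK _ _ mF Fv) (gL _ _ mF Fv)).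
have m1 : measurable_fun F (fun x => (`|f x|)%:E).
  by apply: measurable_funTS; apply/measurable_EFinP; exact: measurableT_comp.
have m2 : measurable_fun F (fun x => (`|g x|)%:E).
  by apply: measurable_funTS; apply/measurable_EFinP; exact: measurableT_comp.
rewrite -ge0_integralD//; apply: ge0_le_integral => //.
- apply: measurable_funTS; apply/measurable_EFinP; apply: measurableT_comp => //.
  exact: measurable_funD.
- exact: emeasurable_funD.
by move=> x _; rewrite -EFinD lee_fin ler_normD.
Qed.

Lemma tail_scale th f K (a : R) : tail_bound th f K ->
  tail_bound th (fun x => a * f x) (`|a| * K).
Proof.
move=> [mf K0 fK]; split; [exact: measurable_funM|exact: mulr_ge0|].
move=> F v mF Fv; under eq_integral do rewrite normrM EFinM.
rewrite ge0_integralZl_EFin//; last first.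
  by apply: measurable_funTS; apply/measurable_EFinP; exact: measurableT_comp.
by rewrite -mulrA EFinM lee_wpmul2l//; exact: fK.
Qed.

Lemma tail_mean_le th f K F v e : tail_bound th f K -> measurable F ->
  (mu F <= v%:E)%E -> 0 <= e -> {ae mu, forall x, ~ F x -> `|f x| <= e} ->
  `|\int[mu]_x f x| <= e + K * v `^ th.
Proof.
move=> tf mF Fv e0 fe; have [mf K0 fK] := tf.
apply: le_trans (le_normr_Rintegral measurableT (tail_integrable tf)) _.
have mn : measurable_fun [set: X] (fun x => (`|f x|)%:E).
  by apply/measurable_EFinP; exact: measurableT_comp.
have ii : mu.-integrable [set: X] (EFin \o (fun x => `|f x|)).
  have := integrable_abse (tail_integrable tf); apply: eq_integrable => // x _.
rewrite -(setUv F) Rintegral_setU ?setUv//; last 2 first.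
- exact: measurableC.
- by apply/disj_setPS; rewrite setICr.
rewrite addrC lerD//; last exact: tail_Rintegral Fv.
rewrite -lee_fin /Rintegral fineK; last first.
  have iF : mu.-integrable (~` F) (EFin \o (fun x => `|f x|)).
    by apply: (integrableS measurableT) ii => //; exact: measurableC.
  exact: (integrable_fin_num (measurableC mF) iF).
apply: (@le_trans _ _ (\int[mu]_(x in ~` F) cst e%:E x)%E).
  have mFc := measurableC mF; apply: ae_ge0_le_integral => //.
    exact: measurable_funTS.
rewrite integral_cst; last exact: measurableC.
rewrite -[leRHS]mule1 lee_wpmul2l ?lee_fin//.
by apply: probability_le1; exact: measurableC.
Qed.

End TailBounds.

Section InvariantTails.
Context {d : measure_display} {X : measurableType d} {R : realType}.
Variables (mu : probability X R) (T : X -> X).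
Hypothesis hT : measure_preserving mu T.

Let muT : (mu : {measure set X -> \bar R}) [set: X] = 1%E := probability_setT mu.

Lemma Lnorm_iter_lt n (p : \bar R) (f : X -> \bar R) (K : R) : (1 < p)%E ->
  measurable_fun [set: X] f -> ('N[mu]_p[f] < K%:E)%E ->
  ('N[mu]_p[(fun x => f (iter n T x))] < K%:E)%E.
Proof.
move=> p1 mf; apply: le_lt_trans.
case: p p1 => [p| |]// p1.
  rewrite unlock; have e := @integral_iter _ _ _ _ _ hT n (fun x => `|f x| `^ p)%E.
  rewrite e//; apply: (measurableT_comp (measurable_poweR _)).
  exact: measurableT_comp.
rewrite unlock muT lte01; apply/ess_supP.
apply: (ae_iter hT n (Q := fun x => (abse \o f) x <= ess_sup mu (abse \o f))%E).
exact/ess_supP.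
Qed.

Lemma tail_Lnorm_iter n (p : \bar R) (f : X -> \bar R) (K : R) : (1 < p)%E ->
  measurable_fun [set: X] f -> ('N[mu]_p[f] < K%:E)%E ->
  tail_bound mu (fine (1 - p^-1)%E) (fun x => fine (f (iter n T x))) K.
Proof.
move=> p1 mf fK; apply: (tail_Lnorm (f := fun x => f (iter n T x))) => //.
  exact: measurableT_comp mf (measurable_iter hT n).
exact: Lnorm_iter_lt.
Qed.

Lemma Rintegral_iter n (f : X -> R) : measurable_fun [set: X] f ->
  \int[mu]_x f (iter n T x) = \int[mu]_x f x.
Proof.
move=> mf; congr fine; apply: (@integral_iter _ _ _ _ _ hT n (EFin \o f)).
exact/measurable_EFinP.
Qed.

End InvariantTails.

(** * Finite scale estimates near a cocycle with a gap *)

Section DoublingScheme.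
Context {R : realType}.
(** The passage to the limit involves no measure theory: [V] is a neighbourhood of the cocycle [A],
    [D] the distance, [l n] and [L] the finite scale and limit exponents, and [a n] the error at
    scale [n]. *)
Variables (W : Type) (V : W -> Prop) (D : W -> W -> R) (A : W).
Variables (l : nat -> W -> R) (L : W -> R) (a : nat -> R) (eps C1 K S : R) (n0 : nat).
Hypotheses (eps_gt0 : 0 < eps) (C1_gt0 : 0 < C1) (K_ge0 : 0 <= K) (S_ge0 : 0 <= S).
Hypothesis n0_gt0 : (0 < n0)%N.
Hypothesis VA : V A.
Hypotheses (a_ge0 : forall n, (n0 <= n)%N -> 0 <= a n)
  (a_anti : forall n k, (n0 <= n <= k)%N -> a k <= a n)
  (a_cvg0 : forall e, 0 < e -> exists n1, forall n, (n1 <= n)%N -> a n <= e).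
Hypothesis a_sum : forall n J, (n0 <= n)%N -> \sum_(j < J) a (2 ^ j * n)%N <= S * a n.
Hypothesis l_cvg : forall B e, V B -> 0 < e -> exists n1, forall n, (n1 <= n)%N ->
  l n B <= L B + e.
Hypothesis l_ge : forall B n, V B -> (0 < n)%N -> L B <= l n B.
Hypothesis l_double : forall B n, V B -> (0 < n)%N -> l (2 * n) B <= l n B.

(* If [l n B] were exactly [L B + b / n], this would be [L B]. *)
Definition extrapolate n B := 2 * l (2 * n) B - l n B.

(** The lower bound on [l (2 n) B] is a premise because exponents of cocycles near [A] are not yet
    bounded below; [near_lower] discharges it at all scales. *)
Hypothesis step : forall B n, V B -> (n0 <= n)%N -> L A - eps <= l (2 * n) B ->
  `|extrapolate (2 * n) B - extrapolate n B| <= K * a n.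
Hypothesis close : forall B1 B2 n, V B1 -> V B2 -> (n0 <= n)%N ->
  D B1 B2 <= expR (- (n%:R * C1)) -> `|l n B1 - l n B2| <= K * a n.

Let dbl_ge n j : (n0 <= n)%N -> (n0 <= 2 ^ j * n)%N.
Proof. by move=> /leq_trans; apply; rewrite leq_pmull// expn_gt0. Qed.

Let dbl_large n j : (0 < n)%N -> (j <= 2 ^ j * n)%N.
Proof.
move=> n_gt0; apply: leq_trans (ltnW (ltn_expl j (ltnSn 1))) _.
by rewrite leq_pmulr.
Qed.

Let le_dbl n : (n <= 2 * n)%N. Proof. by rewrite leq_pmull. Qed.

Let close2 B1 B2 n : V B1 -> V B2 -> (n0 <= n)%N ->
  D B1 B2 <= expR (- (n%:R * (2 * C1))) -> `|l n B1 - l n B2| <= K * a n /\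
    `|l (2 * n) B1 - l (2 * n) B2| <= K * a n.
Proof.
move=> V1 V2 n0n hD; have C0 := C1_gt0.
have n2n : (n <= 2 * n)%N by rewrite leq_pmull.
split.
  apply: close => //; apply: le_trans hD _; rewrite ler_expR lerN2 ler_wpM2l//; lra.
apply: (@le_trans _ _ (K * a (2 * n)%N)); last by rewrite ler_wpM2l// a_anti// n0n.
apply: close => //; first exact: leq_trans n2n.
by apply: le_trans hD _; rewrite natrM ler_expR mulrA [_ * 2]mulrC.
Qed.

(* [l (4 n) >= extrapolate (2 n)] by [l_double], so the condition required by
   [step] propagates from n to 2n as long as the accumulated error is small. *)
Let near_lower : exists r : R, 0 < r /\ forall B, V B -> D B A <= r -> L A - eps <= L B.
Proof.
have e0 := eps_gt0.
have aux (x y z : R) : 0 < y -> 0 <= z -> x <= y - 1 -> y * z <= eps / 4 -> x * z <= eps / 4.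
  by move=> *; nra.
(* [3 K a(n)] bounds the change of [2 l(2n) - l(n)] from [A] to [B], and [K S a(n)] the sum of all
   later steps; the 1 only keeps the divisor positive. *)
have M0 : 0 < 3 * K + K * S + 1.
  by move: (K_ge0) (mulr_ge0 K_ge0 S_ge0) => ? ?; lra.
have [n1 an] := a_cvg0 (divr_gt0 (divr_gt0 eps_gt0 (ltr0n _ 4)) M0).
have [n2 ln] := l_cvg VA (divr_gt0 eps_gt0 (ltr0n _ 4)).
pose n := maxn n0 (maxn n1 n2).
have n0n : (n0 <= n)%N by rewrite leq_maxl.
have n1n : (n1 <= n)%N by rewrite !leq_max leqnn orbT.
have n2n : (n2 <= n)%N by rewrite !leq_max leqnn !orbT.
have n_gt0 : (0 < n)%N by exact: leq_trans n0n.
have {}an : (3 * K + K * S) * a n <= eps / 4.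
  apply: (aux _ (3 * K + K * S + 1)); rewrite ?a_ge0// ?addrK//.
  by rewrite mulrC -ler_pdivlMr// an.
have {}ln : l n A <= L A + eps / 4 by exact: ln.
exists (expR (- (n%:R * (2 * C1)))); split; first exact: expR_gt0.
move=> B VB BA.
have lA2 : L A <= l (2 * n) A by rewrite l_ge// muln_gt0.
have Ka := mulr_ge0 K_ge0 (a_ge0 n0n).
have KSa := mulr_ge0 (mulr_ge0 K_ge0 S_ge0) (a_ge0 n0n).
have [] := close2 VB VA n0n BA; rewrite !ler_distl => /andP[_ c1] /andP[c2 _].
have main j : extrapolate n B - K * \sum_(i < j) a (2 ^ i * n)%N
      <= extrapolate (2 ^ j * n) B /\
    L A - eps <= l (2 * (2 ^ j * n)) B.
  elim: j => [|j [IH1 IH2]].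
    rewrite big_ord0 mulr0 subr0 expn0 mul1n; split=> //; lra.
  have dj := dbl_ge j n0n.
  have := step VB dj IH2; rewrite mulnA -expnS ler_distl => /andP[st _].
  have lo : extrapolate n B - K * \sum_(i < j.+1) a (2 ^ i * n)%N
      <= extrapolate (2 ^ j.+1 * n) B.
    by rewrite big_ord_recr /= mulrDr; lra.
  split=> //.
  have dj1 : (0 < 2 ^ j.+1 * n)%N by exact: leq_trans (dbl_ge j.+1 n0n).
  have := l_double VB dj1; have := ler_wpM2l K_ge0 (a_sum j.+1 n0n).
  move: lo; rewrite /extrapolate; lra.
rewrite leNgt; apply/negP => lt.
have gap : 0 < L A - eps - L B by rewrite subr_gt0.
have [n3 hn3] := l_cvg VB (divr_gt0 gap (ltr0n _ 2)).
have h := hn3 _ (leq_trans (dbl_large n3 n_gt0) (le_dbl _)).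
have := (main n3).2; lra.
Qed.

(** The steps telescope along [n, 2n, 4n, ...], and far out [extrapolate] is close to
    [2 L - L = L]. *)
Let extrapolate_limit B n : V B -> (forall k, (0 < k)%N -> L A - eps <= l k B) ->
  (n0 <= n)%N -> `|L B - extrapolate n B| <= K * S * a n.
Proof.
move=> VB lB n0n; have n_gt0 : (0 < n)%N by exact: leq_trans n0n.
have main j : `|extrapolate (2 ^ j * n) B - extrapolate n B| <= K * \sum_(i < j) a (2 ^ i * n)%N.
  elim: j => [|j IH]; first by rewrite expn0 mul1n subrr normr0 big_ord0 mulr0.
  rewrite big_ord_recr /= mulrDr [leRHS]addrC.
  have dj := dbl_ge j n0n.
  have := step VB dj (lB _ (leq_trans n0_gt0 (leq_trans dj (le_dbl _)))).
  rewrite mulnA -expnS => st; apply: le_trans (lerD st IH).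
  exact: ler_distD.
apply/ler_addgt0Pr => e e0.
have [n3 hn3] := l_cvg VB (divr_gt0 e0 (ltr0n _ 2)).
have := main n3; set N := (2 ^ n3 * n)%N => mN.
have nN : (n3 <= N)%N by exact: dbl_large.
have N0 : (0 < N)%N by rewrite muln_gt0 expn_gt0.
have NN : (N <= 2 * N)%N by rewrite leq_pmull.
have := hn3 _ nN; have := hn3 _ (leq_trans nN NN).
have := l_ge VB N0; have := l_ge VB (leq_trans N0 NN).
have := ler_wpM2l K_ge0 (a_sum n3 n0n); rewrite mulrA.
move: mN; rewrite /extrapolate !ler_distl => /andP[? ?] *; apply/andP; split; lra.
Qed.

(** Both exponents are replaced by [extrapolate n], which costs [2 K S]; comparing [2 l(2n) - l(n)]
    at the two cocycles costs [3 K]. *)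
Lemma doubling_scheme : exists (r K' : R), [/\ 0 < r, 0 <= K' &
  forall B1 B2 n, V B1 -> V B2 -> D B1 A <= r -> D B2 A <= r -> (n0 <= n)%N ->
    D B1 B2 <= expR (- (n%:R * (2 * C1))) -> `|L B1 - L B2| <= K' * a n].
Proof.
have [r [r0 hr]] := near_lower.
exists r, (2 * (K * S) + 3 * K); split=> //.
  by rewrite addr_ge0 ?mulr_ge0.
move=> B1 B2 n V1 V2 /(hr _ V1) L1 /(hr _ V2) L2 n0n h12.
have := extrapolate_limit V1 (fun k k0 => le_trans L1 (l_ge V1 k0)) n0n.
have := extrapolate_limit V2 (fun k k0 => le_trans L2 (l_ge V2 k0)) n0n.
have [] := close2 V1 V2 n0n h12.
rewrite /extrapolate !ler_distl => /andP[? ?] /andP[? ?] /andP[? ?] /andP[? ?].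
by apply/andP; split; lra.
Qed.

End DoublingScheme.

Lemma ln_dist {R : realType} (a b s : R) : 0 < s -> s <= a -> s <= b ->
  `|ln a - ln b| <= `|a - b| / s.
Proof.
move=> s0; wlog ab : a b / b <= a.
  move=> H sa sb; have [/H|/ltW/H] := leP b a; first exact.
  by rewrite (distrC (ln b)) (distrC b); exact.
move=> sa sb; have b0 := lt_le_trans s0 sb; have a0 := lt_le_trans s0 sa.
rewrite ger0_norm ?subr_ge0 ?ler_ln ?posrE// ger0_norm ?subr_ge0// -ln_div ?posrE//.
rewrite (_ : a / b = 1 + (a - b) / b); last by field; rewrite gt_eqF.
apply: (@le_trans _ _ ((a - b) / b)).
  by apply: le_ln1Dx; rewrite (lt_le_trans (ltrN10 _))// divr_ge0 ?subr_ge0// ltW.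
by rewrite ler_wpM2l ?subr_ge0// lef_pV2 ?posrE.
Qed.

Section QuadrupleProducts.
Context {d : measure_display} {X : measurableType d} {R : realType}.
Variable T : X -> X.

Lemma iterate_double m (B : X -> 'M[R]_m) n x :
  iterate T B (2 * n) x = iterate T B n (iter n T x) *m iterate T B n x.
Proof. by rewrite mul2n -addnn iterateD. Qed.

Lemma iterate_quadruple m (B : X -> 'M[R]_m) n x : iterate T B (2 * (2 * n)) x =
  iterate T B n (iter (n + n + n) T x) *m
    (iterate T B n (iter (n + n) T x) *m iterate T B n (iter n T x)) *m iterate T B n x.
Proof.
have -> : (2 * (2 * n) = n + (n + n + n))%N by rewrite !mul2n -!addnn !addnA.
by rewrite iterateD (iterateD _ _ (n + n)) iterateD !mulmxA -iterD.
Qed.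

(** [ln_opnorm_prod4] with [a = N gam / 5] and [b = 9 N gam / 10]. Indeed [ell - ell2 <= gam / 32],
    so multiplying neighbours loses at most [N gam (1/16 + 1/10)], which is below [a], and
    [2 a - b = - N gam / 2]. Each logarithm is normalized by its own length; the combination is
    [(2 N)^-1] times that of [ln_opnorm_prod4], which with [N >= 1] turns 18 into 9. *)
Lemma ln_opnorm_quadruple m (g3 g2 g1 g0 : 'M[R]_m) (N ell ell2 lam gam : R) :
  (0 < m)%N -> 1 <= N -> 0 < gam -> lam - gam / 40 <= ell2 -> ell2 <= ell ->
  ell <= lam + gam / 160 ->
  (forall g, g \in [:: g3; g2; g1; g0] -> `|ln (opnorm g) - N * ell| <= N * (gam / 40)) ->
  (forall g, g \in [:: g3 *m g2; g2 *m g1; g1 *m g0] -> 0 < opnorm g /\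
    `|ln (opnorm g) - 2 * N * ell2| <= 2 * N * (gam / 40)) ->
  (forall g, g \in [:: g2; g1; g2 *m g1] ->
    singval 2 g <= expR (- (N * (9 / 10 * gam))) * opnorm g) ->
  6 * expR (2 - N * gam / 2) <= 1 ->
  0 < opnorm (g3 *m (g2 *m g1) *m g0) /\
  `|2 * ((4 * N)^-1 * ln (opnorm (g3 *m (g2 *m g1) *m g0)))
    + 2^-1 * (N^-1 * ln (opnorm g2)) + 2^-1 * (N^-1 * ln (opnorm g1))
    + - 1 * ((2 * N)^-1 * ln (opnorm (g3 *m g2)))
    + - 1 * ((2 * N)^-1 * ln (opnorm (g2 *m g1)))
    + - 1 * ((2 * N)^-1 * ln (opnorm (g1 *m g0)))| <= 9 * expR (2 - N * gam / 2).
Proof.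
move=> m0 N1 gam0 lo mid hi one two sv small.
have N0 : 0 < N by exact: lt_le_trans N1.
have pair (u v w : R) : `|u - N * ell| <= N * (gam / 40) -> `|v - N * ell| <= N * (gam / 40) ->
    `|w - 2 * N * ell2| <= 2 * N * (gam / 40) -> u + v - N * (gam / 5) <= w.
  rewrite !ler_distl => /andP[_ u1] /andP[_ v1] /andP[w1 _].
  have : 0 <= N * (gam / 32 - (ell - ell2)) by rewrite mulr_ge0 ?(ltW N0)//; lra.
  have : 0 < N * gam by exact: mulr_gt0.
  lra.
have combine (z u v w t s E : R) : 0 <= E -> `|z + u + v - w - t - s| <= 18 * E ->
   `|2 * ((4 * N)^-1 * z) + 2^-1 * (N^-1 * u) + 2^-1 * (N^-1 * v) + - 1 * ((2 * N)^-1 * w)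
    + - 1 * ((2 * N)^-1 * t) + - 1 * ((2 * N)^-1 * s)| <= 9 * E.
  move=> E0 h; rewrite (_ : _ + _ = (2 * N)^-1 * (z + u + v - w - t - s)); last first.
    by field; rewrite gt_eqF.
  rewrite normrM ger0_norm ?invr_ge0 ?mulr_ge0 ?(ltW N0)//.
  rewrite ler_pdivrMl ?mulr_gt0//; apply: le_trans h _.
  by have := ler_wpM2r E0 N1; lra.
have e : 2 * (N * (gam / 5) + 1) - N * (9 / 10 * gam) = 2 - N * gam / 2 by field.
have [p32 k32] := two _ (mem_head _ _).
have [p21 k21] : 0 < opnorm (g2 *m g1) /\
  `|ln (opnorm (g2 *m g1)) - 2 * N * ell2| <= 2 * N * (gam / 40).
  by apply: two; rewrite !inE eqxx orbT.
have [p10 k10] : 0 < opnorm (g1 *m g0) /\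
  `|ln (opnorm (g1 *m g0)) - 2 * N * ell2| <= 2 * N * (gam / 40).
  by apply: two; rewrite !inE eqxx !orbT.
have [] := @ln_opnorm_prod4 R m m0 g3 g2 g1 g0 (N * (gam / 5)) (N * (9 / 10 * gam)).
- by rewrite mulr_ge0 ?(ltW N0)// divr_ge0// ltW.
- exact: p32.
- exact: p21.
- exact: p10.
- by apply: pair k32; apply: one; rewrite !inE eqxx ?orbT.
- by apply: pair k21; apply: one; rewrite !inE eqxx ?orbT.
- by apply: pair k10; apply: one; rewrite !inE eqxx ?orbT.
- by apply: sv; rewrite !inE eqxx.
- by apply: sv; rewrite !inE eqxx !orbT.
- by apply: sv; rewrite !inE eqxx !orbT.
- by rewrite e.
rewrite e => pos h; split=> //; apply: combine h; exact: expR_ge0.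
Qed.

End QuadrupleProducts.

Section GapEstimates.
Context {d : measure_display} {X : measurableType d} {R : realType}.
Variables (mu : probability X R) (T : X -> X).
Hypothesis hT : measure_preserving mu T.
Variables (p : \bar R) (m : nat) (lam gam c K : R) (iota : R -> R) (n0 : nat).
Hypotheses (hp : (1 < p)%E) (m_gt1 : (1 < m)%N) (gam_gt0 : 0 < gam)
  (hi : deviation_measure iota).
Implicit Types B : X -> 'M[R]_m.

Let m_gt0 : (0 < m)%N := ltnW m_gt1.
Local Notation th := (fine (1 - p^-1)%E).

Definition lyap1_real n B : R := fine (lyap1_fin mu T n B).

(* With deviation gam / 40 the errors in [ln_opnorm_quadruple] add up to less than
   half of the spectral gap, which leaves exp(- n gam / 2). *)
Definition good n B x := [/\ 0 < opnorm (iterate T B n x),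
  `|ln (opnorm (iterate T B n x)) - n%:R * lyap1_real n B| <= n%:R * (gam / 40) &
  opnorm (extmx 2 (iterate T B n x)) <= expR (n%:R * (2 * lam - gam))].

(** What is known about all cocycles near [A], with common constants. In the application [lam] is
    [L_1(A)] and [gam] satisfies [L_1(A) + L_2(A) < 2 lam - gam]. In terms of [lam] the finite scale
    exponents are bounded from above only. *)
Definition controlled B := [/\ bounded_cocycle mu B c,
  forall n, (0 < n)%N -> ('N[mu]_p[log_growth T B n] < K%:E)%E,
  forall n, (n0 <= n)%N -> lyap1_real n B <= lam + gam / 160 &
  forall n, (n0 <= n)%N -> exists F, [/\ measurable F, (mu F <= (iota n%:R)%:E)%E &
    forall x, ~ F x -> good n B x]].

Let measurable_log_growth B n : bounded_cocycle mu B c ->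
  measurable_fun [set: X] (log_growth T B n).
Proof.
move=> hB; rewrite /log_growth.
have -> : (fun x : X => ((n%:R^-1)%:E * lne (opnorm (iterate T B n x))%:E)%E) =
  (fun x => ((n%:R^-1)%:E * log_norm T B n x)%E) by [].
by apply: measurable_funeM; exact: measurable_log_norm hT _ _ _ hB n.
Qed.

Lemma log_growth_fine B n x : 0 < opnorm (iterate T B n x) ->
  fine (log_growth T B n x) = n%:R^-1 * ln (opnorm (iterate T B n x)).
Proof. by move=> pos; rewrite /log_growth lne_EFin. Qed.

Lemma lyap1_fin_real B n : bounded_cocycle mu B c ->
  ('N[mu]_p[log_growth T B n] < K%:E)%E ->
  lyap1_fin mu T n B = (lyap1_real n B)%:E /\
  lyap1_real n B = \int[mu]_x fine (log_growth T B n x).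
Proof.
move=> hB hK; have mg := measurable_log_growth n hB.
have e : lyap1_fin mu T n B = (\int[mu]_x (fine (log_growth T B n x))%:E)%E.
  apply: ae_eq_integral => //; first by apply/measurable_EFinP; exact: measurableT_comp.
  by apply: filterS (Lnorm_fin_num hp mg hK) => x fx _; rewrite fineK.
have i := tail_integrable (tail_Lnorm hp mg hK).
rewrite /lyap1_real e fineK//; exact: (integrable_fin_num measurableT i).
Qed.

Let tail_growth B n k : controlled B -> (0 < n)%N ->
  tail_bound mu th (fun x => fine (log_growth T B n (iter k T x))) K.
Proof.
by move=> [hB hK _ _] n_gt0; exact: (tail_Lnorm_iter hT k hp (measurable_log_growth n hB) (hK n n_gt0)).
Qed.

Let integral_growth B n k : controlled B -> (0 < n)%N ->
  \int[mu]_x fine (log_growth T B n (iter k T x)) = lyap1_real n B.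
Proof.
move=> [hB hK _ _] n_gt0; rewrite (lyap1_fin_real hB (hK n n_gt0)).2.
apply: (Rintegral_iter hT k (f := fun x => fine (log_growth T B n x))).
by apply: measurableT_comp => //; exact: measurable_log_growth.
Qed.

Lemma lyap1_real_le B n : controlled B -> (0 < n)%N -> `|lyap1_real n B| <= K.
Proof.
move=> cB n_gt0; rewrite -(integral_growth 0 cB n_gt0).
exact: tail_mean (tail_growth 0 cB n_gt0).
Qed.

Let K_ge0 B : controlled B -> 0 <= K.
Proof. by move=> cB; exact: le_trans (normr_ge0 _) (lyap1_real_le cB (ltn0Sn 0)). Qed.

Let shifted_good B n k : controlled B -> (n0 <= n)%N -> exists F,
  [/\ measurable F, (mu F <= (iota n%:R)%:E)%E & forall x, ~ F x -> good n B (iter k T x)].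
Proof.
move=> [_ _ _ hB] /hB[F [mF Fi gF]]; exists (iter k T @^-1` F); split.
- by rewrite -[X in measurable X]setTI; exact: (measurable_iter hT).
- by apply: le_trans Fi; rewrite -[leRHS](measure_iter hT k mF).
- by move=> x Fx; exact: gF.
Qed.

Let union_bound (F G : set X) (u v : R) : measurable F -> measurable G ->
  (mu F <= u%:E)%E -> (mu G <= v%:E)%E ->
  measurable (F `|` G) /\ (mu (F `|` G) <= (u + v)%:E)%E.
Proof.
move=> mF mG Fu Gv; split; first exact: measurableU.
by rewrite EFinD; apply: le_trans (measureU2 _ mF mG) (leeD Fu Gv).
Qed.

(** The second singular value is the norm of the exterior square divided by the norm; the bound on
    the former is divided twice by the norm, whose logarithm is at least [n (ell - gam / 40)]. *)
Let good_singval2 B n x (ell : R) : good n B x -> ell <= lyap1_real n B -> 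
  singval 2 (iterate T B n x) <=
  expR (n%:R * (2 * lam - gam) - 2 * (n%:R * (ell - gam / 40))) * opnorm (iterate T B n x).
Proof.
move=> [pos dev ext] ell_le.
have e1 : opnorm (extmx 1 (iterate T B n x)) = opnorm (iterate T B n x).
  by rewrite opnorm_extmx// big_ord1 singval1.
rewrite (@singval_ext_div R m 1)// e1 ler_pdivrMr//.
apply: le_trans ext _; rewrite -mulrA -expr2.
rewrite -[X in _ <= _ * X ^+ 2]lnK ?posrE// -expRM_natl -expRD ler_expR.
have n0' : (0 : R) <= n%:R by [].
have aux (N u L g z : R) : 0 <= N -> ell <= z -> `|L - N * z| <= N * g ->
    N * u <= N * u - 2 * (N * (ell - g)) + 2%:R * L.
  by move=> N0 lz; rewrite ler_distl => /andP[h _]; have := ler_wpM2l N0 lz; lra.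
exact: aux dev.
Qed.

(** Off the exceptional sets both norms are at least [exp(-n (K + gam / 40))], so the logarithm is
    Lipschitz with the inverse of this constant, and the iterates differ by at most [n exp(n c) h].
    The exponent [c + K + 2 gam] in the smallness of [h] beats both with [exp(-n gam)] to spare; the
    factor [n] cancels against the normalization. *)
Lemma gap_close B1 B2 n h : controlled B1 -> controlled B2 -> (n0 <= n)%N -> (0 < n)%N ->
  0 <= h -> {ae mu, forall x, opnorm (B1 x - B2 x) <= h} ->
  h <= expR (- (n%:R * (c + K + 2 * gam))) ->
  `|lyap1_real n B1 - lyap1_real n B2|
    <= expR (- (n%:R * gam)) + 2 * K * (2 * iota n%:R) `^ th.
Proof.
move=> c1 c2 n0n n_gt0 h0 hB hh; have g0 := gam_gt0.
have nR : 0 < n%:R :> R by rewrite ltr0n.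
have [hB1 _ _ _] := c1; have [hB2 _ _ _] := c2.
have [F1 [mF1 F1i G1]] := shifted_good 0 c1 n0n.
have [F2 [mF2 F2i G2]] := shifted_good 0 c2 n0n.
have [mF Fi] := union_bound mF1 mF2 F1i F2i.
pose f B x := fine (log_growth T B n x).
have t1 : tail_bound mu th (f B1) K by exact: (tail_growth 0 c1).
have t2 : tail_bound mu th (fun x => - 1 * f B2 x) (`|- 1| * K).
  exact: (tail_scale (- 1) (tail_growth 0 c2 n_gt0)).
have t12 := tail_add t1 t2.
rewrite -(integral_growth 0 c1 n_gt0) -(integral_growth 0 c2 n_gt0) -/(f B1) -/(f B2).
have -> : \int[mu]_x f B1 x - \int[mu]_x f B2 x = \int[mu]_x (f B1 x + - 1 * f B2 x).
  rewrite RintegralD//; [|exact: tail_integrable t1|exact: tail_integrable t2].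
  rewrite RintegralZl ?mulN1r//; exact: tail_integrable (tail_growth 0 c2 n_gt0).
have -> : 2 * K * (2 * iota n%:R) `^ th =
    (K + `|- 1| * K) * (iota n%:R + iota n%:R) `^ th.
  by rewrite normrN1 mul1r -!mulr2n !mulr_natl.
apply: (tail_mean_le t12 mF Fi); first exact: expR_ge0.
have low B x : controlled B -> good n B x ->
    expR (- (n%:R * (K + gam / 40))) <= opnorm (iterate T B n x).
  move=> cB [pos dev _]; rewrite -[leRHS]lnK ?posrE// ler_expR.
  have := lyap1_real_le cB n_gt0; rewrite ler_norml => /andP[lo _].
  move: dev; rewrite ler_distl => /andP[dev _].
  apply: le_trans dev; have := ler_wpM2l (ltW nR) lo; lra.
apply: filterS (iterate_dist hT h0 hB2 hB1 hB) => x /(_ n) hd nF.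
have g1 : good n B1 x by apply: G1 => h1; apply: nF; left.
have g2 : good n B2 x by apply: G2 => h1; apply: nF; right.
have [p1 _ _] := g1; have [p2 _ _] := g2.
rewrite /f !log_growth_fine// mulN1r -mulrBr normrM ger0_norm ?invr_ge0 ?(ltW nR)//.
rewrite ler_pdivrMl//; apply: le_trans (ln_dist (expR_gt0 _) (low _ _ c1 g1) (low _ _ c2 g2)) _.
rewrite expRN invrK; apply: (@le_trans _ _ (n%:R * expR (n%:R * c) * h * expR (n%:R * (K + gam / 40)))).
  by rewrite ler_pM2r ?expR_gt0//; apply: le_trans (opnorm_dist _ _) hd.
rewrite -!mulrA ler_pM2l//; apply: (@le_trans _ _ (expR (n%:R * c) *
    (expR (- (n%:R * (c + K + 2 * gam))) * expR (n%:R * (K + gam / 40))))).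
  by rewrite ler_pM2l ?expR_gt0// ler_pM2r ?expR_gt0.
rewrite -!expRD ler_expR; have : 0 < n%:R * gam by exact: mulr_gt0.
lra.
Qed.

(** By invariance the six terms of [ln_opnorm_quadruple] integrate to [2 l(4n) + l(n) - 3 l(2n)],
    the increment of [2 l(2n) - l(n)]. The absolute values of their coefficients add up to 6, whence
    [6 K] on the exceptional set. *)
Lemma gap_step B n : controlled B -> (n0 <= n)%N -> (0 < n)%N ->
  6 * expR (2 - n%:R * gam / 2) <= 1 -> lam - gam / 40 <= lyap1_real (2 * n) B ->
  lyap1_real (2 * n) B <= lyap1_real n B ->
  `|(2 * lyap1_real (2 * (2 * n)) B - lyap1_real (2 * n) B)
     - (2 * lyap1_real (2 * n) B - lyap1_real n B)|
    <= 9 * expR (2 - n%:R * gam / 2) + 6 * K * (7 * iota n%:R) `^ th.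
Proof.
have aux1 (N l g : R) : N * (2 * l - g) - 2 * (N * (l - g / 40 - g / 40)) <= - (N * (9 / 10 * g)).
  by lra.
have aux2 (N l g : R) : 0 < N * g ->
    2 * N * (2 * l - g) - 2 * (2 * N * (l - g / 40 - g / 40)) <= - (N * (9 / 10 * g)).
  by move=> ?; lra.
move=> cB n0n n_gt0 small lam2 l2l; have gam0 := gam_gt0.
have nR : 1 <= n%:R :> R by rewrite ler1n.
have n2n : (n <= 2 * n)%N by rewrite leq_pmull.
have n2_gt0 : (0 < 2 * n)%N by exact: leq_trans n2n.
have n4_gt0 : (0 < 2 * (2 * n))%N by rewrite muln_gt0.
have n02 : (n0 <= 2 * n)%N by exact: leq_trans n2n.
have i2 : iota (2 * n)%N%:R <= iota n%:R by apply: (devm_anti hi); rewrite ?ltr0n ?ler_nat.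
have sg2 k : exists F, [/\ measurable F, (mu F <= (iota n%:R)%:E)%E &
    forall x, ~ F x -> good (2 * n) B (iter k T x)].
  have [F [mF Fi GF]] := shifted_good k cB n02; exists F; split=> //.
  by apply: le_trans Fi _; rewrite lee_fin.
(* Seven exceptional sets: four blocks of length [n] and three of length [2 n], the latter also of
   measure at most [iota n] because [iota] decreases. *)
have [F0 [mF0 F0i G0]] := shifted_good 0 cB n0n.
have [F1 [mF1 F1i G1]] := shifted_good n cB n0n.
have [F2 [mF2 F2i G2]] := shifted_good (n + n) cB n0n.
have [F3 [mF3 F3i G3]] := shifted_good (n + n + n) cB n0n.
have [E0 [mE0 E0i H0]] := sg2 0%N.
have [E1 [mE1 E1i H1]] := sg2 n.
have [E2 [mE2 E2i H2]] := sg2 (n + n)%N.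
have [mU1 U1] := union_bound mF0 mF1 F0i F1i.
have [mU2 U2] := union_bound mU1 mF2 U1 F2i.
have [mU3 U3] := union_bound mU2 mF3 U2 F3i.
have [mU4 U4] := union_bound mU3 mE0 U3 E0i.
have [mU5 U5] := union_bound mU4 mE1 U4 E1i.
have [mU U] := union_bound mU5 mE2 U5 E2i.
pose f j k x := fine (log_growth T B j (iter k T x)).
pose N : R := n%:R.
have N0 : 0 < N by exact: lt_le_trans nR.
have ts (b : R) j k : (0 < j)%N -> tail_bound mu th (fun x => b * f j k x) (`|b| * K).
  by move=> j0; exact: (tail_scale b (tail_growth k cB j0)).
have t6 := tail_add (tail_add (tail_add (tail_add (tail_add
  (ts 2 _ 0%N n4_gt0) (ts 2^-1 _ (n + n)%N n_gt0)) (ts 2^-1 _ n n_gt0))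
  (ts (- 1) _ (n + n)%N n2_gt0)) (ts (- 1) _ n n2_gt0)) (ts (- 1) _ 0%N n2_gt0).
have Iadd g h Kg Kh : tail_bound mu th g Kg -> tail_bound mu th h Kh ->
    \int[mu]_x (g x + h x) = \int[mu]_x g x + \int[mu]_x h x.
  by move=> tg tk; apply: RintegralD => //; [exact: tail_integrable tg|exact: tail_integrable tk].
have Is (b : R) j k : (0 < j)%N -> \int[mu]_x (b * f j k x) = b * lyap1_real j B.
  move=> j0; rewrite RintegralZl//; first by rewrite (integral_growth k cB j0).
  exact: tail_integrable (tail_growth k cB j0).
have -> : (2 * lyap1_real (2 * (2 * n)) B - lyap1_real (2 * n) B)
     - (2 * lyap1_real (2 * n) B - lyap1_real n B) =
    \int[mu]_x (2 * f (2 * (2 * n))%N 0%N x + 2^-1 * f n (n + n)%N x + 2^-1 * f n n x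
      + - 1 * f (2 * n)%N (n + n)%N x + - 1 * f (2 * n)%N n x + - 1 * f (2 * n)%N 0%N x).
  have t1 := ts 2 _ 0%N n4_gt0; have t2 := tail_add t1 (ts 2^-1 _ (n + n)%N n_gt0).
  have t3 := tail_add t2 (ts 2^-1 _ n n_gt0).
  have t4 := tail_add t3 (ts (- 1) _ (n + n)%N n2_gt0).
  have t5 := tail_add t4 (ts (- 1) _ n n2_gt0).
  rewrite (Iadd _ _ _ _ t5 (ts (- 1) _ 0%N n2_gt0)) (Iadd _ _ _ _ t4 (ts (- 1) _ n n2_gt0)).
  rewrite (Iadd _ _ _ _ t3 (ts (- 1) _ (n + n)%N n2_gt0)) (Iadd _ _ _ _ t2 (ts 2^-1 _ n n_gt0)).
  rewrite (Iadd _ _ _ _ t1 (ts 2^-1 _ (n + n)%N n_gt0)) !Is//.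
  by field.
have -> : 6 * K * (7 * iota n%:R) `^ th = (`|2| * K + `|2^-1| * K + `|2^-1| * K + `|- 1| * K + `|- 1| * K
     + `|- 1| * K) * (iota n%:R + iota n%:R + iota n%:R + iota n%:R + iota n%:R
     + iota n%:R + iota n%:R) `^ th.
  rewrite normrN1 ger0_norm// ger0_norm ?invr_ge0//; congr (_ * _ `^ _); last by ring.
  by field.
apply: (tail_mean_le t6 mU U); first by rewrite mulr_ge0// expR_ge0.
apply: aeW => x nU.
have g0 : good n B x by apply: G0 => h; apply: nU; do 6 left.
have g1 : good n B (iter n T x) by apply: G1 => h; apply: nU; do 5 left; right.
have g2 : good n B (iter (n + n) T x) by apply: G2 => h; apply: nU; do 4 left; right.
have g3 : good n B (iter (n + n + n) T x) by apply: G3 => h; apply: nU; do 3 left; right.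
have h0 : good (2 * n) B x by apply: H0 => h; apply: nU; do 2 left; right.
have h1 : good (2 * n) B (iter n T x) by apply: H1 => h; apply: nU; left; right.
have h2 : good (2 * n) B (iter (n + n) T x) by apply: H2 => h; apply: nU; right.
have ell_le : lam - gam / 40 <= lyap1_real n B by exact: le_trans l2l.
have [_ _ hlam _] := cB; have lam1 := hlam _ n0n.
have s1 := good_singval2 g1 ell_le; have s2 := good_singval2 g2 ell_le.
have s21 := good_singval2 h1 lam2.
move: g0 g1 g2 g3 h0 h1 h2 => [p0 d0 _] [p1 d1 _] [p2 d2 _] [p3 d3 _]
  [q0 k0 _] [q1 k1 _] [q2 k2 _].
have i1 : iter n T (iter n T x) = iter (n + n) T x by rewrite -iterD.
have i3 : iter n T (iter (n + n) T x) = iter (n + n + n) T x by rewrite -iterD addnA.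
have [p4 main] : 0 < opnorm (iterate T B (2 * (2 * n)) x) /\
    `|2 * ((4 * N)^-1 * ln (opnorm (iterate T B (2 * (2 * n)) x)))
    + 2^-1 * (N^-1 * ln (opnorm (iterate T B n (iter (n + n) T x))))
    + 2^-1 * (N^-1 * ln (opnorm (iterate T B n (iter n T x))))
    + - 1 * ((2 * N)^-1 * ln (opnorm (iterate T B (2 * n) (iter (n + n) T x))))
    + - 1 * ((2 * N)^-1 * ln (opnorm (iterate T B (2 * n) (iter n T x))))
    + - 1 * ((2 * N)^-1 * ln (opnorm (iterate T B (2 * n) x)))| <= 9 * expR (2 - N * gam / 2).
  move: q0 k0 q1 k1 q2 k2 s21; rewrite iterate_quadruple !iterate_double i1 i3 natrM.
  move=> q0 k0 q1 k1 q2 k2 s21.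
  apply: (ln_opnorm_quadruple m_gt0 nR gam0 lam2 l2l lam1); last exact: small.
  - by move=> g; rewrite !inE => /or4P[] /eqP->.
  - by move=> g; rewrite !inE => /or3P[] /eqP->.
  move=> g; rewrite !inE => /or3P[] /eqP->.
  - by apply: le_trans s2 _; rewrite ler_pM2r// ler_expR.
  - by apply: le_trans s1 _; rewrite ler_pM2r// ler_expR.
  by apply: le_trans s21 _; rewrite ler_pM2r// ler_expR; apply: aux2; exact: mulr_gt0.
rewrite /f !log_growth_fine//= !natrM mulrA -natrM.
exact: main.
Qed.

End GapEstimates.

Lemma conj_exponent_bounds {R : realType} (p : \bar R) : (1 < p)%E ->
  0 < fine (1 - p^-1)%E /\ fine (1 - p^-1)%E <= 1.
Proof.
case: p => [r| |] //; last by rewrite invey sube0.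
rewrite lte_fin => r1; have r0 : 0 < r by lra.
rewrite inver gt_eqF//=; have : r^-1 < 1 by rewrite invf_lt1.
have : 0 < r^-1 by rewrite invr_gt0.
by move=> *; split; lra.
Qed.

(** * One-dimensional cocycles, for the determinant *)

Section DimensionOne.
Context {d : measure_display} {X : measurableType d} {R : realType}.
Variables (mu : probability X R) (T : X -> X).
Hypothesis hT : measure_preserving mu T.
Variable m : nat.
(** The dimension stays a variable because the application is to the top exterior power, of
    dimension ['C(m, m)], which is equal but not convertible to 1. *)
Hypothesis m1 : m = 1%N.
Implicit Types (g h : 'M[R]_m) (A B : X -> 'M[R]_m).

Lemma opnormM1 g h : opnorm (g *m h) = opnorm g * opnorm h.
Proof.
have m0 : (0 < m)%N by rewrite m1.
have sc (u : 'M[R]_m) : exists a, u = a%:M.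
  move: (u); rewrite m1 => v; exists (v 0 0); apply/matrixP => i j.
  by rewrite !ord1 mxE eqxx mulr1n.
have ops (a : R) : opnorm (a%:M : 'M[R]_m) = `|a|.
  by rewrite -(scalemx1 m a) opnormZ opnorm1// mulr1.
by have [a ->] := sc g; have [b ->] := sc h; rewrite -scalar_mxM !ops normrM.
Qed.

Lemma log_int_dim1 A c n : bounded_cocycle mu A c -> (0 < n)%N ->
  log_int mu T A n = (n%:R%:E * log_int mu T A 1)%E.
Proof.
move=> hA; case: n => // n _; elim: n => [|n IH]; first by rewrite mul1e.
have e : log_int mu T A (n.+1 + 1) = (log_int mu T A n.+1 + log_int mu T A 1)%E.
  rewrite /log_int -(integral_iter hT 1 (measurable_log_norm hT hA n.+1)).
  have u1 := log_norm_ui hT hA 1.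
  have u2 : upper_integrable mu (fun x => log_norm T A n.+1 (iter 1 T x)).
    apply: (ui_bounded (c := n.+1%:R * c)).
    - exact: measurableT_comp (measurable_log_norm hT hA n.+1) (measurable_iter hT 1).
    - by move=> x; exact: log_norm_lty.
    exact: (ae_iter hT 1 (log_norm_le hT hA n.+1)).
  have [_ <-] := ui_add u2 u1; apply: eq_integral => x _.
  by rewrite /log_norm iterateD opnormM1 lneM_ge0 ?opnorm_ge0.
rewrite -addn1 e IH -[X in (_ + X)%E]mul1e -ge0_muleDl ?lee_fin//.
by rewrite -EFinD natr1 addn1.
Qed.

(** The norm is multiplicative in dimension one, so the finite scale exponent does not depend on the
    scale. *)
Lemma lyap1_dim1 A c : bounded_cocycle mu A c -> lyap_inf mu T A = lyap1_fin mu T 1 A.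
Proof.
move=> hA; have e n : (0 < n)%N -> lyap1_fin mu T n A = lyap1_fin mu T 1 A.
  move=> n_gt0; rewrite !(lyap1_finE hT hA) (log_int_dim1 hA n_gt0) muleA -EFinM.
  by rewrite mulVf ?pnatr_eq0 -?lt0n// invr1.
apply/eqP; rewrite eq_le (lyap_inf_le _ _ _ (ltn0Sn 0)) /=.
by apply/ereal_infP => _ [n /= n_gt0 <-]; rewrite e.
Qed.

(** No large deviations are involved: the L^p bound makes the set where [|A|] is tiny negligible for
    both log norms, and away from it the logarithm is Lipschitz. *)
Lemma lyap1_dim1_lsc A c (p : \bar R) (K eps : R) : (1 < p)%E -> bounded_cocycle mu A c ->
  0 < eps -> ('N[mu]_p[log_growth T A 1] < K%:E)%E ->
  exists2 delta : R, 0 < delta & forall B e, bounded_cocycle mu B c ->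
    ('N[mu]_p[log_growth T B 1] < K%:E)%E ->
    {ae mu, forall x, opnorm (A x - B x) <= e} -> e < delta ->
    `|lyap1_real mu T 1 A - lyap1_real mu T 1 B| <= eps.
Proof.
move=> hp hA eps0 NA; have [th0 th1] := conj_exponent_bounds hp.
set th := fine _ in th0 th1.
have mg (D : X -> 'M[R]_m) : bounded_cocycle mu D c -> measurable_fun [set: X] (log_growth T D 1).
  by move=> hD; apply: measurable_funeM; exact: measurable_log_norm hT _ _ _ hD 1.
have tA := tail_Lnorm hp (mg A hA) NA; rewrite -/th in tA; have [mfA K0 _] := tA.
have it1 (D : X -> 'M[R]_m) x : iterate T D 1 x = D x by rewrite /= mulmx1.
have fE (D : X -> 'M[R]_m) x : 0 < opnorm (D x) ->
    fine (log_growth T D 1 x) = ln (opnorm (D x)).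
  by move=> pos; rewrite log_growth_fine it1// invr1 mul1r.
(* The measure of the exceptional set is chosen so that both tails together, [2 K v^th], take at
   most [eps / 2]; the added 1 covers [K = 0]. *)
pose v := (eps / 2 / (2 * K + 1)) `^ th^-1.
have K1 : 0 < 2 * K + 1 by rewrite ltr_wpDl ?mulr_ge0.
have v0 : 0 < v by rewrite powR_gt0 ?divr_gt0.
have vE : 2 * K * v `^ th <= eps / 2.
  rewrite -powRrM mulVf ?gt_eqF// powRr1; last by rewrite !divr_ge0 ?ltW.
  by rewrite mulrCA ger_pMr ?divr_gt0// ler_pdivrMr// mul1r lerDl.
(* Chebyshev: on [F] the log norm of [A] exceeds [s] in absolute value, so [s mu(F) <= K] and
   [mu(F) <= v]. *)
pose s := (K + 1) / v; have s0 : 0 < s by rewrite divr_gt0// ltr_wpDl.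
pose F := [set x | opnorm (A x) < expR (- s)].
have mA : measurable_fun [set: X] (fun x => opnorm (A x)).
  by case: hA => _ mA _ _; exact: measurable_opnorm.
have mF : measurable F.
  rewrite -[X in measurable X]setTI.
  by apply: (@measurable_fun_ltr _ _ _ _ _ (cst _) mA _ measurableT [set true]).
have Fv : (mu F <= v%:E)%E.
  have le : (\int[mu]_(x in F) (cst s%:E) x <= \int[mu]_(x in F) (`|fine (log_growth T A 1 x)|)%:E)%E.
    apply: ae_ge0_le_integral => //.
    - by move=> x _; rewrite lee_fin ltW.
    - by apply: measurable_funTS; apply/measurable_EFinP; exact: measurableT_comp.
    apply: filterS (Lnorm_fin_num hp (mg A hA) NA) => x fx Fx.
    have pos : 0 < opnorm (A x).
      rewrite ltNge; apply/negP => le0; move: fx.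
      by rewrite /log_growth it1 le0_lneNy ?lee_fin// invr1 mul1e.
    rewrite lee_fin fE// ler0_norm.
      by rewrite lerNr -[leRHS]expRK ler_ln ?posrE ?expR_gt0// ltW.
    rewrite ln_le0// (le_trans (ltW Fx))// -expR0 ler_expR lerNl oppr0 ltW//.
  have [_ _ tb] := tA; have F1 : (mu F <= 1%:E)%E by exact: probability_le1.
  have := le_trans le (tb F 1 mF F1); rewrite integral_cst// powR1 mulr1.
  have mFf : (fine (mu F))%:E = mu F.
    by rewrite fineK// ge0_fin_numE// (le_lt_trans F1)// ltry.
  have -> : (s%:E * (mu : {measure set X -> \bar R}) F = (s * fine (mu F))%:E)%E.
    exact: (congr1 (fun z => s%:E * z)%E (esym mFf)).
  rewrite -mFf !lee_fin mulrC -ler_pdivlMr// => /le_trans; apply.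
  rewrite /s invf_div mulrA ler_pdivrMr ?ltr_wpDl// [leRHS]mulrC.
  by rewrite ler_pM2r// lerDl.
(* The second term keeps [|B|] above [exp(-s) / 2] off [F]; the logarithm then has Lipschitz
   constant [2 exp s] there, and the first term leaves [eps / 2]. *)
exists (Num.min (eps / 4 * expR (- s)) (expR (- s) / 2)).
  by rewrite lt_min !mulr_gt0 ?divr_gt0 ?expR_gt0.
move=> B e hB NB AB; rewrite lt_min => /andP[e1 e2].
have tB := tail_Lnorm hp (mg B hB) NB; rewrite -/th in tB.
have tNB := tail_scale (- 1) tB; have tAB := tail_add tA tNB.
rewrite (lyap1_fin_real hT hp hA NA).2 (lyap1_fin_real hT hp hB NB).2.
have -> : \int[mu]_x fine (log_growth T A 1 x) - \int[mu]_x fine (log_growth T B 1 x) =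
    \int[mu]_x (fine (log_growth T A 1 x) + - 1 * fine (log_growth T B 1 x)).
  rewrite RintegralD//; [|exact: tail_integrable tA|exact: tail_integrable tNB].
  by rewrite RintegralZl ?mulN1r//; exact: tail_integrable tB.
have e0 : 0 <= eps / 2 by rewrite divr_ge0// ltW.
apply: le_trans (tail_mean_le tAB mF Fv e0 _) _; last first.
  by rewrite normrN1 mul1r -mulr2n -mulr_natl; move: vE; lra.
apply: filterS AB => x ABx nF.
have Ax : expR (- s) <= opnorm (A x) by rewrite leNgt; apply/negP.
have dAB := le_trans (opnorm_dist (A x) (B x)) ABx.
have Bx : expR (- s) / 2 <= opnorm (B x).
  by move: dAB; rewrite ler_distl => /andP[_ ?]; lra.
have E0 := expR_gt0 (- s); have E2 : 0 < expR (- s) / 2 by rewrite divr_gt0.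
rewrite (fE A) ?(lt_le_trans E0)// (fE B) ?(lt_le_trans E2)// mulN1r.
apply: le_trans (ln_dist E2 _ Bx) _; first by lra.
rewrite ler_pdivrMr//; apply: le_trans dAB _; lra.
Qed.

End DimensionOne.

(** * Continuity and modulus of continuity *)

Section Continuity.
Context {d : measure_display} {X : measurableType d} {R : realType}.
Variables (mu : probability X R) (T : X -> X).
Hypothesis hT : measure_preserving mu T.
Variables (C : forall m : nat, set (X -> 'M[R]_m))
  (dist : forall m : nat, (X -> 'M[R]_m) -> (X -> 'M[R]_m) -> R).
Hypothesis hC : cocycle_space mu C dist.
Variables (Xi : set (X -> R)) (E I : set (R -> R))
  (P : set (nat * (R -> R) * (R -> R))).
Hypothesis hXi : forall xi : X -> R, Xi xi -> measurable_fun [set: X] xi.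
Hypothesis hP : LDT_parameters E I P.
Variable p : \bar R.
Hypothesis hp : (1 < p)%E.
Hypothesis hcompat : forall (m : nat) (A : X -> 'M[R]_m), (0 < m)%N -> C A ->
  compatible mu T Xi A.
Hypothesis hbase : forall xi : X -> R, Xi xi -> base_LDT mu T P xi.
Hypothesis hLp : forall (m : nat) (A : X -> 'M[R]_m), (0 < m)%N -> C A ->
  (-oo < lyap mu T 1 A)%E -> unif_Lp_bounded mu T C dist p A.
Hypothesis hfiber : forall (m : nat) (A : X -> 'M[R]_m), (1 < m)%N -> C A ->
  (lyap mu T 2 A < lyap mu T 1 A)%E -> unif_fiber_LDT mu T P C dist A.
Local Notation th := (fine (1 - p^-1)%E).

Lemma ext_dist_lt m k (A : X -> 'M[R]_m) (r : R) : (0 < k <= m)%N -> C A -> 0 < r ->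
  exists2 delta : R, 0 < delta & forall B, C B -> dist B A < delta ->
    dist (ext_cocycle k B) (ext_cocycle k A) < r.
Proof.
move=> km CA r0; have m0 : (0 < m)%N by case/andP: km => /leq_trans h /h.
have [delta [K [delta0 lip]]] := cocycle_ext_lipschitz hC km CA.
have K0 : 0 < `|K| + 1 by rewrite ltr_wpDl.
exists (Num.min delta (r / (`|K| + 1))); first by rewrite lt_min delta0 divr_gt0.
move=> B CB; rewrite lt_min => /andP[Bd Br].
apply: le_lt_trans (lip B A CB CA Bd _) _; first by rewrite (cocycle_dist_refl hC).
have D0 := cocycle_dist_ge0 hC m0 CB CA.
move: Br; rewrite ltr_pdivlMr// mulrC => /(le_lt_trans _); apply.
by rewrite ler_wpM2r// (le_trans (ler_norm _))// lerDl.
Qed.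

(** The fiber-LDT with precision [gam / 40], the L^p bound and the uniform upper bound on finite
    scale exponents are applied to [A], and the one-sided estimate [lyap1_nusc] to its exterior
    square, whose top exponent [L_1 + L_2] is below [2 lam - gam]. Two exceptional sets lead to the
    sum of two deviation functions. *)
Lemma gap_controlled m (A : X -> 'M[R]_m) : (1 < m)%N -> C A ->
  (lyap mu T 2 A < lyap mu T 1 A)%E ->
  exists (delta lam gam c K : R) (iota : R -> R) (n0 : nat),
  [/\ 0 < delta, 0 < gam, (0 < n0)%N, I iota & lyap mu T 1 A = lam%:E /\
    forall B, C B -> dist B A < delta -> controlled mu T p lam gam c K iota n0 B].
Proof.
move=> m1 CA gap; have m0 : (0 < m)%N by exact: ltnW.
have [c hc] := class_bounded hC m0 CA.
have hA : bounded_cocycle mu A c by apply: hc; rewrite ?(cocycle_dist_refl hC m0 CA).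
have lt1 : (lyap mu T 1 A < +oo)%E by apply: (lyap_lty hT hA); rewrite m0.
have gt1 : (-oo < lyap mu T 1 A)%E by apply: le_lt_trans gap; rewrite leNye.
have [lam lamE] : exists lam, lyap mu T 1 A = lam%:E.
  by exists (fine (lyap mu T 1 A)); rewrite fineK// fin_numElt gt1.
(* Half of [L_1 - L_2]; when [L_2] is [-oo] any positive number does. *)
have [gam gam0 sum2] : exists2 gam, 0 < gam & (lyap_sum mu T 2 A < (2 * lam - gam)%:E)%E.
  rewrite /lyap_sum big_nat_recr//= big_nat1 lamE; move: gap; rewrite lamE.
  case: (lyap mu T 2 A) => [r| |]// gap.
    rewrite lte_fin in gap; exists ((lam - r) / 2); first by rewrite divr_gt0// subr_gt0.
    by rewrite -EFinD lte_fin; lra.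
  by exists 1 => //; rewrite addeNy ltNyr.
have [dK [K [dK0 hK]]] := hLp m0 CA gt1.
have g40 : 0 < gam / 40 by rewrite divr_gt0.
have [df [nf [e [i1 [df0 Pe hf]]]]] := hfiber m1 CA gap g40.
have [nf0 _ Ii1] := ldt_triplet hP Pe.
have [du [nu [du0 nu0 hu]]] : exists (delta : R) (n0 : nat), [/\ 0 < delta, (0 < n0)%N &
    forall B, C B -> dist B A < delta -> forall n, (n0 <= n)%N ->
      (lyap1_fin mu T n B <= (lam + gam / 160)%:E)%E].
  by apply: (lyap1_usc hT hC m0 CA); rewrite lamE lte_fin ltrDl divr_gt0.
have k2 : (0 < 2 <= m)%N by [].
have CE := cocycle_ext hC k2 CA.
have mE : (0 < 'C(m, 2))%N by rewrite bin_gt0.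
have [d3 [n3 [i3 [d30 n30 Ii3 h3]]]] : exists (delta : R) (n0 : nat) (iota : R -> R),
  [/\ 0 < delta, (0 < n0)%N, I iota &
    forall B, C B -> dist B (ext_cocycle 2 A) < delta -> forall n, (n0 <= n)%N ->
      (mu [set x | (n%:R * (2 * lam - gam))%:E < log_norm T B n x] <= (iota n%:R)%:E)%E].
  apply: (lyap1_nusc hT hC hXi hP hcompat hbase mE CE).
  by rewrite (lyap1_ext hT hA).
have [d4 d40 h4] := ext_dist_lt k2 CA d30.
exists (Num.min (Num.min dK df) (Num.min du (Num.min d4 1))), lam, gam, c, K,
  (fun t => i1 t + i3 t), (maxn nf (maxn nu n3)).
split=> //.
- by rewrite !lt_min dK0 df0 du0 d40 ltr01.
- by rewrite !leq_max nf0.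
- exact: (ldt_add hP).
split=> // B CB; rewrite !lt_min => /and3P[/andP[BK Bf] Bu /andP[B4 B1]].
have hB := hc B CB B1; have NB := hK B CB BK.
have cE := cocycle_ext hC k2 CB.
have real n : (0 < n)%N -> lyap1_fin mu T n B = (lyap1_real mu T n B)%:E.
  by move=> n_gt0; have [] := lyap1_fin_real hT hp hB (NB n n_gt0).
split=> //.
  move=> n; rewrite !geq_max => /and3P[_ un _].
  by rewrite -lee_fin -real ?(leq_trans nu0 un)//; exact: hu.
move=> n; rewrite !geq_max => /and3P[fn un n3n].
have n_gt0 : (0 < n)%N by exact: leq_trans un.
have [en bad] := hf B CB Bf n fn.
have bad3 := h3 _ cE (h4 B CB B4) n n3n.
pose F1 := [set x | `|log_growth T B n x - lyap1_fin mu T n B| > (e n%:R)%:E]%E.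
pose F3 := [set x | (n%:R * (2 * lam - gam))%:E < log_norm T (ext_cocycle 2 B) n x]%E.
have mF1 : measurable F1.
  rewrite -[X in measurable X]setTI; apply: emeasurable_fun_o_infty => //.
  apply: measurableT_comp => //; apply: emeasurable_funB => //.
  by apply: measurable_funeM; exact: measurable_log_norm hT _ _ _ hB n.
have mF3 : measurable F3.
  rewrite -[X in measurable X]setTI; apply: emeasurable_fun_o_infty => //.
  exact: (measurable_log_norm hT (bounded_ext m1 hB) n).
exists (F1 `|` F3); split; first exact: measurableU.
  by rewrite EFinD; apply: le_trans (measureU2 _ mF1 mF3) (leeD (ltW bad) bad3).
move=> x nF.
have nF1 : (`|log_growth T B n x - lyap1_fin mu T n B| <= (e n%:R)%:E)%E.
  by rewrite leNgt; apply/negP => h; apply: nF; left.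
have nF3 : (log_norm T (ext_cocycle 2 B) n x <= (n%:R * (2 * lam - gam))%:E)%E.
  by rewrite leNgt; apply/negP => h; apply: nF; right.
have nR : 0 < n%:R :> R by rewrite ltr0n.
(* With norm 0 the growth would be [-oo], at infinite distance from its real mean, and [x] would lie
   in [F1]. *)
have pos : 0 < opnorm (iterate T B n x).
  rewrite ltNge; apply/negP => le0; move: nF1.
  by rewrite (real n n_gt0) /log_growth le0_lneNy ?lee_fin// gt0_muleNy ?lte_fin ?invr_gt0.
split=> //.
  move: nF1; rewrite (real n n_gt0) /log_growth lne_EFin// -EFinM -EFinB lee_fin => h.
  have := le_trans h en; rewrite -(ler_pM2l nR) -{1}(ger0_norm (ltW nR)) -normrM mulrBr.
  by rewrite mulVKf ?gt_eqF.
by apply: lne_le_expR_inv; rewrite -iterate_ext.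
Qed.

(** All errors of [gap_step] and [gap_close] are brought to the form [Kt * a n] required by
    [doubling_scheme]. The conclusion keeps the scale [n] free: lower semicontinuity fixes one large
    [n], the modulus lets [n] depend on the distance. *)
Lemma gap_continuity_scale m (A : X -> 'M[R]_m) : (1 < m)%N -> C A ->
  (lyap mu T 2 A < lyap mu T 1 A)%E ->
  exists (r K' cc C2 : R) (iota : R -> R) (n0 : nat),
  [/\ 0 < r, 0 <= K', 0 < cc, 0 < C2 & I iota /\
    forall B1 B2, C B1 -> C B2 -> dist B1 A < r -> dist B2 A < r ->
    lyap mu T 1 B1 \is a fin_num /\ forall n, (n0 <= n)%N -> dist B1 B2 <= expR (- (n%:R * C2)) ->
      `|fine (lyap mu T 1 B1) - fine (lyap mu T 1 B2)| <= K' * iota (cc * n%:R) `^ th].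
Proof.
move=> m1 CA gap; have m0 : (0 < m)%N by exact: ltnW.
have [delta [lam [gam [c [K [iota [n0 [delta0 gam0 n00 Ii [lamE ctrl]]]]]]]]] := gap_controlled m1 CA gap.
have hi := ldt_measure hP Ii; have [th0 th1] := conj_exponent_bounds hp.
have cA : controlled mu T p lam gam c K iota n0 A.
  by apply: ctrl; rewrite ?(cocycle_dist_refl hC m0 CA).
have K0 : 0 <= K by exact: le_trans (normr_ge0 _) (lyap1_real_le hT hp cA (ltn0Sn 0)).
have c0 : 0 <= c by case: cA => -[].
have [K1 K10 [t0 [t00 iota_exp]]] := devm_exp hi.
(* [cc <= 1] gives [iota(n) <= iota(cc n)]; the other bound gives [exp(-n gam / 2) <= iota(cc n)]
   through [devm_exp]. *)
pose cc := Num.min 1 (gam / (2 * K1)).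
have cc0 : 0 < cc by rewrite lt_min ltr01 divr_gt0// mulr_gt0.
have [S [nS [S0 hS]]] := devm_sum hi cc0 th0.
have [n1 _ /(_ n1 (leqnn n1)) hn1] := nbhs_infty_gtr (t0 / cc).
have [n2 _ /(_ n2 (leqnn n2)) hn2] := nbhs_infty_gtr ((2 + ln 6) / (gam / 2)).
pose N := maxn (maxn n0 nS) (maxn n1 n2).
pose a n := iota (cc * n%:R) `^ th.
(* [9 exp 2] and [42 K] are the two errors of [gap_step], where [(7 iota)^th <= 7 iota^th] because
   [th <= 1]; the constants [1] and [4 K] of [gap_close] fit below as well. *)
pose Kt := 9 * expR 2 + 42 * K + 1.
pose V (B : X -> 'M[R]_m) := C B /\ dist B A < delta.
pose l n (B : X -> 'M[R]_m) := lyap1_real mu T n B.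
pose L (B : X -> 'M[R]_m) := fine (lyap mu T 1 B).
have Nle n : (N <= n)%N -> [/\ (n0 <= n)%N, (nS <= n)%N, (n1 <= n)%N, (n2 <= n)%N & (0 < n)%N].
  rewrite !geq_max => /andP[/andP[h1 h2] /andP[h3 h4]]; split=> //.
  exact: leq_trans h1.
have ccn n : (0 < n)%N -> 0 < cc * n%:R by move=> ?; rewrite mulr_gt0 ?ltr0n.
have age0 n : 0 <= a n by exact: powR_ge0.
have aexp n : (N <= n)%N -> expR (- (n%:R * gam / 2)) <= a n.
  move=> /Nle[_ _ n1n _ n_gt0]; have nR : 0 < n%:R :> R by rewrite ltr0n.
  have le1 : expR (- (n%:R * gam / 2)) <= 1.
    by rewrite -expR0 ler_expR oppr_le0 divr_ge0// mulr_ge0// ltW.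
  apply: (@le_trans _ _ (expR (- (n%:R * gam / 2)) `^ th)).
    rewrite -{1}(powRr1 (expR_ge0 _)); apply: ger_powR th1.
    by rewrite expR_gt0.
  apply: ge0_ler_powR; rewrite ?nnegrE ?expR_ge0 ?(ltW th0)//.
    exact/ltW/(devm_gt0 hi)/ccn.
  apply: le_trans (iota_exp _ _); last first.
    by rewrite mulrC -ler_pdivrMr//; apply: le_trans (ltW hn1) _; rewrite ler_nat.
  rewrite ler_expR lerN2; have : cc <= gam / (2 * K1) by rewrite ge_min lexx orbT.
  rewrite ler_pdivlMr ?mulr_gt0// => h.
  have := ler_wpM2r (ltW nR) h; lra.
have aiota n k : (0 < n)%N -> (k%:R * iota n%:R) `^ th <= k%:R * a n.
  move=> n_gt0; case: k => [|k]; first by rewrite !mul0r powR0 ?gt_eqF.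
  have i0 : 0 <= iota n%:R by apply/ltW/(devm_gt0 hi); rewrite ltr0n.
  rewrite powRM//; apply: ler_pM; rewrite ?powR_ge0//.
    rewrite -[leRHS]powRr1//; apply: ler_powR th1; by rewrite ler1n.
  apply: ge0_ler_powR; rewrite ?nnegrE ?(ltW th0)//.
    exact/ltW/(devm_gt0 hi)/ccn.
  apply: (devm_anti hi); first exact: ccn.
  by rewrite ler_piMl// ge_min lexx.
have aanti n k : (N <= n <= k)%N -> a k <= a n.
  move=> /andP[/Nle[_ _ _ _ n_gt0] nk].
  apply: ge0_ler_powR; rewrite ?nnegrE ?(ltW th0)//.
  - exact/ltW/(devm_gt0 hi)/ccn/(leq_trans n_gt0).
  - exact/ltW/(devm_gt0 hi)/ccn.
  by apply: (devm_anti hi); [exact: ccn|rewrite ler_pM2l// ler_nat].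
have acvg e : 0 < e -> exists n3, forall n, (n3 <= n)%N -> a n <= e.
  exact: (devm_powR_small hi cc0 th0).
have asum n J : (N <= n)%N -> \sum_(j < J) a (2 ^ j * n)%N <= S * a n.
  by move=> /Nle[_ nSn _ _ n_gt0]; exact: hS.
have fin B : V B -> [/\ lyap mu T 1 B = (L B)%:E, lyap mu T 1 B = lyap_inf mu T B &
    forall n, (0 < n)%N -> lyap1_fin mu T n B = (l n B)%:E].
  move=> [CB BA]; have cB := ctrl B CB BA; have [hB NB _ _] := cB.
  have real n : (0 < n)%N -> lyap1_fin mu T n B = (l n B)%:E.
    by move=> n_gt0; have [] := lyap1_fin_real hT hp hB (NB n n_gt0).
  split=> //; last exact: (lyap1_inf hT hC m0 CB).
  rewrite /L fineK// (lyap1_inf hT hC m0 CB) fin_numElt; apply/andP; split.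
    apply: (@lt_le_trans _ _ (- K)%:E); first exact: ltNyr.
    apply/ereal_infP => _ [n /= n_gt0 <-]; rewrite real// lee_fin.
    by have := lyap1_real_le hT hp cB n_gt0; rewrite ler_norml => /andP[].
  exact: (lyap_inf_lty hT hB).
have lcvg B e : V B -> 0 < e -> exists n3, forall n, (n3 <= n)%N -> l n B <= L B + e.
  move=> VB e0; have [LE infE real] := fin B VB; have [CB BA] := VB.
  have [hB _ _ _] := ctrl B CB BA.
  have := cvg_lyap_inf hT hB; rewrite -infE LE => /fine_cvgP[_ /cvgrPdist_le/(_ e e0)[n3 _ h]].
  exists n3 => n /h /=; rewrite distrC ler_distl => /andP[_]; exact.
have lge B n : V B -> (0 < n)%N -> L B <= l n B.
  move=> VB n_gt0; have [LE infE real] := fin B VB.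
  by rewrite -lee_fin -real// -LE infE; exact: lyap_inf_le.
have ldbl B n : V B -> (0 < n)%N -> l (2 * n)%N B <= l n B.
  move=> VB n_gt0; have [_ _ real] := fin B VB; have [CB BA] := VB.
  have [hB _ _ _] := ctrl B CB BA.
  have n2_gt0 : (0 < 2 * n)%N by rewrite muln_gt0.
  rewrite -lee_fin -!real// !(lyap1_finE hT hB).
  apply: le_trans (lee_wpmul2l _ (log_intM hT hB n 2)) _; first by rewrite lee_fin.
  rewrite muleA -EFinM natrM invfM mulrAC mulVf// mul1r.
  exact: lexx.
have hstep B n : V B -> (N <= n)%N -> L A - gam / 40 <= l (2 * n)%N B ->
    `|extrapolate l (2 * n) B - extrapolate l n B| <= Kt * a n.
  move=> VB Nn lo; have [n0n _ _ n2n n_gt0] := Nle n Nn; have [CB BA] := VB.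
  have LA : L A = lam by rewrite /L lamE.
  have small : 6 * expR (2 - n%:R * gam / 2) <= 1.
    have : (2 + ln 6) / (gam / 2) <= n%:R by apply: le_trans (ltW hn2) _; rewrite ler_nat.
    rewrite ler_pdivrMr ?divr_gt0// => h.
    rewrite -[X in X * _](@lnK _ 6) ?posrE// -expRD -[leRHS]expR0 ler_expR; lra.
  rewrite LA in lo.
  apply: le_trans (gap_step hT hp m1 gam0 hi (ctrl B CB BA) n0n n_gt0 small lo (ldbl _ _ VB n_gt0)) _.
  rewrite expRD; have := ler_wpM2l (expR_ge0 2) (aexp n Nn).
  have := ler_wpM2l (mulr_ge0 (ler0n R 6) K0) (aiota n 7 n_gt0).
  have := age0 n; rewrite /Kt; lra.
have hclose B1 B2 n : V B1 -> V B2 -> (N <= n)%N ->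
    dist B1 B2 <= expR (- (n%:R * (c + K + 2 * gam))) -> `|l n B1 - l n B2| <= Kt * a n.
  move=> [CB1 BA1] [CB2 BA2] Nn hd; have [n0n _ _ n2n n_gt0] := Nle n Nn.
  apply: le_trans (gap_close hT hp gam0 (ctrl _ CB1 BA1) (ctrl _ CB2 BA2) n0n n_gt0
    (cocycle_dist_ge0 hC m0 CB1 CB2) (class_dist hC m0 CB1 CB2) hd) _.
  have e1 : expR (- (n%:R * gam)) <= a n.
    apply: le_trans (aexp n Nn); rewrite ler_expR lerN2 ler_piMr ?invf_le1 ?ler1n//.
    by rewrite mulr_ge0// ltW.
  have := ler_wpM2l (mulr_ge0 (ler0n R 2) K0) (aiota n 2 n_gt0).
  have := mulr_ge0 K0 (age0 n); have := mulr_ge0 (expR_ge0 2) (age0 n).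
  by rewrite /Kt; lra.
have Kt0 : 0 <= Kt by rewrite !addr_ge0 ?mulr_ge0 ?expR_ge0.
have C10 : 0 < c + K + 2 * gam by rewrite ltr_wpDl ?addr_ge0 ?mulr_gt0.
have N0 : (0 < N)%N by rewrite /N !leq_max n00.
have VA : V A by split=> //; rewrite (cocycle_dist_refl hC m0 CA).
have e0 : 0 < gam / 40 by rewrite divr_gt0.
have [r [K' [r0 K'0 hr]]] := doubling_scheme e0 C10 Kt0 S0 N0 VA (fun n _ => age0 n) aanti
   acvg asum lcvg lge ldbl hstep hclose.
exists (Num.min delta r), K', cc, (2 * (c + K + 2 * gam)), iota, N; split=> //.
- by rewrite lt_min delta0.
- by rewrite mulr_gt0.
split=> // B1 B2 CB1 CB2; rewrite !lt_min => /andP[d1 r1] /andP[d2 r2].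
split; first by have [-> _ _] := fin B1 (conj CB1 d1).
by move=> n Nn hd; apply: hr => //; exact: ltW.
Qed.

(** [h] differs from [dist B1 B2] because the lemma serves exterior powers, while the modulus is
    measured in the distance of the original cocycles. The scale is the integer part of
    [log(1/h) / (2 C2)]. The factor [K'] disappears into the deviation function, multiplied by
    [s = (K' + 1)^(1/th)], as the cone property allows. *)
Lemma gap_modulus m (A : X -> 'M[R]_m) (Lip : R) : (1 < m)%N -> C A ->
  (lyap mu T 2 A < lyap mu T 1 A)%E -> 0 < Lip ->
  exists (r c : R) (iota : R -> R), [/\ 0 < r, 0 < c, I iota &
    forall B1 B2, C B1 -> C B2 -> dist B1 A < r -> dist B2 A < r ->
    lyap mu T 1 B1 \is a fin_num /\
    forall h, 0 <= h -> h < r -> dist B1 B2 <= Lip * h ->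
      `|fine (lyap mu T 1 B1) - fine (lyap mu T 1 B2)| <= modulus p iota c h].
Proof.
move=> m1 CA gap Lip0; have m0 : (0 < m)%N by exact: ltnW.
have [r [K' [cc [C2 [iota [n0 [r0 K'0 cc0 C20 [Ii H]]]]]]]] := gap_continuity_scale m1 CA gap.
have hi := ldt_measure hP Ii; have [th0 th1] := conj_exponent_bounds hp.
pose s := (K' + 1) `^ th^-1; have K1 : 0 < K' + 1 by rewrite ltr_wpDl.
have s0 : 0 < s by exact: powR_gt0.
have rootK x : 0 <= x -> (x `^ th^-1) `^ th = x.
  by move=> x0; rewrite -powRrM mulVf ?gt_eqF// powRr1.
have sE x : 0 <= x -> (s * x) `^ th = (K' + 1) * x `^ th.
  by move=> x0; rewrite powRM ?(ltW s0)// rootK// ltW.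
(* Lower bounds required of [log(1/h)]: the first makes the integer part of [q] at least [q / 2],
   the second absorbs [Lip] into half of [log(1/h)], the third brings the scale above [n0]. *)
pose M := Num.max (4 * C2) (Num.max (2 * `|ln Lip|) (4 * C2 * n0%:R)).
have M0 : 0 < M by rewrite lt_max mulr_gt0.
have hi' := ldt_measure hP (ldt_scale hP s0 Ii).
exists (Num.min r (expR (- M))), (cc / (4 * C2)), (fun t => s * iota t); split.
- by rewrite lt_min r0 expR_gt0.
- by rewrite divr_gt0// mulr_gt0.
- exact: (ldt_scale hP).
move=> B1 B2 CB1 CB2; rewrite !lt_min => /andP[r1 _] /andP[r2 _].
have [f1 HB] := H B1 B2 CB1 CB2 r1 r2; split=> // h h0.
rewrite lt_min => /andP[hr hM] hd; rewrite /modulus; case: eqP => [hz|/eqP hz].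
  (* At distance 0 the estimate holds at every scale, and its right-hand side tends to 0, the value
     of the modulus at 0. *)
  have d0 : dist B1 B2 = 0.
    by apply/eqP; rewrite eq_le (cocycle_dist_ge0 hC m0 CB1 CB2) andbT (le_trans hd)// hz mulr0.
  apply/ler_addgt0Pr => e e0; rewrite add0r.
  have ek0 : 0 < e / (K' + 1) by rewrite divr_gt0.
  have [n3 hn3] := devm_powR_small hi cc0 th0 ek0.
  have := HB _ (leq_maxl n0 n3) _; rewrite d0 expR_ge0 => /(_ isT) h1.
  apply: le_trans h1 _; have := hn3 _ (leq_maxr n0 n3).
  rewrite ler_pdivlMr// => h2; have := powR_ge0 (iota (cc * (maxn n0 n3)%:R)) th.
  by move: h2; move: (_ `^ th) => y; lra.
have hp0 : 0 < h by rewrite lt_neqAle eq_sym hz.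
pose y := ln (1 / h); have yE : y = - ln h by rewrite /y div1r lnV ?posrE.
have yM : M <= y by rewrite yE lerNr -[leRHS]expRK ler_ln ?posrE ?expR_gt0// ltW.
have [y4 [yL yn]] : 4 * C2 <= y /\ 2 * `|ln Lip| <= y /\ 4 * C2 * n0%:R <= y.
  by move: yM; rewrite !ge_max => /and3P[].
have y0 : 0 < y by exact: lt_le_trans yM.
pose q := y / (2 * C2).
have q0 : 0 <= q by rewrite divr_ge0 ?mulr_ge0 ?(ltW y0) ?(ltW C20).
have [qlo qhi] : (Num.truncn q)%:R <= q /\ q < (Num.truncn q).+1%:R.
  by have /andP[] := truncn_itv q0.
set n := Num.truncn q in qlo qhi *.
have qy : q * (2 * C2) = y by rewrite /q divfK// mulf_neq0 ?gt_eqF.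
have nlow : y / (4 * C2) <= n%:R.
  rewrite ler_pdivrMr ?mulr_gt0//; rewrite -natr1 in qhi.
  have : q * (2 * C2) < (n%:R + 1) * (2 * C2) by rewrite ltr_pM2r ?mulr_gt0.
  by rewrite qy; lra.
have n0n : (n0 <= n)%N.
  rewrite -(ler_nat R); apply: le_trans nlow.
  by rewrite ler_pdivlMr ?mulr_gt0// mulrC.
apply: le_trans (HB n n0n _) _.
  apply: le_trans hd _; rewrite -[X in X * h]lnK ?posrE// -[X in _ * X]lnK ?posrE//.
  rewrite -expRD ler_expR.
  have : n%:R * C2 <= q * C2 by rewrite ler_pM2r.
  have := ler_norm (ln Lip); move: yE qy yL; lra.
have cy : 0 < cc / (4 * C2) * y by rewrite mulr_gt0// divr_gt0// mulr_gt0.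
rewrite sE; last by apply/ltW/(devm_gt0 hi).
apply: ler_pM; rewrite ?powR_ge0//; first by rewrite lerDl.
have ccn : cc / (4 * C2) * y <= cc * n%:R by rewrite -mulrA ler_pM2l// mulrC.
apply: ge0_ler_powR; rewrite ?nnegrE ?(ltW th0)//.
- by apply/ltW/(devm_gt0 hi); exact: lt_le_trans ccn.
- exact/ltW/(devm_gt0 hi).
exact: (devm_anti hi).
Qed.

Variables (m : nat) (A : X -> 'M[R]_m).
Hypotheses (m0 : (0 < m)%N) (CA : C A).
Implicit Types B : X -> 'M[R]_m.

Definition class_near (Q : (X -> 'M[R]_m) -> Prop) :=
  exists2 delta : R, 0 < delta & forall B, C B -> dist B A < delta -> Q B.

Lemma class_near2 (Q1 Q2 Q : (X -> 'M[R]_m) -> Prop) : class_near Q1 -> class_near Q2 ->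
  (forall B, C B -> Q1 B -> Q2 B -> Q B) -> class_near Q.
Proof.
move=> [d1 d10 h1] [d2 d20 h2] h; exists (Num.min d1 d2); first by rewrite lt_min d10.
by move=> B CB; rewrite lt_min => /andP[B1 B2]; apply: h => //; [exact: h1|exact: h2].
Qed.

Lemma near_bounded : exists c, class_near (fun B => bounded_cocycle mu B c).
Proof. by have [c hc] := class_bounded hC m0 CA; exists c; exists 1. Qed.

Let refl_near Q : class_near Q -> Q A.
Proof. by move=> [e e0]; apply; rewrite ?(cocycle_dist_refl hC m0 CA). Qed.

Lemma lyap_sum_usc k t : (0 < k <= m)%N -> (lyap_sum mu T k A < t%:E)%E ->
  class_near (fun B => (lyap_sum mu T k B < t%:E)%E).
Proof.
move=> km At; have [c nb] := near_bounded; have hA := refl_near nb.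
have km' : (k <= m)%N by case/andP: km.
have CE := cocycle_ext hC km CA; have mE : (0 < 'C(m, k))%N by rewrite bin_gt0.
have [s As st] : exists2 s : R, (lyap_sum mu T k A < s%:E)%E & s < t.
  move: At; case: (lyap_sum mu T k A) => [x| |] //.
    by rewrite lte_fin => xt; exists ((x + t) / 2); rewrite ?lte_fin; lra.
  by move=> _; exists (t - 1); rewrite ?ltNyr// ltrBlDr ltrDl.
rewrite -(lyap1_ext hT hA km') in As.
have [d1 [n0 [d10 n00 h]]] := lyap1_usc hT hC mE CE As.
have [d2 d20 hd] := ext_dist_lt km CA d10.
have nd : class_near (fun B => dist (ext_cocycle k B) (ext_cocycle k A) < d1) by exists d2.
apply: (class_near2 nb nd) => B CB hB nB.
rewrite -(lyap1_ext hT hB km') (lyap1_inf hT hC mE (cocycle_ext hC km CB)).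
apply: (@le_lt_trans _ _ s%:E); last by rewrite lte_fin.
exact: le_trans (lyap_inf_le _ _ _ n00) (h _ (cocycle_ext hC km CB) nB _ (leqnn n0)).
Qed.

(* The indices at which [lyap_sum k] is also lower semicontinuous. *)
Definition splitting k := [\/ k = 0%N, (0 < k < m)%N /\ (lyap mu T k.+1 A < lyap mu T k A)%E |
  k = m /\ (-oo < lyap mu T k A)%E].

Lemma lyap_sum_lsc k (eps : R) : splitting k -> 0 < eps ->
  lyap_sum mu T k A \is a fin_num /\
  class_near (fun B => ((fine (lyap_sum mu T k A) - eps)%:E < lyap_sum mu T k B)%E).
Proof.
have aux (L y a b : R) : 0 < eps -> y * (L + 1) <= eps / 2 -> a - L * y <= b -> 0 <= y ->
    a - eps < b.
  by move=> *; lra.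
have aux2 (a b : R) : 0 < eps -> `|a - b| <= eps / 2 -> a - eps < b.
  by move=> ?; rewrite ler_distl => /andP[_ h]; lra.
move=> sk eps0; have [c nb] := near_bounded; have hA := refl_near nb.
case: sk => [->|[km gap]|[-> Am]].
- have s0 B : lyap_sum mu T 0 B = 0%E by rewrite /lyap_sum big_geq.
  split; first by rewrite s0.
  by exists 1 => // B _ _; rewrite !s0 /= lte_fin sub0r oppr_lt0.
- case: k km gap => // k km gap.
  have km' : (0 < k.+1 <= m)%N by exact: ltnW km.
  have kle : (k.+1 <= m)%N by exact: ltnW.
  have CE := cocycle_ext hC km' CA.
  have C2 : (1 < 'C(m, k.+1))%N.
    by apply: (@leq_trans 'C(k.+2, k.+1)); [rewrite binSn|exact: leq_bin2l].
  have [r [K' [cc [C3 [iota [n0 [r0 K'0 cc0 C30 [Ii H]]]]]]]] :=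
    gap_continuity_scale C2 CE (lyap2_ext_lt hT hA km gap).
  have hi := ldt_measure hP Ii; have [th0 th1] := conj_exponent_bounds hp.
  have K1 : 0 < K' + 1 by rewrite ltr_wpDl.
  have ek0 : 0 < eps / 2 / (K' + 1) by rewrite !divr_gt0.
  have [n3 hn3] := devm_powR_small hi cc0 th0 ek0.
  (* A single scale [n] with [K' iota(cc n)^th <= eps / 2] suffices; it determines the radius
     [exp(-n C3)]. *)
  pose n := maxn n0 n3; pose e1 := Num.min r (expR (- (n%:R * C3))).
  have e10 : 0 < e1 by rewrite lt_min r0 expR_gt0.
  have [d2 d20 hd] := ext_dist_lt km' CA e10.
  have EA0 : dist (ext_cocycle k.+1 A) (ext_cocycle k.+1 A) < r.
    by rewrite (cocycle_dist_refl hC (ltnW C2) CE).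
  have [fA _] := H _ _ CE CE EA0 EA0; rewrite (lyap1_ext hT hA kle) in fA.
  have nd : class_near (fun B => dist (ext_cocycle k.+1 B) (ext_cocycle k.+1 A) < e1).
    by exists d2.
  split=> //; apply: (class_near2 nb nd) => B CB hB nB.
  have EB := cocycle_ext hC km' CB; move: nB; rewrite lt_min => /andP[Br Bn].
  have [fB /(_ n (leq_maxl _ _) (ltW Bn))] := H _ _ EB CE Br EA0.
  rewrite (lyap1_ext hT hB kle) in fB *; rewrite (lyap1_ext hT hA kle).
  have := hn3 n (leq_maxr _ _); rewrite ler_pdivlMr//.
  rewrite ler_distl -[in X in _ -> _ -> X](fineK fB) lte_fin => h2 /andP[h3 _].
  by apply: aux eps0 h2 h3 _; exact: powR_ge0.
have mm : (0 < m <= m)%N by rewrite m0 leqnn.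
have CE := cocycle_ext hC mm CA; have mE : 'C(m, m) = 1%N by exact: binn.
have mE0 : (0 < 'C(m, m))%N by rewrite mE.
have [fA _] : lyap_sum mu T m A \is a fin_num /\ lyap_sum mu T m.-1 A \is a fin_num.
  by have := @lyap_sum_fin _ _ _ _ _ hT _ _ _ hA m.-1; rewrite prednK// => /(_ (leqnn m) Am).
have gtE : (-oo < lyap mu T 1 (ext_cocycle m A))%E.
  by rewrite (lyap1_ext hT hA (leqnn m)); move: fA; rewrite fin_numElt => /andP[].
have [d1 [K [d10 hK]]] := hLp mE0 CE gtE.
have hEA := bounded_ext (leqnn m) hA.
have eps2 : 0 < eps / 2 by rewrite divr_gt0.
have NA := hK _ CE; rewrite (cocycle_dist_refl hC mE0 CE) in NA.
have [d2 d20 lsc] := lyap1_dim1_lsc hT hp hEA eps2 (NA d10 1%N (ltnSn 0)).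
have [d3 d30 hd] : exists2 d3 : R, 0 < d3 & forall B, C B -> dist B A < d3 ->
    dist (ext_cocycle m B) (ext_cocycle m A) < Num.min d1 d2.
  by apply: (ext_dist_lt mm CA); rewrite lt_min d10.
have nd : class_near (fun B => dist (ext_cocycle m B) (ext_cocycle m A) < Num.min d1 d2).
  by exists d3.
split=> //; apply: (class_near2 nb nd) => B CB hB.
rewrite lt_min => /andP[B1 B2]; have EB := cocycle_ext hC mm CB.
have NB := hK _ EB B1 1%N (ltnSn 0); have hEB := bounded_ext (leqnn m) hB.
have real (D : X -> 'M[R]_m) : C D -> bounded_cocycle mu D c ->
    ('N[mu]_p[log_growth T (ext_cocycle m D) 1] < K%:E)%E ->
    lyap_sum mu T m D = (lyap1_real mu T 1 (ext_cocycle m D))%:E.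
  move=> CD hD ND; have hED := bounded_ext (leqnn m) hD.
  rewrite -(lyap1_ext hT hD (leqnn m)) (lyap1_inf hT hC mE0 (cocycle_ext hC mm CD)).
  by rewrite (lyap1_dim1 hT mE hED) (lyap1_fin_real hT hp hED ND).1.
rewrite (real _ CA hA (NA d10 _ (ltnSn 0))) (real _ CB hB NB) lte_fin /=.
have := lsc _ _ hEB NB (class_dist hC mE0 CE EB).
rewrite (cocycle_dist_sym hC mE0 CE EB) => /(_ B2).
exact: aux2.
Qed.

Lemma lyap_sumS k B : lyap_sum mu T k.+1 B = (lyap_sum mu T k B + lyap mu T k.+1 B)%E.
Proof. by rewrite /lyap_sum big_nat_recr. Qed.

(** Induction upwards. If [L_{k+1} = L_k] at [A], the upper bound for [L_k] also bounds [L_{k+1}] of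
    the cocycles nearby. Otherwise [k] is a splitting index, and [L_{k+1}] is an upper
    semicontinuous sum minus one that is lower semicontinuous at [A]. *)
Lemma lyap_upper k (t : R) : (0 < k <= m)%N -> (lyap mu T k A < t%:E)%E ->
  class_near (fun B => (lyap mu T k B < t%:E)%E).
Proof.
have [c nb] := near_bounded; have hA := refl_near nb.
elim: k t => // k IH t km At.
have [eqk|sp] : (0 < k)%N /\ lyap mu T k.+1 A = lyap mu T k A \/ splitting k.
  case: (posnP k) => [->|k0]; first by right; constructor 1.
  have k0m : (0 < k < m)%N by rewrite k0.
  have := lyap_anti hT hA k0m; rewrite le_eqVlt => /predU1P[e|lt]; first by left.
  by right; constructor 2.
- have [k0 e] := eqk; have k0m : (0 < k < m)%N by rewrite k0.
  rewrite e in At; apply: (class_near2 nb (IH t _ At)); first by rewrite k0 ltnW//; case/andP: km.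
  by move=> B CB hB; apply: le_lt_trans; exact: (lyap_anti hT hB k0m).
have [e e0 At'] : exists2 e : R, 0 < e & (lyap mu T k.+1 A < (t - 2 * e)%:E)%E.
  move: At; case: (lyap mu T k.+1 A) => [x| |] //.
    by rewrite lte_fin => xt; exists ((t - x) / 4); rewrite ?lte_fin; lra.
  by move=> _; exists 1; rewrite ?ltNyr.
have [fA lsc] := lyap_sum_lsc sp e0.
have up : (lyap_sum mu T k.+1 A < (fine (lyap_sum mu T k A) - e + t)%:E)%E.
  rewrite lyap_sumS -(fineK fA) -addrA EFinD lteD2lE//.
  by apply: lt_trans At' _; rewrite lte_fin; lra.
apply: (class_near2 lsc (lyap_sum_usc km up)) => B CB Bl Bu.
rewrite ltNge; apply/negP => tB; move: Bu; rewrite ltNge => /negP; apply.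
by rewrite lyap_sumS EFinD; apply: leeD => //; exact: ltW.
Qed.

Let split_lower k (t : R) : (k < m)%N -> splitting k.+1 -> (t%:E < lyap mu T k.+1 A)%E ->
  class_near (fun B => (t%:E < lyap mu T k.+1 B)%E).
Proof.
have [c nb] := near_bounded; have hA := refl_near nb.
move=> km sp At; have lty : (lyap mu T k.+1 A < +oo)%E by exact: (lyap_lty hT hA).
have gt1 : (-oo < lyap mu T k.+1 A)%E by apply: lt_trans At; exact: ltNyr.
have [e e0 At'] : exists2 e : R, 0 < e & ((t + 2 * e)%:E < lyap mu T k.+1 A)%E.
  move: At lty; case: (lyap mu T k.+1 A) => [x| |] //.
  by rewrite lte_fin => xt _; exists ((x - t) / 4); rewrite ?lte_fin; lra.
have [fA lsc] := lyap_sum_lsc sp e0.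
have [_ fA'] := lyap_sum_fin hT hA km gt1.
have usc : class_near (fun B => (lyap_sum mu T k B < (fine (lyap_sum mu T k A) + e)%:E)%E).
  case: (posnP k) => [->|k0].
    have s0 B : lyap_sum mu T 0 B = 0%E by rewrite /lyap_sum big_geq.
    by exists 1 => // B _ _; rewrite !s0 /= lte_fin add0r.
  apply: lyap_sum_usc; first by rewrite k0 ltnW.
  by rewrite -[ltLHS](fineK fA') lte_fin ltrDl.
apply: (class_near2 lsc usc) => B CB Bl Bu.
rewrite ltNge; apply/negP => tB.
have h1 : (lyap_sum mu T k.+1 B <= (fine (lyap_sum mu T k A) + e + t)%:E)%E.
  by rewrite lyap_sumS EFinD; apply: leeD => //; exact: ltW.
have := lt_le_trans Bl h1; rewrite lte_fin.
have : ((fine (lyap_sum mu T k A) + (t + 2 * e))%:E < (fine (lyap_sum mu T k.+1 A))%:E)%E.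
  by rewrite (fineK fA) lyap_sumS EFinD (fineK fA') lteD2lE.
by rewrite lte_fin; lra.
Qed.

(** Induction downwards from [m]. At a splitting index [split_lower] subtracts an upper
    semicontinuous sum from one that is lower semicontinuous at [A]; otherwise [L_k = L_{k+1}] at
    [A], and the lower bound for [L_{k+1}] also serves [L_k] nearby. *)
Lemma lyap_lower k (t : R) : (0 < k <= m)%N -> (t%:E < lyap mu T k A)%E ->
  class_near (fun B => (t%:E < lyap mu T k B)%E).
Proof.
have [c nb] := near_bounded; have hA := refl_near nb.
move eq_l : (m - k)%N => l; elim: l k eq_l t => [|l IH] [|k]// eq_l t km At.
all: have gt1 : (-oo < lyap mu T k.+1 A)%E by apply: lt_trans At; exact: ltNyr.
  have km' : (k < m)%N := km.
  have e : k.+1 = m by apply/eqP; rewrite eqn_leq km' -subn_eq0 eq_l.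
  by apply: split_lower => //; constructor 3.
have k1m : (0 < k.+1 < m)%N by rewrite -(subn_gt0 k.+1 m) eq_l.
have := lyap_anti hT hA k1m; rewrite le_eqVlt => /predU1P[e|lt]; last first.
  by apply: split_lower => //; constructor 2.
rewrite -e in At; have mk : (m - k.+2)%N = l by rewrite subnS eq_l.
apply: (class_near2 nb (IH k.+2 mk t k1m At)) => B CB hB nB.
exact: lt_le_trans nB (lyap_anti hT hB k1m).
Qed.

Lemma lyap_continuous k (U : set (\bar R)) : (0 < k <= m)%N -> nbhs (lyap mu T k A) U ->
  class_near (fun B => U (lyap mu T k B)).
Proof.
move=> km; have [c nb] := near_bounded; have hA := refl_near nb.
have up := lyap_upper km; have lo := lyap_lower km; move: up lo (lyap_lty hT hA km).
case: (lyap mu T k A) => [x| |] // up lo _.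
  rewrite /nbhs /= /ereal_nbhs /= => /nbhs_ballP[e /= e0 eU].
  have lo' : class_near (fun B => ((x - e)%:E < lyap mu T k B)%E).
    by apply: lo; rewrite lte_fin gtrBl.
  have up' : class_near (fun B => (lyap mu T k B < (x + e)%:E)%E).
    by apply: up; rewrite lte_fin ltrDl.
  apply: (class_near2 lo' up') => B CB.
  case: (lyap mu T k B) => [y| |] //; rewrite !lte_fin => h1 h2.
  by apply: eU; rewrite /ball /= ltr_distlC h1 h2.
rewrite /nbhs /= /ereal_nbhs /= => -[M [_ MU]].
have [e e0 h] := up M (ltNyr M).
by exists e => // B CB nB; apply: MU; exact: h.
Qed.

End Continuity.

Theorem theorem1p1 (d : measure_display) (X : measurableType d) (R : realType)
    (mu : probability X R) (T : X -> X) (hT : ergodic mu T)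
    (C : forall m : nat, set (X -> 'M[R]_m))
    (dist : forall m : nat, (X -> 'M[R]_m) -> (X -> 'M[R]_m) -> R)
    (hC : cocycle_space mu C dist)
    (Xi : set (X -> R))
    (hXi : forall xi : X -> R, Xi xi -> measurable_fun [set: X] xi)
    (E I : set (R -> R)) (P : set (nat * (R -> R) * (R -> R)))
    (hP : LDT_parameters E I P)
    (p : \bar R) (hp : (1 < p)%E)
    (hcompat : forall (m : nat) (A : X -> 'M[R]_m), (0 < m)%N -> C m A ->
      compatible mu T Xi A)
    (hbase : forall xi : X -> R, Xi xi -> base_LDT mu T P xi)
    (hLp : forall (m : nat) (A : X -> 'M[R]_m), (0 < m)%N -> C m A ->
      (-oo < lyap mu T 1 A)%E -> unif_Lp_bounded mu T C dist p A)
    (hfiber : forall (m : nat) (A : X -> 'M[R]_m), (1 < m)%N -> C m A ->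
      (lyap mu T 2 A < lyap mu T 1 A)%E -> unif_fiber_LDT mu T P C dist A) :
  (forall m k : nat, (1 <= k <= m)%N ->
    forall A : X -> 'M[R]_m, C m A ->
      (lyap mu T k A < +oo)%E /\
      forall U : set (\bar R), nbhs (lyap mu T k A) U ->
        exists2 delta : R, 0 < delta &
          forall B : X -> 'M[R]_m, C m B -> dist m B A < delta ->
            U (lyap mu T k B)) /\
  (forall (m k : nat) (A : X -> 'M[R]_m), (1 <= k < m)%N -> C m A ->
    (lyap mu T k.+1 A < lyap mu T k A)%E ->
    exists (delta : R) (iota : R -> R) (c : R),
      [/\ 0 < delta, I iota, 0 < c &
        forall B1 B2 : X -> 'M[R]_m, C m B1 -> C m B2 ->
          dist m B1 A < delta -> dist m B2 A < delta ->
          (`|lyap_sum mu T k B1 - lyap_sum mu T k B2|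
             <= (modulus p iota c (dist m B1 B2))%:E)%E]).
Proof.
have hT' : measure_preserving mu T by case: hT.
split=> [m k km A CA|m [|k]// A km CA gap].
  have m0 : (0 < m)%N by case/andP: km => /leq_trans h /h.
  have [c hc] := class_bounded hC m0 CA.
  have hA : bounded_cocycle mu A c by apply: hc; rewrite ?(cocycle_dist_refl hC m0 CA).
  split; first exact: (lyap_lty hT' hA).
  by move=> U; exact: (lyap_continuous hT' hC hXi hP hp hcompat hbase hLp hfiber m0 CA).
have m0 : (0 < m)%N by exact: leq_trans km.
have km' : (0 < k.+1 <= m)%N by exact: ltnW km.
have kle : (k.+1 <= m)%N by exact: ltnW km.
have [c hc] := class_bounded hC m0 CA.
have hA : bounded_cocycle mu A c by apply: hc; rewrite ?(cocycle_dist_refl hC m0 CA).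
have C2 : (1 < 'C(m, k.+1))%N.
  by apply: (@leq_trans 'C(k.+2, k.+1)); [rewrite binSn|exact: leq_bin2l].
have [dl [K [dl0 lip]]] := cocycle_ext_lipschitz hC km' CA.
have Lip0 : 0 < `|K| + 1 by rewrite ltr_wpDl.
(* The exterior power is [|K| + 1]-Lipschitz near [A], the constant being made positive since the
   sign of [K] is not given; [h] will be the distance of the original cocycles. *)
have [r [cc [iota [r0 cc0 Ii H]]]] := gap_modulus hT' hC hXi hP hp hcompat hbase hLp hfiber
  C2 (cocycle_ext hC km' CA) (lyap2_ext_lt hT' hA km gap) Lip0.
have [d2 d20 hd] := ext_dist_lt hC km' CA r0.
(* [1] is the radius of the common norm bound, and [r / 2] keeps the mutual distance of [B1] and
   [B2] below [r] by the triangle inequality. *)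
exists (Num.min (Num.min dl 1) (Num.min d2 (r / 2))), iota, cc; split=> //.
  by rewrite !lt_min dl0 ltr01 d20 divr_gt0.
move=> B1 B2 CB1 CB2; rewrite !lt_min => /andP[/andP[l1 u1] /andP[d1 h1]]
  /andP[/andP[l2 u2] /andP[d2' h2]].
have hB1 := hc _ CB1 u1; have hB2 := hc _ CB2 u2.
have E1 := cocycle_ext hC km' CB1; have E2 := cocycle_ext hC km' CB2.
have [f1 h12] := H _ _ E1 E2 (hd _ CB1 d1) (hd _ CB2 d2').
have [f2 _] := H _ _ E2 E1 (hd _ CB2 d2') (hd _ CB1 d1).
rewrite (lyap1_ext hT' hB1 kle) in f1 h12; rewrite (lyap1_ext hT' hB2 kle) in f2 h12.
rewrite -(fineK f1) -(fineK f2) -EFinB lee_fin; apply: h12.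
- exact: (cocycle_dist_ge0 hC m0 CB1 CB2).
- apply: le_lt_trans (cocycle_dist_triangle hC m0 CB1 CA CB2) _.
  by rewrite (cocycle_dist_sym hC m0 CA CB2) [ltRHS]splitr ltrD.
apply: le_trans (lip _ _ CB1 CB2 l1 l2) _.
rewrite ler_wpM2r ?(cocycle_dist_ge0 hC m0 CB1 CB2)//.
by rewrite (le_trans (ler_norm _))// lerDl.
Qed.
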